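(* Let $V$ be a dg vector space (in (2) and (4), endowed with a symmetric non-degenerate scalar product). (1) Consider the automorphism $\mathrm{tw}$ of the functor $A\mapsto \mathrm{MC}(\tilde{\mathfrak c}(V),A)$ on formal cdgas given by $\mathrm{tw}:(m,\xi)\mapsto(m^\xi,-\xi)$. This automorphism is induced by an $L_\infty$ automorphism of $\tilde{\mathfrak c}(V)$ (denoted by the same symbol) with components $\mathrm{tw}_n:(\Pi\tilde{\mathfrak c}(V))^{\otimes n}\to\Pi\tilde{\mathfrak c}(V)$, $n\ge1$, as follows. For $f\in\mathrm{Hom}(S^{k+n-1}\Pi V,\Pi V)$ with $k\ge1$ and $w_1,\dots,w_{n-1}\in\Pi V$, the element $\mathrm{tw}_n(\Pi f,w_1,\dots,w_{n-1})$ lies in $\Pi\mathrm{Hom}(S^k\Pi V,\Pi V)\subset\Pi\tilde{\mathfrak c}(V)$ and is (the parity shift of) the map $$(x_1,\dots,x_k)\mapsto f(w_1,\dots,w_{n-1},x_1,\dots,x_k).$$ In addition $\mathrm{tw}_1(w)=-w$ for $w\in\Pi V$. The value of $\mathrm{tw}_n$ on any other collection of homogeneous elements (up to symmetry) is zero. (2) The automorphism $\mathrm{tw}:(m,\xi)\mapsto(m^\xi,-\xi)$ of the functor $A\mapsto\mathrm{MC}(\widetilde{\mathfrak{cs}}(V),A)$ is induced by an $L_\infty$ automorphism of $\widetilde{\mathfrak{cs}}(V)$ which is the restriction of the $L_\infty$ automorphism in (1). (3) The automorphism $\mathrm{tw}:(m,\xi)\mapsto(m^\xi,-\xi)$ of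 the functor $A\mapsto\mathrm{MC}(\tilde{\mathfrak a}(V),A)$ is induced by an $L_\infty$ automorphism of $\tilde{\mathfrak a}(V)$ with components $\mathrm{tw}_n:(\Pi\tilde{\mathfrak a}(V))^{\otimes n}\to\Pi\tilde{\mathfrak a}(V)$, $n\ge1$, as follows. For $f\in\mathrm{Hom}((\Pi V)^{\otimes (n-1+k)},\Pi V)$ with $k\ge1$ and $w_1,\dots,w_{n-1}\in\Pi V$, the element $\mathrm{tw}_n(\Pi f,w_1,\dots,w_{n-1})$ lies in $\Pi\mathrm{Hom}((\Pi V)^{\otimes k},\Pi V)$ and is (the parity shift of) the map $$(x_1,\dots,x_k)\mapsto\sum_{\sigma\in S_{n-1}}f\big(\sigma(w_1\otimes\dots\otimes w_{n-1})\mid x_1,\dots,x_k\big).$$ In addition $\mathrm{tw}_1(w)=-w$ for $w\in\Pi V$. The value of $\mathrm{tw}_n$ on any other collection of homogeneous elements (up to symmetry) is zero. (4) The automorphism $\mathrm{tw}:(m,\xi)\mapsto(m^\xi,-\xi)$ of the functor $A\mapsto\mathrm{MC}(\widetilde{\mathfrak{as}}(V),A)$ is induced by an $L_\infty$ automorphism of $\widetilde{\mathfrak{as}}(V)$ which is the restriction of the $L_\infty$ automorphism in (3).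
   Context: $\mathbf k$ is a field of characteristic $0$; all vector spaces are $\mathbb Z/2$-graded, dg means differential $\mathbb Z/2$-graded, $\Pi$ is parity reversion, Koszul signs are used throughout. A formal cdga $A$ is obtained by adjoining a unit to an inverse limit $A_+$ of finite-dimensional nilpotent non-unital commutative dg algebras; tensor products with $A_+$ are completed. An $L_\infty$ structure on a dg vector space $(U,d)$ is a collection of odd (super)symmetric maps $m_n:(\Pi U)^{\otimes n}\to\Pi U$, $n\ge1$, equivalently an odd continuous derivation $m$ of $\hat S\Pi U^*$ without constant term, with $d(m)+\frac12[m,m]=0$. An $A_\infty$ structure is the analogous notion without symmetry, with $\hat T\Pi U^*$ in place of $\hat S\Pi U^*$. In the $A$-linear version $m_n:(\Pi U)^{\otimes n}\to A_+\otimes\Pi U$ and the differential includes $d_A$. $\mathrm{MC}(U,A)$ is the set of even $\xi\in A_+\otimes\Pi U$ with $d(\xi)+\sum_{i\ge1}\frac1{i!}m_i(\xi^{\otimes i})=0$ (in the $A_\infty$ case $d(\xi)+\sum_{i\ge1}m_i(\xi^{\otimes i})=0$), where $d=d_A\otimes\mathrm{id}+\mathrm{id}\otimes d_{\Pi U}$. An $L_\infty$ map $U\to W$ is a continuous map of dg algebras $\hat S\Pi W^*\to\hat S\Pi U^*$, where these carry the differentials $d+m$; dually it is a collection of even symmetric components $F_n:(\Pi U)^{\otimes n}\to\Pi W$, $n\ge1$, and it induces the map $\mathrm{MC}(U,A)\to\mathrm{MC}(W,A)$, $\eta\mapsto\sum_{n\ge1}\frac1{n!}F_n(\eta^{\otimes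 n})$. Twisting: for an $A$-linear $L_\infty$ structure $m$ on $V$ and $\xi\in\mathrm{MC}(V,A)$, the twisted structure $m^\xi=e^\xi me^{-\xi}-d_{A\otimes\Pi V}(\xi)$ ($\xi$ viewed as a constant derivation) is the $A$-linear $L_\infty$ structure with $m_n^\xi(x_1,\dots,x_n)=\sum_{i\ge0}\frac1{i!}m_{n+i}(\xi,\dots,\xi,x_1,\dots,x_n)$, with $i$ copies of $\xi$. In the $A_\infty$ case $m_n^\xi(x_1,\dots,x_n)=\sum_{i\ge0}m_{n+i}(\xi,\dots,\xi\mid x_1,\dots,x_n)$. Here, for a multilinear $f$ of arity $p+k$, $f(w_1,\dots,w_p\mid x_1,\dots,x_k)$ denotes the sum, with Koszul signs, of $f(z_1,\dots,z_{p+k})$ over all $\binom{p+k}{p}$ ways of interleaving $w_1,\dots,w_p$ (in order) with $x_1,\dots,x_k$ (in order). $\mathfrak c(V)$ is the dg Lie algebra of continuous derivations of $\hat S\Pi V^*$ vanishing at zero, identified with $\prod_{n\ge1}\mathrm{Hom}(S^n\Pi V,\Pi V)$, with bracket the graded commutator of $(g\circ h)(w_1,\dots)=\sum_{\text{shuffles}}\pm g(h(w_I),w_J)$. $\mathfrak a(V)$ is the dg Lie algebra of continuous derivations of $\hat T\Pi V^*$ vanishing at zero, identified with $\prod_{n\ge1}\mathrm{Hom}((\Pi V)^{\otimes n},\Pi V)$, with bracket the graded commutator of $g\circ h=\sum_i g\circ_ih$. There is a dg Lie map $\mathfrak a(V)\to\mathfrak c(V)$ induced by the quotient $\hat T\Pi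 V^*\to\hat S\Pi V^*$, given on multilinear maps by symmetrization $g\mapsto\bar g=\sum_\sigma\pm g\circ\sigma$. If $V$ has a symmetric non-degenerate scalar product, equivalently $\Pi V$ has a linear symplectic form $\omega$, then $\mathfrak{cs}(V)\subset\mathfrak c(V)$ (resp. $\mathfrak{as}(V)\subset\mathfrak a(V)$) is the dg Lie subalgebra of symplectic derivations, i.e. those with components $g_n$ such that $\omega(g_n(x_1,\dots,x_n),x_{n+1})$ is symmetric (resp. cyclically invariant) with Koszul signs. For $\mathfrak g=\mathfrak c(V),\mathfrak{cs}(V),\mathfrak a(V),\mathfrak{as}(V)$, the $L_\infty$ algebra $\tilde{\mathfrak g}(V)$ has underlying dg space $\mathfrak g\oplus V$ and products: $m_2(\Pi g,\Pi h)=(-1)^{|g|}\Pi[g,h]$ on $\Pi\mathfrak g$; $m_n(\Pi g,w_1,\dots,w_{n-1})=g(w_1,\dots,w_{n-1})\in\Pi V$ for $w_i\in\Pi V$, $n\ge2$ and $g$ of arity $n-1$ (with $\bar g$ instead of $g$ in the cases $\mathfrak a(V),\mathfrak{as}(V)$); all other products (up to symmetry) vanish. An element of $\mathrm{MC}(\tilde{\mathfrak g}(V),A)$ is the same as a pair $(m,\xi)$ where $m$ is an $A$-linear $L_\infty$ / cyclic $L_\infty$ / $A_\infty$ / cyclic $A_\infty$ structure on $V$ respectively (cyclic meaning that $m$ is a symplectic derivation) and $\xi\in\mathrm{MC}(V,A)$ for that structure. *)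

(* Defs.v *)
From HB Require Import structures.
From mathcomp Require Import all_boot all_order all_algebra.
From mathcomp Require Import boolp functions.

Set Implicit Arguments.
Unset Strict Implicit.
Unset Printing Implicit Defensive.

Import GRing.Theory.
Local Open Scope ring_scope.

(* Multilinear maps are functions on sequences: f : seq U -> W stands for the
   family of its components f_n, n >= 0, where f_n is f on sequences of size n.
   Koszul signs are written for homogeneous arguments, whose parities are given
   by a sequence b : seq bool (true = odd). *)

Notation sgn b := ((-1) ^+ nat_of_bool b).

Definition parsum (b : seq bool) : bool := foldr addb false b.

Fixpoint words (T : Type) (L : seq T) (n : nat) : seq (seq T) :=
  if n is n'.+1 then [seq x :: w | x <- L, w <- words L n'] else [:: [::]].

(* A word w of labels splits a sequence s into the blocks blk w j s of the
   entries labelled j, in their original order. *)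
Definition blk (T : Type) (w : seq nat) (j : nat) (s : seq T) : seq T :=
  mask [seq i == j | i <- w] s.

(* The parity of the Koszul sign of the rearrangement of a sequence with
   parities b that sorts it stably by the labels w. *)
Fixpoint kodd (w : seq nat) (b : seq bool) : bool :=
  match w, b with
  | i :: w', p :: b' =>
      (p && parsum [seq (jq.1 < i)%N && jq.2 | jq <- zip w' b']) (+) kodd w' b'
  | _, _ => false
  end.

Notation ksign w b := (sgn (kodd w b)).

(* The sequence whose entries labelled 0 are those of s and whose entries
   labelled 1 are those of t, in order. *)
Fixpoint weave (T : Type) (c : seq nat) (s t : seq T) : seq T :=
  match c with
  | [::] => [::]
  | 0%N :: c' => if s is x :: s' then x :: weave c' s' t else weave c' s t
  | _.+1 :: c' => if t is x :: t' then x :: weave c' s t' else weave c' s t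
  end.

(* A Z/2-graded vector space, U = U_0 (+) U_1; the decomposition is given by
   the projection ev onto U_0 along U_1. *)
Record superspace (k : fieldType) := SuperSpace {
  scar :> lmodType k;
  ev : scar -> scar;
  ev_linear : linear ev;
  ev_idem : forall v, ev (ev v) = ev v }.

Section Super.
Variables (k : fieldType) (U : superspace k).
Implicit Types (p : bool) (u v : U) (b : seq bool) (s : seq U).

Definition pr p v : U := if p then v - ev v else ev v.
Definition hom p v : bool := pr p v == v.
Definition homs b s : bool := all2 hom b s.
Definition prs b s : seq U := [seq pr pv.1 pv.2 | pv <- zip b s].

Lemma pr_linear p : linear (pr p).
Proof.
case: p => a u v; rewrite /pr ev_linear //.
by rewrite scalerBr opprD addrACA.
Qed.

Lemma pr_pr p q v : pr p (pr q v) = if p == q then pr p v else 0.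
Proof.
have evB x y : ev (x - y : U) = ev x - ev y.
  by rewrite addrC -scaleN1r ev_linear scaleN1r addrC.
by case: p; case: q; rewrite /pr ?evB ?ev_idem ?subrr ?subr0.
Qed.

Lemma pr_hom p v : hom p (pr p v). Proof. by rewrite /hom pr_pr eqxx. Qed.

Lemma pr_dec v : v = pr false v + pr true v.
Proof. by rewrite /pr addrC subrK. Qed.

End Super.

Section Parity.
Variables (k : fieldType) (U : superspace k).

(* Pi U has the same carrier as U: the element Pi x is x itself. *)
Definition Pi : superspace k.
refine (@SuperSpace k (scar U) (@pr k U true) (@pr_linear k U true) _).
by move=> v; rewrite pr_pr.
Defined.

Lemma Pi_prE p v : @pr k Pi p v = @pr k U (~~ p) v.
Proof. by case: p; rewrite /= /pr //= subKr. Qed.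

End Parity.

Record dgspace (k : fieldType) := DgSpace {
  dsp :> superspace k;
  dif : dsp -> dsp;
  dif_linear : linear dif;
  dif_odd : forall p v, hom p v -> hom (~~ p) (dif v);
  dif_dif : forall v, dif (dif v) = 0 }.

Section DirectSum.
Variables (k : fieldType) (U W : superspace k).

Definition dsum : superspace k.
refine (@SuperSpace k (scar U * scar W)%type (fun x => (ev x.1, ev x.2)) _ _).
- by move=> a x y; congr pair; rewrite /= ev_linear.
- by case=> x y; rewrite /= !ev_idem.
Defined.

End DirectSum.

Section Multilinear.
Variables (k : fieldType).

Definition mlin_on (U W : lmodType k) (D : U -> Prop) (f : seq U -> W) : Prop :=
  forall s1 s2 a u v, (forall x, x \in s1 ++ u :: v :: s2 -> D x) ->
    f (s1 ++ (a *: u + v) :: s2) = a *: f (s1 ++ u :: s2) + f (s1 ++ v :: s2).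

Definition ksym_on (U : superspace k) (W : lmodType k) (D : U -> Prop)
    (f : seq U -> W) : Prop :=
  forall s1 s2 p q u v, hom p u -> hom q v ->
    (forall x, x \in s1 ++ u :: v :: s2 -> D x) ->
    f (s1 ++ u :: v :: s2) = sgn (p && q) *: f (s1 ++ v :: u :: s2).

Definition mlin (U W : lmodType k) (f : seq U -> W) : Prop :=
  mlin_on (fun _ => True) f.

Definition ksym (U : superspace k) (W : lmodType k) (f : seq U -> W) : Prop :=
  ksym_on (fun _ => True) f.

(* The multilinear extension to all arguments of a formula G b s that is
   written for homogeneous arguments s with parities b. *)
Definition kext (U : superspace k) (W : lmodType k)
    (G : seq bool -> seq U -> W) (s : seq U) : W :=
  \sum_(b <- words [:: false; true] (size s)) G b (prs b s).

Lemma mlinE (U W : lmodType k) (f : seq U -> W) : mlin f ->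
  forall s1 s2 a u v,
    f (s1 ++ (a *: u + v) :: s2) = a *: f (s1 ++ u :: s2) + f (s1 ++ v :: s2).
Proof. by move=> H s1 s2 a u v; apply: H. Qed.

Lemma mlin0 (U W : lmodType k) (f : seq U -> W) s1 s2 :
  mlin f -> f (s1 ++ 0 :: s2) = 0.
Proof.
move=> H; have := mlinE H s1 s2 (-1) 0 0.
by rewrite scaler0 addr0 scaleN1r addNr.
Qed.

Lemma ksymE (U : superspace k) (W : lmodType k) (f : seq U -> W) : ksym f ->
  forall s1 s2 p q u v, hom p u -> hom q v ->
    f (s1 ++ u :: v :: s2) = sgn (p && q) *: f (s1 ++ v :: u :: s2).
Proof. by move=> H s1 s2 p q u v hu hv; apply: H. Qed.

Lemma mlin_comb (U W : lmodType k) (f g : seq U -> W) c :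
  mlin f -> mlin g -> mlin (fun s => c *: f s + g s).
Proof.
move=> Hf Hg s1 s2 a u v _; rewrite (mlinE Hf) (mlinE Hg) !scalerDr !scalerA.
by rewrite mulrC addrACA.
Qed.

Lemma mlin_sum (U W : lmodType k) (I : Type) (r : seq I) (P : pred I)
    (F : I -> seq U -> W) :
  (forall i, mlin (F i)) -> mlin (fun s => \sum_(i <- r | P i) F i s).
Proof.
move=> H s1 s2 a u v _; rewrite scaler_sumr -big_split /=.
by apply: eq_bigr => i _; rewrite (mlinE (H i)).
Qed.

Lemma mlin_scale (U W : lmodType k) (f : seq U -> W) c :
  mlin f -> mlin (fun s => c *: f s).
Proof. by move=> H s1 s2 a u v _; rewrite (mlinE H) scalerDr !scalerA mulrC. Qed.

Section Kext.
Variables (U : superspace k) (W : lmodType k).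
Implicit Types (G : seq bool -> seq U -> W).

Lemma kext_nil G : kext G [::] = G [::] [::].
Proof. by rewrite /kext big_seq1. Qed.

Lemma kext_cons G x s : kext G (x :: s) =
  kext (fun b t => G (false :: b) (pr false x :: t)) s +
  kext (fun b t => G (true :: b) (pr true x :: t)) s.
Proof. by rewrite /kext /= cats0 big_cat !big_map. Qed.

Lemma eq_kext G G' s : (forall b t, G b t = G' b t) -> kext G s = kext G' s.
Proof. by move=> H; apply: eq_bigr. Qed.

Lemma kext_comb G G' a s :
  kext (fun b t => a *: G b t + G' b t) s = a *: kext G s + kext G' s.
Proof. by rewrite /kext big_split scaler_sumr. Qed.

Lemma kext0 s : kext (fun _ (_ : seq U) => 0 : W) s = 0.
Proof. by rewrite /kext big1. Qed.

Lemma kext_scale G a s : kext (fun b t => a *: G b t) s = a *: kext G s.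
Proof. by rewrite /kext scaler_sumr. Qed.

Lemma mlin_cons (f : seq U -> W) x : mlin f -> mlin (fun s => f (x :: s)).
Proof. by move=> H s1 s2 a u v _; rewrite -!cat_cons (mlinE H). Qed.

Lemma kext_mlin G : (forall b, mlin (G b)) -> mlin (kext G).
Proof.
move=> HG s1 s2 a u v _; elim: s1 G HG => [|x s1 IH] G HG.
  rewrite !cat0s !kext_cons scalerDr addrACA -!kext_comb.
  congr (_ + _); apply: eq_kext => b t; rewrite pr_linear.
    by rewrite (mlinE (HG _) [::]).
  by rewrite (mlinE (HG _) [::]).
rewrite !cat_cons !kext_cons !IH; first by rewrite scalerDr addrACA.
  by move=> b; apply: (@mlin_cons (G (_ :: b))); exact: HG.
by move=> b; apply: (@mlin_cons (G (_ :: b))); exact: HG.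
Qed.

Lemma kext_hom G b s : (forall b, mlin (G b)) -> homs b s -> kext G s = G b s.
Proof.
elim: s b G => [|x s IH] [|p b] G HG //; first by rewrite kext_nil.
rewrite /homs /= => /andP[hx hs].
have prx q : pr q x = if q == p then x else 0.
  by move/eqP: hx => hx; rewrite -{1}hx pr_pr; case: eqP => // ->.
have Hz q : kext (fun b' t => G (q :: b') (0 :: t)) s = 0.
  rewrite -[RHS](kext0 s); apply: eq_kext => b' t.
  exact: (mlin0 [::] t (HG _)).
have HG' q : forall b', mlin (fun t => G (q :: b') (x :: t)).
  by move=> b'; apply: mlin_cons.
rewrite kext_cons !prx; move: (hx); case: p {hx prx} => hx /=.
  by rewrite Hz add0r (IH b).
by rewrite Hz addr0 (IH b).
Qed.

Lemma kext_ksym G : (forall b, mlin (G b)) ->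
  (forall b1 p q b2 s1 u v s2, size b1 = size s1 -> hom p u -> hom q v ->
     G (b1 ++ p :: q :: b2) (s1 ++ u :: v :: s2) =
     sgn (p && q) *: G (b1 ++ q :: p :: b2) (s1 ++ v :: u :: s2)) ->
  ksym (kext G).
Proof.
move=> HG HS s1 s2 p q u v hu hv _; elim: s1 G HG HS => [|x s1 IH] G HG HS.
  have prE r (y : U) : hom r y -> forall r', pr r' y = if r' == r then y else 0.
    by move=> /eqP hy r'; rewrite -{1}hy pr_pr; case: eqP => // ->.
  have Hz1 r r' (y : U) :
      kext (fun b t => G [:: r, r' & b] [:: 0, y & t]) s2 = 0.
    rewrite -[RHS](kext0 s2); apply: eq_kext => b t.
    exact: (mlin0 [::] (y :: t) (HG _)).
  have Hz2 r r' (y : U) :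
      kext (fun b t => G [:: r, r' & b] [:: y, 0 & t]) s2 = 0.
    rewrite -[RHS](kext0 s2); apply: eq_kext => b t.
    exact: (mlin0 [:: y] t (HG _)).
  rewrite !cat0s !kext_cons !(prE _ _ hu) !(prE _ _ hv).
  have H: kext (fun b t => G [:: p, q & b] [:: u, v & t]) s2 =
     sgn (p && q) *: kext (fun b t => G [:: q, p & b] [:: v, u & t]) s2.
    rewrite -kext_scale; apply: eq_kext => b t.
    exact: (HS [::] p q b [::] u v t).
  by move: H {HS hu hv}; case: p; case: q => /= H;
     rewrite !(Hz1, Hz2, addr0, add0r).
rewrite !cat_cons !kext_cons scalerDr; congr (_ + _); apply: IH => //.
- by move=> b; apply: mlin_cons.
- move=> b1 p' q' b2 t1 u' v' t2 hs; rewrite -!cat_cons; apply: HS => /=.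
  by rewrite hs.
- by move=> b; apply: mlin_cons.
move=> b1 p' q' b2 t1 u' v' t2 hs; rewrite -!cat_cons; apply: HS => /=.
by rewrite hs.
Qed.

End Kext.

Lemma size_words (T : eqType) (L : seq T) n w : w \in words L n -> size w = n.
Proof.
elim: n w => [|n IH] w /=; first by rewrite inE => /eqP ->.
by case/allpairsP=> -[x t] /= [_ /IH <- ->].
Qed.

Lemma homs_prs (U : superspace k) b (s : seq U) :
  size b = size s -> homs b (prs b s).
Proof.
elim: s b => [|x s IH] [|p b] //= [] /IH hs.
by rewrite /homs /= pr_hom.
Qed.

Section Multi.
Variable (P : superspace k).
Implicit Types (f g : seq P -> P).

Definition is_multi f : Prop := f [::] = 0 /\ mlin f.
Definition is_smulti f : Prop := is_multi f /\ ksym f.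

Definition multi_pred : {pred (seq P -> P)} := fun f => `[< is_multi f >].
Definition smulti_pred : {pred (seq P -> P)} := fun f => `[< is_smulti f >].

Lemma multi_closed : submod_closed multi_pred.
Proof.
split.
  apply/asboolP; split=> // s1 s2 a u v _.
  by rewrite [RHS](_ : _ = a *: 0 + 0) // scaler0 addr0.
move=> c f g /asboolP[f0 Hf] /asboolP[g0 Hg]; apply/asboolP; split.
  by rewrite /= !fctE f0 g0 scaler0 addr0.
exact: mlin_comb.
Qed.

Lemma smulti_closed : submod_closed smulti_pred.
Proof.
have [H0 H1] := multi_closed.
split.
  apply/asboolP; split; first by have /asboolP := H0.
  move=> s1 s2 p q u v _ _ _.
  by rewrite [RHS](_ : _ = sgn (p && q) *: 0) // scaler0.
move=> c f g /asboolP[Hf Sf] /asboolP[Hg Sg]; apply/asboolP; split.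
  have := H1 c f g; rewrite /in_mem /= /multi_pred !asboolE.
  by move=> H; apply: H.
move=> s1 s2 p q u v hu hv _; rewrite /= !fctE.
by rewrite (ksymE Sf _ _ hu hv) (ksymE Sg _ _ hu hv) scalerDr !scalerA mulrC.
Qed.

HB.instance Definition _ :=
  GRing.isSubmodClosed.Build k (seq P -> P) multi_pred multi_closed.
HB.instance Definition _ :=
  GRing.isSubmodClosed.Build k (seq P -> P) smulti_pred smulti_closed.

(* The product over n >= 1 of the spaces Hom(P^{(x) n}, P). *)
Record multi := Multi { mval :> seq P -> P; _ : mval \in multi_pred }.
HB.instance Definition _ := [isSub for mval].
HB.instance Definition _ := [Choice of multi by <:].
HB.instance Definition _ := [SubChoice_isSubLmodule of multi by <:].

(* The product over n >= 1 of the spaces Hom(S^n P, P). *)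
Record smulti := SMulti { smval :> seq P -> P; _ : smval \in smulti_pred }.
HB.instance Definition _ := [isSub for smval].
HB.instance Definition _ := [Choice of smulti by <:].
HB.instance Definition _ := [SubChoice_isSubLmodule of smulti by <:].

Lemma multiP (f : multi) : is_multi f.
Proof. by case: f => f /= /asboolP. Qed.
Lemma smultiP (f : smulti) : is_smulti f.
Proof. by case: f => f /= /asboolP. Qed.

Definition mk_multi f (H : is_multi f) : multi := Multi (asboolT H).
Definition mk_smulti f (H : is_smulti f) : smulti := SMulti (asboolT H).

Definition ev_fun f : seq P -> P := kext (fun b s => pr (parsum b) (f s)).

Lemma pr0 p : pr p (0 : P) = 0.
Proof.
by have := pr_linear p (-1) (0 : P) 0; rewrite scaler0 addr0 scaleN1r addNr.
Qed.

Lemma ev_fun_mlin0 f : mlin f -> forall b, mlin (fun s => pr (parsum b) (f s)).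
Proof.
by move=> Hf b s1 s2 a u v _; rewrite (mlinE Hf) pr_linear.
Qed.

Lemma ev_fun_multi f : is_multi f -> is_multi (ev_fun f).
Proof.
case=> f0 Hf; split; first by rewrite /ev_fun kext_nil f0 pr0.
exact/kext_mlin/ev_fun_mlin0.
Qed.

Lemma parsum_cat b1 b2 : parsum (b1 ++ b2) = parsum b1 (+) parsum b2.
Proof. by elim: b1 => //= p b1 ->; rewrite addbA. Qed.

Lemma ev_fun_smulti f : is_smulti f -> is_smulti (ev_fun f).
Proof.
case=> Hf Sf; split; first exact: ev_fun_multi.
apply: kext_ksym; first by apply: ev_fun_mlin0; case: Hf.
move=> b1 p q b2 s1 u v s2 _ hu hv; rewrite (ksymE Sf _ _ hu hv).
have -> : parsum (b1 ++ p :: q :: b2) = parsum (b1 ++ q :: p :: b2).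
  by rewrite !parsum_cat /= (addbCA p).
by have := pr_linear (parsum (b1 ++ q :: p :: b2)) (sgn (p && q))
   (f (s1 ++ v :: u :: s2)) 0; rewrite pr0 !addr0.
Qed.

Lemma ev_fun_idem f : mlin f -> ev_fun (ev_fun f) = ev_fun f.
Proof.
move=> Hf; apply: funext => s; apply: eq_big_seq => b /size_words hb.
by rewrite {1}/ev_fun (kext_hom (ev_fun_mlin0 Hf) (homs_prs hb)) pr_pr eqxx.
Qed.

Lemma ev_fun_linear a f g :
  ev_fun (a *: f + g) = a *: ev_fun f + ev_fun g.
Proof.
apply: funext => s; rewrite !fctE /ev_fun -kext_comb.
by apply: eq_kext => b t; rewrite -pr_linear.
Qed.

Definition ev_multi (f : multi) : multi := mk_multi (ev_fun_multi (multiP f)).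
Definition ev_smulti (f : smulti) : smulti :=
  mk_smulti (ev_fun_smulti (smultiP f)).

(* A multilinear map f has parity p if f(x_1, ..., x_n) is homogeneous of
   parity p + |x_1| + ... + |x_n| whenever the x_i are homogeneous. *)
Definition multi_sp : superspace k.
refine (@SuperSpace k multi ev_multi _ _).
- by move=> a f g; apply: val_inj; rewrite /= ev_fun_linear.
- by move=> f; apply: val_inj; rewrite /= ev_fun_idem //; case: (multiP f).
Defined.

Definition smulti_sp : superspace k.
refine (@SuperSpace k smulti ev_smulti _ _).
- by move=> a f g; apply: val_inj; rewrite /= ev_fun_linear.
- by move=> f; apply: val_inj; rewrite /= ev_fun_idem //; case: (smultiP f) => [[]].
Defined.

End Multi.
End Multilinear.

Lemma blk_cat (T : Type) w1 w2 j (s1 s2 : seq T) : size w1 = size s1 ->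
  blk (w1 ++ w2) j (s1 ++ s2) = blk w1 j s1 ++ blk w2 j s2.
Proof. by move=> H; rewrite /blk map_cat mask_cat // size_map. Qed.

Lemma blk_cons (T : Type) i w j (x : T) s :
  blk (i :: w) j (x :: s) = if i == j then x :: blk w j s else blk w j s.
Proof. by rewrite /blk /=; case: (i == j). Qed.

Lemma big_words_cons (V : nmodType) (T : Type) (L : seq T) n (F : seq T -> V) :
  \sum_(w <- words L n.+1) F w = \sum_(x <- L) \sum_(w <- words L n) F (x :: w).
Proof. exact: (big_allpairs_dep (op := +%R)). Qed.

Lemma big_words_cat (V : nmodType) (T : Type) (L : seq T) m n (F : seq T -> V) :
  \sum_(w <- words L (m + n)) F w =
  \sum_(w1 <- words L m) \sum_(w2 <- words L n) F (w1 ++ w2).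
Proof.
elim: m F => [|m IH] F; first by rewrite big_seq1.
by rewrite addSn !big_words_cons; apply: eq_bigr => x _; apply: IH.
Qed.

Lemma kodd_swap w1 i j w2 b1 p q b2 : size w1 = size b1 ->
  kodd (w1 ++ i :: j :: w2) (b1 ++ p :: q :: b2) =
  [&& i != j, p & q] (+) kodd (w1 ++ j :: i :: w2) (b1 ++ q :: p :: b2).
Proof.
elim: w1 b1 => [|l w1 IH] [|r b1] //= => [_|[hs]].
  set X := parsum _; set Y := parsum _; set Z := kodd _ _.
  by case: ltngtP => _; case: p; case: q; rewrite //=; case: X; case: Y; case: Z.
rewrite IH // addbCA; congr (_ (+) (_ (+) _)); congr (_ && _).
rewrite !zip_cat // !map_cat !parsum_cat /=; congr (_ (+) _).
by rewrite addbCA.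
Qed.

Lemma weave_l (T : Type) c (s1 s2 t : seq T) :
  (size s1 < count_mem 0%N c)%N ->
  exists r1 r2, forall x, weave c (s1 ++ x :: s2) t = r1 ++ x :: r2.
Proof.
elim: c s1 t => [|[|i] c IH] [|y s1] [|z t] //= hc.
- by exists [::], (weave c s2 [::]).
- by exists [::], (weave c s2 (z :: t)).
- have [|r1 [r2 H]] := IH s1 [::]; first by [].
  by exists (y :: r1), r2 => x; rewrite /= -(H x).
- have [|r1 [r2 H]] := IH s1 (z :: t); first by [].
  by exists (y :: r1), r2 => x; rewrite /= -(H x).
- exact: (IH [::] [::]).
- have [|r1 [r2 H]] := IH [::] t; first by [].
  by exists (z :: r1), r2 => x; rewrite /= -(H x).
- exact: (IH (y :: s1) [::]).
- have [|r1 [r2 H]] := IH (y :: s1) t; first by [].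
  by exists (z :: r1), r2 => x; rewrite /= -(H x).
Qed.

Lemma weave_r (T : Type) c (s t1 t2 : seq T) :
  (size t1 < count (predC (pred1 0%N)) c)%N ->
  exists r1 r2, forall x, weave c s (t1 ++ x :: t2) = r1 ++ x :: r2.
Proof.
elim: c s t1 => [|[|i] c IH] [|y s] [|z t1] //= hc.
- exact: (IH [::] [::]).
- exact: (IH [::] (z :: t1)).
- have [|r1 [r2 H]] := IH s [::]; first by [].
  by exists (y :: r1), r2 => x; rewrite /= -(H x).
- have [|r1 [r2 H]] := IH s (z :: t1); first by [].
  by exists (y :: r1), r2 => x; rewrite /= -(H x).
- by exists [::], (weave c [::] t2).
- have [|r1 [r2 H]] := IH [::] t1; first by [].
  by exists (z :: r1), r2 => x; rewrite /= -(H x).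
- by exists [::], (weave c (y :: s) t2).
- have [|r1 [r2 H]] := IH (y :: s) t1; first by [].
  by exists (z :: r1), r2 => x; rewrite /= -(H x).
Qed.

Section Operations.
Variables (k : fieldType) (P : superspace k).

(* The sum over all unshuffles of s of the terms +- g(h(s_I), s_J). *)
Definition insl (W : lmodType k) (g : seq P -> W) (h : seq P -> P)
    (b : seq bool) (s : seq P) : W :=
  \sum_(w <- words [:: 0%N; 1%N] (size s))
    ksign w b *: g (h (blk w 0 s) :: blk w 1 s).


Lemma big_blk (V : nmodType) (F : seq nat -> V) m n :
  \sum_(w <- words [:: 0%N; 1%N] (m + n.+1)) F w =
  \sum_(w1 <- words [:: 0%N; 1%N] m) \sum_(w2 <- words [:: 0%N; 1%N] n)
    (F (w1 ++ 0%N :: w2) + F (w1 ++ 1%N :: w2)).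
Proof.
rewrite big_words_cat; apply: eq_bigr => w1 _.
by rewrite big_words_cons !big_cons big_nil addr0 big_split.
Qed.

Lemma big_blk2 (V : nmodType) (F : seq nat -> V) m n :
  \sum_(w <- words [:: 0%N; 1%N] (m + n.+2)) F w =
  \sum_(w1 <- words [:: 0%N; 1%N] m) \sum_(w2 <- words [:: 0%N; 1%N] n)
    ((F (w1 ++ 0%N :: 0%N :: w2) + F (w1 ++ 1%N :: 1%N :: w2)) +
     (F (w1 ++ 0%N :: 1%N :: w2) + F (w1 ++ 1%N :: 0%N :: w2))).
Proof.
rewrite big_words_cat; apply: eq_bigr => w1 _.
rewrite big_words_cons !big_cons big_nil addr0 !big_words_cons.
rewrite !big_cons !big_nil !addr0 !big_split /=.
rewrite -!addrA; congr (_ + _); by rewrite [RHS]addrC -addrA.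
Qed.

Lemma mlinZ (W : lmodType k) (f : seq P -> W) s1 s2 c u : mlin f ->
  f (s1 ++ c *: u :: s2) = c *: f (s1 ++ u :: s2).
Proof. by move=> H; rewrite -[c *: u]addr0 (mlinE H) (mlin0 _ _ H) addr0. Qed.

Lemma insl_mlin (g h : seq P -> P) b : mlin g -> mlin h -> mlin (insl g h b).
Proof.
move=> Hg Hh s1 s2 a u v _; rewrite /insl !size_cat /= !big_blk.
rewrite scaler_sumr -big_split /=; apply: eq_big_seq => w1 /size_words hw.
rewrite scaler_sumr -big_split /=; apply: eq_bigr => w2 _.
rewrite !blk_cat // !blk_cons /= (mlinE Hh) (mlinE Hg [::]).
rewrite -!cat_cons (mlinE Hg) !scalerDr !scalerA ![a * _]mulrC.
by rewrite addrACA.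
Qed.

Lemma insl_sym (g h : seq P -> P) : is_smulti g -> is_smulti h ->
  forall b1 p q b2 s1 u v s2, size b1 = size s1 -> hom p u -> hom q v ->
     insl g h (b1 ++ p :: q :: b2) (s1 ++ u :: v :: s2) =
     sgn (p && q) *: insl g h (b1 ++ q :: p :: b2) (s1 ++ v :: u :: s2).
Proof.
case=> [[_ Hg] Sg] [[_ Hh] Sh] b1 p q b2 s1 u v s2 hb hu hv.
rewrite /insl !size_cat /= !big_blk2 scaler_sumr.
apply: eq_big_seq => w1 /size_words hw; rewrite scaler_sumr.
apply: eq_bigr => w2 _; rewrite !scalerDr.
have hwb : size w1 = size b1 by rewrite hw hb.
rewrite !(kodd_swap _ _ _ p) // !blk_cat // !blk_cons /= !signr_addb.
have Sg1 (y : P) l1 l2 := ksymE Sg (y :: l1) l2 hu hv.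
rewrite (ksymE Sh _ _ hu hv) -cat_cons Sg1.
rewrite (mlinZ [::] _ _ _ Hg) /= !scalerA ![sgn (p && q) * _]mulrC.
by congr (_ + _); rewrite addrC.
Qed.

Lemma comp_smulti (g h : smulti P) : is_smulti (kext (insl g h)).
Proof.
have [[g0 Hg] Sg] := smultiP g; have [[h0 Hh] Sh] := smultiP h.
split; [split; last by apply: kext_mlin => b; apply: insl_mlin|].
  by rewrite kext_nil /insl big_seq1 /blk /= h0 (mlin0 [::] _ Hg) scaler0.
apply: kext_ksym => [b|]; first exact: insl_mlin.
exact: (insl_sym (smultiP g) (smultiP h)).
Qed.

Definition comp_s (g h : smulti P) : smulti P := mk_smulti (comp_smulti g h).

(* The sum of all g(x_1, ..., x_i, h(x_i+1, ..., x_j), x_j+1, ..., x_n), with the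
   sign obtained by moving h, of parity p, past x_1, ..., x_i. *)
Definition insa (p : bool) (g h : seq P -> P) (b : seq bool) (s : seq P) : P :=
  \sum_(j < (size s).+1) \sum_(i < j)
    sgn (p && parsum (take i b)) *:
      g (take i s ++ h (drop i (take j s)) :: drop j s).

Lemma insa_mlin p (g h : seq P -> P) b : mlin g -> mlin h -> mlin (insa p g h b).
Proof.
move=> Hg Hh s1 s2 a u v _; rewrite /insa !size_cat /=.
rewrite scaler_sumr -big_split; apply: eq_bigr => -[j /= _] _.
rewrite scaler_sumr -big_split; apply: eq_bigr => -[i /= ij] _.
rewrite scalerA [a * _]mulrC -scalerA -scalerDr; congr (_ *: _).
have E l1 (y : P) l2 x : l1 ++ y :: l2 ++ x :: s2 = (l1 ++ y :: l2) ++ x :: s2.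
  by rewrite -catA.
have E2 l1 (y : P) x : l1 ++ y :: x :: s2 = (l1 ++ [:: y]) ++ x :: s2.
  by rewrite -catA.
case: (ltnP j (size s1)) => js.
  rewrite !take_cat !drop_cat js (ltn_trans ij js).
  by rewrite !E (mlinE Hg).
case: (ltnP i (size s1)) => is1.
  rewrite !take_cat !drop_cat is1 ltnNge js /= !drop_cat is1.
  case: (j - size s1)%N => [|j'] /=; last by rewrite (mlinE Hh) (mlinE Hg).
  by rewrite !cats0 !E2 (mlinE Hg).
rewrite !take_cat !drop_cat !ltnNge is1 js /= !drop_cat !ltnNge is1 /=.
have: (i - size s1 < j - size s1)%N by rewrite ltn_sub2r // (leq_ltn_trans is1).
case: (j - size s1)%N => [|j'] //; case: (i - size s1)%N => [|i'] /= _.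
  by rewrite !cats0 (mlinE Hh [::]) (mlinE Hg).
by rewrite -!catA /= (mlinE Hg).
Qed.

Lemma comp_multi p (g h : multi P) : is_multi (kext (insa p g h)).
Proof.
have [g0 Hg] := multiP g; have [h0 Hh] := multiP h.
split; last by apply: kext_mlin => b; apply: insa_mlin.
by rewrite kext_nil /insa big_ord1 big_ord0.
Qed.

Definition comp_a p (g h : multi P) : multi P := mk_multi (comp_multi p g h).

Lemma arity1_multi (d : P -> P) : linear d ->
  is_multi (fun s => if s is [:: x] then d x else 0).
Proof.
move=> Hd; split=> // -[|x [|y s1]] [|z s2] a u v _ //=; rewrite ?Hd //;
  by rewrite scaler0 addr0.
Qed.

Lemma arity1_smulti (d : P -> P) : linear d ->
  is_smulti (fun s => if s is [:: x] then d x else 0).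
Proof.
move=> Hd; split; first exact: arity1_multi.
by move=> [|x [|y s1]] s2 p q u v _ _ _ /=; rewrite scaler0.
Qed.

(* The empty sequence is excluded: only the components of arity at least 1 are
   kept. *)
Definition plug_fun (f : seq P -> P) (ws xs : seq P) : P :=
  if xs is [::] then 0 else f (ws ++ xs).

Lemma plug_smulti (f : smulti P) ws : is_smulti (plug_fun f ws).
Proof.
have [[f0 Hf] Sf] := smultiP f; split; first split=> //.
  move=> s1 s2 a u v _; have := mlinE Hf (ws ++ s1) s2 a u v.
  by rewrite -!catA; case: s1.
move=> s1 s2 p q u v hu hv _; have := ksymE Sf (ws ++ s1) s2 hu hv.
by rewrite -!catA; case: s1.
Qed.

Definition plug_s (f : smulti P) (ws : seq P) : smulti P :=
  mk_smulti (plug_smulti f ws).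

(* With s = ws ++ xs and n the size of ws, the sum f(ws | xs) over all
   interleavings of ws with xs. *)
Definition interleave (f : seq P -> P) (n : nat) (b : seq bool) (s : seq P) : P :=
  \sum_(c <- words [:: 0%N; 1%N] (size s) | count_mem 0%N c == n)
    ksign c (weave c (take n b) (drop n b)) *:
      f (weave c (take n s) (drop n s)).

Lemma interleave_mlin f n b : mlin f -> mlin (interleave f n b).
Proof.
move=> Hf s1 s2 a u v _; rewrite /interleave !size_cat /=.
rewrite scaler_sumr -big_split.
rewrite big_seq_cond [RHS]big_seq_cond; apply: eq_bigr => c.
move=> /andP[/size_words hc /eqP hn] /=.
rewrite scalerA [a * _]mulrC -scalerA -scalerDr; congr (_ *: _).
rewrite !take_cat !drop_cat; case: ltnP => h.
  have hl : (size (drop n s1) < count (predC (pred1 0%N)) c)%N.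
    rewrite size_drop -(ltn_add2l n) (subnKC (ltnW h)) -hn count_predC hc.
    by rewrite addnS ltnS leq_addr.
  have [r1 [r2 H]] := weave_r (take n s1) s2 hl.
  by rewrite !H (mlinE Hf).
case E: (n - size s1)%N => [|n'] /=.
  have hl : (size (@nil P) < count (predC (pred1 0%N)) c)%N.
    have hh : n = size s1 by apply/eqP; rewrite eqn_leq h -subn_eq0 E.
    rewrite -(ltn_add2l n) addn0 -{2}hn count_predC hc hh.
    by rewrite addnS ltnS leq_addr.
  have [r1 [r2 H]] := weave_r (s1 ++ [::]) s2 hl.
  by rewrite (H u) (H v) (H (a *: u + v)) (mlinE Hf).
have hl : (size s1 < count_mem 0%N c)%N by rewrite hn -subn_gt0 E.
have [r1 [r2 H]] := weave_l (take n' s2) (drop n' s2) hl.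
by rewrite !H (mlinE Hf).
Qed.

Lemma plug_multi (f : multi P) ws :
  is_multi (fun xs => if xs is [::] then 0 else
                      kext (interleave f (size ws)) (ws ++ xs)).
Proof.
have [f0 Hf] := multiP f; split=> // s1 s2 a u v _.
have := kext_mlin (fun b => interleave_mlin (size ws) b Hf).
move=> /mlinE /(_ (ws ++ s1) s2 a u v).
by rewrite -!catA; case: s1.
Qed.

Definition plug_a (f : multi P) (ws : seq P) : multi P :=
  mk_multi (plug_multi f ws).

Definition rearr (T : Type) (w : seq nat) (s : seq T) : seq T :=
  flatten [seq blk w j s | j <- iota 0 (size s)].

Definition symmetrize (W : lmodType k) (g : seq P -> W) : seq P -> W :=
  kext (fun b s => \sum_(w <- permutations (iota 0 (size s)))
                     ksign w b *: g (rearr w s)).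

End Operations.

(* A finite-dimensional nilpotent non-unital commutative dg algebra. It comes
   with a homogeneous basis, in which its tensor products are written. *)
Record nilcdga (k : fieldType) := NilCdga {
  nc_car :> vectType k;
  nc_dim : nat;
  nc_basis : nc_dim.-tuple nc_car;
  nc_basisP : basis_of fullv nc_basis;
  nc_par : 'I_nc_dim -> bool;
  nc_hom := fun (p : bool) (a : nc_car) =>
    forall i, coord nc_basis i a != 0 -> nc_par i = p;
  nc_mul : nc_car -> nc_car -> nc_car;
  nc_mul_linl : forall a, linear (fun b => nc_mul b a);
  nc_mul_linr : forall a, linear (nc_mul a);
  nc_mulA : forall a b c, nc_mul a (nc_mul b c) = nc_mul (nc_mul a b) c;
  nc_mul_hom : forall p q a b, nc_hom p a -> nc_hom q b ->
    nc_hom (p (+) q) (nc_mul a b);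
  nc_mulC : forall p q a b, nc_hom p a -> nc_hom q b ->
    nc_mul a b = sgn (p && q) *: nc_mul b a;
  nc_dif : nc_car -> nc_car;
  nc_dif_linear : linear nc_dif;
  nc_dif_odd : forall p a, nc_hom p a -> nc_hom (~~ p) (nc_dif a);
  nc_dif_dif : forall a, nc_dif (nc_dif a) = 0;
  nc_leibniz : forall p a b, nc_hom p a ->
    nc_dif (nc_mul a b) = nc_mul (nc_dif a) b + sgn p *: nc_mul a (nc_dif b);
  (* products of more than nc_nil elements vanish *)
  nc_nil : nat;
  nc_nilP : forall a s, (nc_nil <= size s)%N -> foldl nc_mul a s = 0 }.

Record nilcdga_mor (k : fieldType) (A B : nilcdga k) := NilCdgaMor {
  nm_fun :> A -> B;
  nm_linear : linear nm_fun;
  nm_mul : forall a b, nm_fun (nc_mul a b) = nc_mul (nm_fun a) (nm_fun b);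
  nm_hom : forall p a, nc_hom p a -> nc_hom p (nm_fun a);
  nm_dif : forall a, nm_fun (nc_dif a) = nc_dif (nm_fun a) }.

(* A formal cdga A, given by the inverse system over a directed set whose limit
   is A_+. *)
Record formal_cdga (k : fieldType) := FormalCdga {
  fc_idx : Type;
  fc_le : fc_idx -> fc_idx -> Prop;
  fc_refl : forall i, fc_le i i;
  fc_trans : forall i j l, fc_le i j -> fc_le j l -> fc_le i l;
  fc_directed : forall i j, exists l, fc_le i l /\ fc_le j l;
  fc_inhabited : inhabited fc_idx;
  fc_alg :> fc_idx -> nilcdga k;
  fc_tr : forall i j, fc_le i j -> nilcdga_mor (fc_alg j) (fc_alg i);
  fc_tr_id : forall i (h : fc_le i i) a, fc_tr h a = a;
  fc_tr_comp : forall i j l (hij : fc_le i j) (hjl : fc_le j l)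
    (hil : fc_le i l) a, fc_tr hij (fc_tr hjl a) = fc_tr hil a }.

(* A continuous morphism A_+ -> B_+: each component A_+ -> B_j factors through
   some A_i. *)
Record formal_mor (k : fieldType) (A B : formal_cdga k) := FormalMor {
  fm_idx : fc_idx B -> fc_idx A;
  fm_map : forall j, nilcdga_mor (A (fm_idx j)) (B j);
  fm_compat : forall j j' (h : fc_le j j'),
    exists l (h1 : fc_le (fm_idx j) l) (h2 : fc_le (fm_idx j') l),
      forall a : A l, fm_map j (fc_tr h1 a) = fc_tr h (fm_map j' (fc_tr h2 a)) }.

Section Tensor.
Variable k : fieldType.
Implicit Types A B : nilcdga k.

(* A (x) U; x stands for the sum over l of e_l (x) x l, for the basis (e_l). *)
Definition tensor A (U : lmodType k) := {ffun 'I_(nc_dim A) -> U}.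

Definition nc_e A (i : 'I_(nc_dim A)) : A := tnth (nc_basis A) i.

Definition tmap A B (phi : A -> B) (U : lmodType k) (x : tensor A U) :
    tensor B U :=
  [ffun l => \sum_i coord (nc_basis B) l (phi (nc_e i)) *: x i].

Definition nc_prod A (js : seq 'I_(nc_dim A)) : A :=
  if js is j :: js' then foldl (@nc_mul k A) (nc_e j) (map (@nc_e A) js') else 0.

(* The sign in (e_1 (x) x_1, ..., e_n (x) x_n) |-> +- e_1 ... e_n (x) F(x_1, ..., x_n)
   for F of parity p, where e_i and x_i have the same parity and the parities
   are b: F is moved past all the e_i, and x_i past e_j for i < j. *)
Definition esign (p : bool) (b : seq bool) : k :=
  sgn (p && parsum b) * sgn (odd 'C(count id b, 2)).

(* F_n(x, ..., x) for an even element x of A (x) U, where F is extended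
   A-linearly and has parity p. *)
Definition tpow A (U W : lmodType k) (p : bool) (F : seq U -> W) (n : nat)
    (x : tensor A U) : tensor A W :=
  [ffun l => \sum_(js <- words (enum 'I_(nc_dim A)) n)
     (esign p (map (@nc_par k A) js) * coord (nc_basis A) l (nc_prod js)) *:
       F (map x js)].

End Tensor.

(* The data of an L_infinity algebra: a graded space U, the differential d of
   U, and the products m_n, n >= 1, which are odd maps on Pi U. The underlying
   space of the algebra is the subspace Lmem of U. *)
Record Linfty_data (k : fieldType) := LinftyData {
  Lsp :> superspace k;
  Lmem : Lsp -> Prop;
  Ldif : Lsp -> Lsp;
  Lop : seq Lsp -> Lsp }.

Section Linfty.
Variable k : fieldType.
Implicit Types L : Linfty_data k.

(* The components of d + m on Pi U; the differential of Pi U is - d. *)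
Definition Ltot L (s : seq L) : L :=
  Lop s + (if s is [:: x] then - Ldif x else 0).

(* The composition of the maps with components G and F, F even: the sum over
   all splittings of s into r blocks of +- 1/r! G_r(F(s_1), ..., F(s_r)). Empty
   blocks do not contribute as F [::] = 0. *)
Definition Lcomp (U W X : lmodType k) (G : seq W -> X) (F : seq U -> W)
    (b : seq bool) (s : seq U) : X :=
  \sum_(1 <= r < (size s).+1) (r`!%:R)^-1 *:
    \sum_(w <- words (iota 0 r) (size s))
      ksign w b *: G [seq F (blk w j s) | j <- iota 0 r].

Definition Lid (U : lmodType k) (s : seq U) : U := if s is [:: x] then x else 0.

Definition Lmems L (s : seq L) : Prop := forall x, x \in s -> Lmem x.

Record Linfty_map L L' (F : seq L -> L') : Prop := {
  Lm_nil : F [::] = 0;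
  Lm_mem : forall s, Lmems s -> Lmem (F s);
  Lm_lin : mlin_on (@Lmem k L) F;
  Lm_sym : @ksym_on k (Pi L) L' (@Lmem k L) F;
  Lm_even : forall b s, Lmems s -> @homs k (Pi L) b s ->
    @hom k (Pi L') (parsum b) (F s);
  Lm_dif : forall b s, Lmems s -> @homs k (Pi L) b s ->
    insl F (@Ltot L) b s = Lcomp (@Ltot L') F b s }.

Definition Linfty_aut L (F : seq L -> L) : Prop :=
  Linfty_map F /\
  exists2 G : seq L -> L, Linfty_map G &
    forall b s, Lmems s -> @homs k (Pi L) b s ->
      Lcomp G F b s = Lid s /\ Lcomp F G b s = Lid s.

Definition MC_eqn L (A : nilcdga k) (x : tensor A L) : Prop :=
  forall l : 'I_(nc_dim A),
    tmap (@nc_dif k A) x l + sgn (nc_par l) *: (- Ldif (x l)) +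
    \sum_(1 <= n < (nc_nil A).+1) (n`!%:R)^-1 *: tpow true (@Lop k L) n x l = 0.

Definition MC_at L (A : nilcdga k) (x : tensor A L) : Prop :=
  [/\ forall l, Lmem (x l),
      forall l, @hom k (Pi L) (nc_par l) (x l) &
      MC_eqn x].

(* Families of elements of the A_i (x) U; an element of the completed tensor
   product of A_+ and U is a compatible one. *)
Definition family L (A : formal_cdga k) := forall i, tensor (A i) L.

Definition MC L (A : formal_cdga k) (x : family L A) : Prop :=
  (forall i j (h : fc_le i j), tmap (fc_tr h) (x j) = x i) /\
  (forall i, MC_at (x i)).

Definition MC_fmap L (A B : formal_cdga k) (phi : formal_mor A B)
    (x : family L A) : family L B :=
  fun j => tmap (fm_map phi j) (x (fm_idx phi j)).

Definition MC_ind L L' (F : seq L -> L') (A : formal_cdga k) (x : family L A) :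
    family L' A :=
  fun i => \sum_(1 <= n < (nc_nil (A i)).+1) (n`!%:R)^-1 *: tpow false F n (x i).

Definition functor_aut L (T : forall A : formal_cdga k, family L A -> family L A) :
    Prop :=
  [/\ forall A (x : family L A), MC x -> MC (T A x),
      forall A (x y : family L A), MC x -> MC y ->
        (forall i, T A x i = T A y i) -> forall i, x i = y i,
      forall A (y : family L A), MC y ->
        exists2 x : family L A, MC x & forall i, T A x i = y i &
      forall A B (phi : formal_mor A B) (x : family L A), MC x ->
        forall j, MC_fmap phi (T A x) j = T B (MC_fmap phi x) j].

Definition induced_by L (T : forall A : formal_cdga k, family L A -> family L A)
    (F : seq L -> L) : Prop :=
  forall A (x : family L A), MC x -> forall i, T A x i = MC_ind F x i.

End Linfty.

Arguments Linfty_map {k} L L' F.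
Arguments Linfty_aut {k} L F.
Arguments functor_aut {k} L T.
Arguments induced_by {k} L T F.

Section Tilde.
Variables (k : fieldType) (G V : superspace k).

(* The graded commutator for a composition comp p g h, where p is the parity
   of h. *)
Definition bracket (comp : bool -> G -> G -> G) (g h : G) : G :=
  \sum_(p <- [:: false; true]) \sum_(q <- [:: false; true])
    (comp q (pr p g) (pr q h) - sgn (p && q) *: comp p (pr q h) (pr p g)).

(* The products of g~(V), for the action act of g on sequences of elements of
   Pi V. In the V-component, s_i = (Pi g, _) is moved to the front, which gives
   g(w_1, ..., w_(n-1)) for the V-components w_j of the other entries of s. In
   the g-component, Pi g has parity b_0, so that |g| = ~~ b_0. *)
Definition tilde_op (br : G -> G -> G) (act : G -> seq V -> V) :
    seq (dsum G V) -> dsum G V :=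
  @kext k (Pi (dsum G V)) (dsum G V) (fun b s =>
    (if s is [:: x; y] then sgn (~~ head false b) *: br x.1 y.1 else 0,
     \sum_(i < size s) sgn (nth false b i && parsum (take i b)) *:
       act (nth 0 s i).1 [seq x.2 | x <- take i s ++ drop i.+1 s])).

Definition tilde (D : G -> Prop) (br : G -> G -> G) (dd : G)
    (act : G -> seq V -> V) (dV : V -> V) : Linfty_data k :=
  @LinftyData k (dsum G V) (fun x => D x.1) (fun x => (br dd x.1, dV x.2))
    (tilde_op br act).

(* An element x of MC(g~(V), A) is the pair (m, xi), where m is an odd element
   of A (x) g; the sign comes from moving Pi past e_l. *)
Definition MC_m (A : nilcdga k) (x : tensor A (dsum G V)) : tensor A G :=
  [ffun l => sgn (nc_par l) *: (x l).1].
Definition MC_xi (A : nilcdga k) (x : tensor A (dsum G V)) : tensor A V :=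
  [ffun l => (x l).2].
Definition MC_pair (A : nilcdga k) (m : tensor A G) (xi : tensor A V) :
    tensor A (dsum G V) :=
  [ffun l => (sgn (nc_par l) *: m l, xi l)].

(* The twisted structure, the sum over r of c r times
   m(xi, ..., xi, x_1, ..., x_n) (resp. m(xi, ..., xi | x_1, ..., x_n)), r copies
   of xi, where plug f ws is the map f(ws, -) (resp. f(ws | -)). *)
Definition twist (c : nat -> k) (plug : G -> seq V -> G) (A : nilcdga k)
    (m : tensor A G) (xi : tensor A V) : tensor A G :=
  [ffun l => \sum_(r < nc_nil A) c r *: \sum_(i < nc_dim A)
     \sum_(js <- words (enum 'I_(nc_dim A)) r)
       (esign k (~~ nc_par i) (map (@nc_par k A) js) *
        coord (nc_basis A) l (nc_prod (i :: js))) *: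
         plug (m i) (map xi js)].

Definition tw_fun (c : nat -> k) (plug : G -> seq V -> G) (A : formal_cdga k)
    (x : forall i, tensor (A i) (dsum G V)) :
    forall i, tensor (A i) (dsum G V) :=
  fun i => MC_pair (twist c plug (MC_m (x i)) (MC_xi (x i))) (- MC_xi (x i)).

Definition tw_components (plug : G -> seq V -> G)
    (tw : seq (dsum G V) -> dsum G V) : Prop :=
  [/\ forall f ws, tw ((f, 0) :: [seq (0, w) | w <- ws]) = (plug f ws, 0),
      forall w, tw [:: (0, w)] = (0, - w),
      forall ws, size ws != 1%N -> tw [seq (0, w) | w <- ws] = 0 &
      forall f f' s, tw ((f, 0) :: (f', 0) :: s) = 0].

End Tilde.

(* A symmetric non-degenerate scalar product on V, even or odd. *)
Record scalar_product (k : fieldType) (V : dgspace k) := ScalarProduct {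
  sp :> V -> V -> k;
  sp_linl : forall y a x x', sp (a *: x + x') y = a * sp x y + sp x' y;
  sp_linr : forall x a y y', sp x (a *: y + y') = a * sp x y + sp x y';
  sp_par : bool;
  sp_hom : forall p q x y, hom p x -> hom q y -> p (+) q != sp_par -> sp x y = 0;
  sp_sym : forall p q x y, hom p x -> hom q y -> sp x y = sgn (p && q) * sp y x;
  sp_dif : forall p x y, hom p x -> sp (dif x) y + sgn p * sp x (dif y) = 0;
  sp_nondeg : forall x, (forall y, sp x y = 0) -> x = 0 }.

Section Main.
Variables (k : fieldType) (V : dgspace k).

Lemma opp_dif_linear : linear (fun x : V => - dif x).
Proof. by move=> a x y; rewrite dif_linear opprD scalerN. Qed.

Definition der_c : superspace k := smulti_sp (Pi V).
Definition der_a : superspace k := multi_sp (Pi V).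

Definition br_c (g h : der_c) : der_c := @bracket k der_c (fun _ => @comp_s k (Pi V)) g h.
Definition br_a (g h : der_a) : der_a := @bracket k der_a (@comp_a k (Pi V)) g h.

(* The differential of Pi V as an element of c(V) and of a(V); the
   differentials of these Lie algebras are the brackets with it. *)
Definition dif_c : der_c := mk_smulti (@arity1_smulti k (Pi V) _ opp_dif_linear).
Definition dif_a : der_a := mk_multi (@arity1_multi k (Pi V) _ opp_dif_linear).

(* omega(Pi x, Pi y) = (-1)^|x| <x, y> *)
Definition omega (B : scalar_product V) (x y : V) : k :=
  B (pr false x) y - B (pr true x) y.

Definition omega_fun (B : scalar_product V) (g : seq V -> V) (s : seq V) : k^o :=
  if s is x :: s' then omega B (g (belast x s')) (last x s') else 0.

Definition symplectic_c (B : scalar_product V) (g : der_c) : Prop :=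
  @ksym k (Pi V) k^o (omega_fun B (smval g)).

Definition symplectic_a (B : scalar_product V) (g : der_a) : Prop :=
  forall b p s x, @homs k (Pi V) b s -> @hom k (Pi V) p x ->
    omega_fun B (mval g) (rcons s x) =
    sgn (p && parsum b) *: omega_fun B (mval g) (x :: s).

Definition act_c (g : der_c) (s : seq V) : V := smval g s.
Definition act_a (g : der_a) (s : seq V) : V := @symmetrize k (Pi V) V (mval g) s.

Definition c_tilde := @tilde k der_c V (fun _ => True) br_c dif_c act_c (@dif k V).
Definition cs_tilde B := @tilde k der_c V (symplectic_c B) br_c dif_c act_c (@dif k V).
Definition a_tilde := @tilde k der_a V (fun _ => True) br_a dif_a act_a (@dif k V).
Definition as_tilde B := @tilde k der_a V (symplectic_a B) br_a dif_a act_a (@dif k V).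

(* The maps f(ws, -), of all arities n >= 1. *)
Definition plug_c (f : der_c) (ws : seq V) : der_c := @plug_s k (Pi V) f ws.

(* The sum over sigma of the maps f(sigma(ws) | -), of all arities n >= 1. *)
Definition plug_sym_a (f : der_a) (ws : seq V) : der_a :=
  @symmetrize k (Pi V) der_a (@plug_a k (Pi V) f) ws.

Definition tw_c (A : formal_cdga k) : family c_tilde A -> family c_tilde A :=
  @tw_fun k der_c V (fun r => (r`!%:R)^-1) plug_c A.

Definition tw_a (A : formal_cdga k) : family a_tilde A -> family a_tilde A :=
  @tw_fun k der_a V (fun _ => 1) (@plug_a k (Pi V)) A.

End Main.

Arguments plug_c {k} V f ws.
Arguments plug_sym_a {k} V f ws.
Arguments tw_c {k} V A x.
Arguments tw_a {k} V A x.

(* Main.v *)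
From mathcomp Require Import all_boot all_algebra.
From mathcomp Require Import boolp functions.
Require Import Defs.

Set Implicit Arguments.
Unset Strict Implicit.
Unset Printing Implicit Defensive.

Import GRing.Theory.
Local Open Scope ring_scope.

(** Twisting [m] by [xi] and then twisting the result by [- xi] gives back [m],
so [(m, xi) |-> (m^xi, - xi)] is an involution; the content is that it is
given, on Maurer-Cartan elements, by an L-infinity morphism whose components
can be read off from the formula for [m^xi].

Symmetric and associative structures are treated together.  A [twistable]
structure is a graded space [G] with a composition, an action of [G] on words
of [Pi V] and an operation [plug g w], which is [g(w, -)] for [c(V)] and the
symmetrization of [g(w | -)] for [a(V)].  Its one substantial axiom,
[tplug_comp], says how arguments are distributed when they are plugged into a
composition [g o h]: either [h] is left with free arguments, which gives the
composition of [plug g I] with [plug h J], or all its arguments are plugged in,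
and then [h] acts on them and its value is plugged into [g].  For [c(V)] this
holds because an unshuffle of a concatenation is a pair of unshuffles.  For
[a(V)] it is a statement on signed shuffles: cutting a shuffle into two words
is the same as cutting both factors and shuffling the pieces ([sh_dec]), the
letters on each side of a letter that is not moved form shuffles ([sh_mid]),
and shuffling a word in amounts to inserting its letters one by one
([sh_cons]).

All identities between multilinear maps are tested on words of homogeneous
letters, on which signs become parities of words and sums over label words
become the recursive operators [spl] (unshuffles) and [blks] (ordered
partitions).  For the identities that make [tw] an L-infinity automorphism it
suffices, by symmetry, to consider words in which some letters of [G] are
followed by letters of [V] ([sorted_D]).  With no letter of [G] both sides come
from the differential of [V] ([tw_tot_V]); with one, the action of [g] is
compared with the action of its twists, and an alternating sum over unshuffles
telescopes because [xi] is sent to [- xi] ([tw_tot_g], [spl_alt]); with two,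
the identity is [tplug_comp] for both orders of a bracket ([tw_tot_gg]); with
three or more everything vanishes.  In the same way [tw] composed with itself
is the identity ([tw_inv]).

To pass to Maurer-Cartan elements, [ev] evaluates a multilinear map on copies
of the element [sum e_l (x) x_l].  Since the factors [e_l] commute up to the
signs that occur in unshuffles, the evaluation of a sum over unshuffles is a
binomial sum ([ev_spl]), and with the factors [1 / n!] evaluation turns
composition of morphisms into composition of maps ([expo_comp]) and insertion
of the total structure into substitution ([expo_insl]).  The Leibniz rule in
[A] ([leibniz_ev]) accounts for the differential of [A].  The twisted
structure is the exponential of [tw]: the denominators [r!] appear in the
symmetric case, while in the associative case they cancel against the [r!]
orders in which [r] equal even arguments are plugged in ([ev_sym]).

Finally, the twisting map restricts to symplectic derivations as soon as these
are stable under [plug].  For [c(V)] that is the symmetry of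
[omega(g(x_1, ..., x_n), x_(n+1))]; for [a(V)] a rotation of its arguments
exchanges the blocks of plugged letters on the two sides of a marked letter
([symplectic_a_plug]). *)

(** * Sums over unshuffles and ordered partitions of a word *)

Section Unshuffles.
Variables (k : fieldType) (T : Type) (par : T -> bool).
Implicit Types (z I J : seq T) (W : lmodType k).

Definition lp z : bool := parsum (map par z).

Lemma lp_cat z1 z2 : lp (z1 ++ z2) = lp z1 (+) lp z2.
Proof. by rewrite /lp map_cat parsum_cat. Qed.

Lemma lp_cons a z : lp (a :: z) = par a (+) lp z.
Proof. by []. Qed.

(** The sum over all unshuffles of a word into two subwords, with the Koszul
sign.  Recursion on the first letter spares the permutations: a letter that
goes to the second subword jumps over the part I of the first one that comes
later. *)
Fixpoint spl W z (psi : seq T -> seq T -> W) : W :=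
  if z is a :: z' then
    spl z' (fun I J => psi (a :: I) J) +
    spl z' (fun I J => sgn (par a && lp I) *: psi I (a :: J))
  else psi [::] [::].

Lemma eq_spl W z (psi psi' : seq T -> seq T -> W) :
  (forall I J, psi I J = psi' I J) -> spl z psi = spl z psi'.
Proof.
by move=> H; congr (spl _ _); apply: funext => I; apply: funext => J.
Qed.

(** Only subwords with complementary sizes and parities occur, so a sign that
depends on the whole word may be rewritten inside the sum. *)
Lemma eq_spl_in (g : pred T) W z (psi psi' : seq T -> seq T -> W) : all g z ->
  (forall I J, all g I -> all g J -> (size I + size J)%N = size z ->
     lp I (+) lp J = lp z -> psi I J = psi' I J) ->
  spl z psi = spl z psi'.
Proof.
elim: z psi psi' => [|a z IH] psi psi' /=; first by move=> _ H; apply: H.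
case/andP=> ga gz H; congr (_ + _); apply: IH => // I J gI gJ hs hl.
  by apply: H => //=; rewrite ?ga // ?addSn ?hs // !lp_cons -hl addbA.
congr (_ *: _); apply: H => //=; rewrite ?ga // ?addnS ?hs //.
by rewrite !lp_cons -hl addbCA.
Qed.

Lemma spl_lin W z c (psi psi' : seq T -> seq T -> W) :
  spl z (fun I J => c *: psi I J + psi' I J) = c *: spl z psi + spl z psi'.
Proof.
elim: z psi psi' => //= a z IH psi psi'.
rewrite IH scalerDr addrACA; congr (_ + _); rewrite -IH.
by apply: eq_spl => I J; rewrite scalerDr !scalerA mulrC.
Qed.

Lemma splD W z (psi psi' : seq T -> seq T -> W) :
  spl z (fun I J => psi I J + psi' I J) = spl z psi + spl z psi'.
Proof.
rewrite -[spl z psi]scale1r -spl_lin.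
by apply: eq_spl => I J; rewrite scale1r.
Qed.

Lemma spl0 W z : spl z (fun _ _ => 0 : W) = 0.
Proof.
elim: z => //= a z IH; rewrite IH add0r -[RHS]IH.
by apply: eq_spl => I J; rewrite scaler0.
Qed.

Lemma splZ W z c (psi : seq T -> seq T -> W) :
  spl z (fun I J => c *: psi I J) = c *: spl z psi.
Proof.
rewrite -[RHS]addr0 -(spl0 W z) -spl_lin.
by apply: eq_spl => I J; rewrite addr0.
Qed.

Lemma spl_map W W' (L : W -> W') z (psi : seq T -> seq T -> W) : linear L ->
  L (spl z psi) = spl z (fun I J => L (psi I J)).
Proof.
move=> HL; have HD u v : L (u + v) = L u + L v.
  by have := HL 1 u v; rewrite !scale1r.
have H0 : L 0 = 0 by have := HL (-1) 0 0; rewrite scaler0 addr0 scaleN1r addNr.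
have HZ c u : L (c *: u) = c *: L u by have := HL c u 0; rewrite H0 !addr0.
elim: z psi => //= a z IH psi; rewrite HD !IH; congr (_ + _).
by apply: eq_spl => I J; rewrite HZ.
Qed.

Lemma spl_sum W (R : Type) (r : seq R) z (psi : R -> seq T -> seq T -> W) :
  spl z (fun I J => \sum_(i <- r) psi i I J) = \sum_(i <- r) spl z (psi i).
Proof.
elim: r => [|i r IH].
  by rewrite big_nil -[RHS](spl0 W z); apply: eq_spl => I J; rewrite big_nil.
by rewrite big_cons -IH -splD; apply: eq_spl => I J; rewrite big_cons.
Qed.

End Unshuffles.

Ltac bcase :=
  repeat match goal with
  | |- context [@lp ?T ?p ?z] => destruct (@lp T p z)
  | |- context [parsum ?z] => destruct (parsum z)
  | |- context [@fst bool ?U ?x] => destruct (@fst bool U x)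
  | |- context [?f ?x] => is_var f;
       match type of (f x) with bool => destruct (f x) end
  | |- context [?b] => is_var b; match type of b with bool => destruct b end
  end.
Ltac ssign := rewrite ?scalerA -?signr_addb ?lp_cat ?lp_cons;
  congr ((-1) ^+ nat_of_bool _ *: _); simpl; bcase; reflexivity.

Section UnshuffleTheory.
Variables (k : fieldType) (T : Type) (par : T -> bool).
Implicit Types (z I J : seq T) (W : lmodType k).
Local Notation spl := (spl par).
Local Notation lp := (lp par).

Lemma lp_split z : forall W (psi psi' : seq T -> seq T -> W),
  (forall I J, lp z = lp I (+) lp J -> psi I J = psi' I J) ->
  spl z psi = spl z psi'.
Proof.
move=> W psi psi' H; apply: (@eq_spl_in _ _ _ predT) => [|I J _ _ _ /esym].
  exact: all_predT.
exact: H.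
Qed.

(** Both sides sum over the splittings into three subwords. *)
Lemma spl_coassoc W z (psi : seq T -> seq T -> seq T -> W) :
  spl z (fun I J => spl J (psi I)) =
  spl z (fun I J => spl I (fun I1 I2 => psi I1 I2 J)).
Proof.
elim: z psi => //= a z IH psi; rewrite splD -addrA IH; congr (_ + _).
rewrite (eq_spl _ _ (fun I J => scalerDr _ _ _)) splD.
congr (_ + _).
  rewrite -(IH (fun I1 I2 J => sgn (par a && lp I1) *: psi I1 (a :: I2) J)).
  by apply: eq_spl => I J; rewrite -splZ.
pose chi I1 I2 J := sgn (par a && (lp I1 (+) lp I2)) *: psi I1 I2 (a :: J).
transitivity (spl z (fun I J => spl J (fun J1 J2 => chi I J1 J2))).
  apply: eq_spl => I J; rewrite -splZ; apply: eq_spl => J1 J2.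
  by rewrite scalerA -signr_addb /chi andb_addr.
rewrite IH; apply: eq_spl => I J; rewrite -splZ.
by apply: lp_split => I1 I2 ->.
Qed.

(** Exchanging the two subwords costs the sign of moving one past the other. *)
Lemma spl_comm W z (psi : seq T -> seq T -> W) :
  spl z psi = spl z (fun I J => sgn (lp I && lp J) *: psi J I).
Proof.
elim: z psi => [|a z IH] psi /=; first by rewrite scale1r.
rewrite addrC; congr (_ + _); rewrite IH; apply: lp_split => I J _.
  by rewrite scalerA -signr_addb lp_cons -andb_addl addbC.
by rewrite scalerA -signr_addb lp_cons andb_addr (andbC (lp I) (par a)) addKb.
Qed.

(** From the order (I, (J, K)) to the order (J, (I, K)). *)
Lemma spl_swap W z (psi : seq T -> seq T -> seq T -> W) :
  spl z (fun I M => spl M (psi I)) =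
  spl z (fun J M => spl M (fun I K => sgn (lp I && lp J) *: psi I J K)).
Proof.
rewrite !spl_coassoc; apply: eq_spl => M K.
by rewrite spl_comm; apply: eq_spl => I J; rewrite andbC.
Qed.

(** An unshuffle of a concatenation is a pair of unshuffles. *)
Lemma spl_cat W z1 z2 (psi : seq T -> seq T -> W) :
  spl (z1 ++ z2) psi =
  spl z1 (fun I1 J1 => spl z2 (fun I2 J2 =>
    sgn (lp J1 && lp I2) *: psi (I1 ++ I2) (J1 ++ J2))).
Proof.
elim: z1 psi => [|a z IH] psi /=.
  by apply: eq_spl => I J; rewrite scale1r.
rewrite !IH; congr (_ + _); apply: lp_split => I J _.
by rewrite -splZ; apply: lp_split => I' J' _; ssign.
Qed.

Lemma spl_nill W z (phi : seq T -> W) :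
  spl z (fun I J => if I is [::] then phi J else 0) = phi z.
Proof.
elim: z phi => //= a z IH phi; rewrite spl0 add0r -[RHS](IH (fun J => phi (a :: J))).
by apply: eq_spl => -[|b I] J; rewrite ?andbF ?scale1r ?scaler0.
Qed.

Lemma spl_nilr W z (phi : seq T -> W) :
  spl z (fun I J => if J is [::] then phi I else 0) = phi z.
Proof.
rewrite spl_comm -[RHS]spl_nill.
by apply: eq_spl => -[|b I] J; rewrite ?scale1r ?scaler0.
Qed.

(** Moving one letter to the front is an unshuffle whose first part is that
letter. *)
Definition front W z (K : T -> seq T -> W) : W :=
  spl z (fun I J => if I is [:: a] then K a J else 0).

Lemma front_cons W a z (K : T -> seq T -> W) :
  front (a :: z) K =
  K a z + front z (fun c J => sgn (par a && par c) *: K c (a :: J)).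
Proof.
rewrite /front /= -[K a z](spl_nill z (K a)); congr (_ + _).
apply: eq_spl => -[|b [|c I]] J; rewrite ?scaler0 //.
by rewrite /lp /= addbF.
Qed.

(** The sum over ordered partitions of a word into r blocks, empty blocks
included.  Empty blocks are harmless for functions that vanish on them, and make
the exponential formulas uniform. *)
Fixpoint blks W r z (Xi : seq (seq T) -> W) : W :=
  if r is r'.+1 then spl z (fun I J => blks r' J (fun B => Xi (I :: B)))
  else if z is [::] then Xi [::] else 0.

Lemma eq_blks W r z (Xi Xi' : seq (seq T) -> W) :
  (forall B, Xi B = Xi' B) -> blks r z Xi = blks r z Xi'.
Proof. by move=> H; congr (blks _ _ _); apply: funext. Qed.

Lemma blks_lin W r z c (Xi Xi' : seq (seq T) -> W) :
  blks r z (fun B => c *: Xi B + Xi' B) = c *: blks r z Xi + blks r z Xi'.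
Proof.
elim: r z Xi Xi' => [|r IH] [|a z] Xi Xi'; rewrite ?scaler0 ?addr0 //.
  by rewrite -spl_lin; apply: eq_spl => I J.
by rewrite -spl_lin; apply: eq_spl => I J.
Qed.

Lemma blks0 W r z : blks r z (fun _ => 0 : W) = 0.
Proof.
elim: r z => [|r IH] z /=; first by case: z.
by rewrite -[RHS](spl0 par W z); apply: eq_spl.
Qed.

Lemma blksZ W r z c (Xi : seq (seq T) -> W) :
  blks r z (fun B => c *: Xi B) = c *: blks r z Xi.
Proof.
rewrite -[RHS]addr0 -(blks0 W r z) -blks_lin.
by apply: eq_blks => B; rewrite addr0.
Qed.

Lemma blksD W r z (Xi Xi' : seq (seq T) -> W) :
  blks r z (fun B => Xi B + Xi' B) = blks r z Xi + blks r z Xi'.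
Proof.
rewrite -[blks r z Xi]scale1r -blks_lin.
by apply: eq_blks => B; rewrite scale1r.
Qed.

End UnshuffleTheory.

(** * Label words *)

Section Words.
Variables (k : fieldType) (T : Type) (par : T -> bool).
Implicit Types (z : seq T) (W : lmodType k) (w : seq nat).
Local Notation spl := (spl par).
Local Notation lp := (lp par).
Local Notation blks := (blks par).

Lemma parsum_eq w z i : size w = size z ->
  parsum [seq (jq.1 == i) && jq.2 | jq <- zip w (map par z)] = lp (blk w i z).
Proof.
elim: w z => [|j w IH] [|a z] //= [hs]; rewrite blk_cons IH //.
by case: eqP.
Qed.

(** The letters with a label below i are those of the blocks below i; this is
what the sign of a label word counts at each letter labelled i. *)
Lemma parsum_lt w z i : size w = size z ->
  parsum [seq (jq.1 < i)%N && jq.2 | jq <- zip w (map par z)] =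
  lp (flatten [seq blk w j z | j <- iota 0 i]).
Proof.
move=> hs; elim: i => [|i IH].
  by elim: w z hs => [|j w IH] [|a z] //= [] /IH.
rewrite -addn1 iotaD map_cat flatten_cat lp_cat -IH /= cats0 -parsum_eq //.
elim: w z hs {IH} => [|j w IH] [|a z] //= [] /IH ->.
rewrite addn1 ltnS leq_eqVlt; move: (parsum _) (parsum _) => x y.
by case: ltngtP; case: (par a); case: x; case: y.
Qed.

Lemma kodd_cons i w a z : size w = size z ->
  kodd (i :: w) (map par (a :: z)) =
  (par a && lp (flatten [seq blk w j z | j <- iota 0 i]))
    (+) kodd w (map par z).
Proof. by move=> hs; rewrite -parsum_lt. Qed.

Lemma words_spl W z (psi : seq T -> seq T -> W) :
  \sum_(w <- words [:: 0%N; 1%N] (size z))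
     ksign w (map par z) *: psi (blk w 0 z) (blk w 1 z) = spl z psi.
Proof.
elim: z psi => [|a z IH] psi; first by rewrite big_seq1 scale1r.
rewrite big_words_cons !big_cons big_nil addr0 [RHS]/=; congr (_ + _); rewrite -IH.
  apply: eq_big_seq => w /size_words hw.
  by rewrite !blk_cons (@kodd_cons 0%N w a z) //= andbF.
apply: eq_big_seq => w /size_words hw.
by rewrite !blk_cons (@kodd_cons 1%N w a z) //= cats0 scalerA addbC signr_addb.
Qed.

(** The effect on the blocks of a label word of a new first letter labelled i. *)
Fixpoint consat i (a : T) (B : seq (seq T)) :=
  if B is s :: B' then
    if i is i'.+1 then s :: consat i' a B' else (a :: s) :: B'
  else [::].

Lemma consatE w a z m r i :
  [seq blk ((m + i)%N :: w) j (a :: z) | j <- iota m r] =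
  consat i a [seq blk w j z | j <- iota m r].
Proof.
elim: r m i => [|r IH] m [|i] //=; rewrite blk_cons.
  rewrite addn0 eqxx; congr (_ :: _); apply/eq_in_map => j.
  by rewrite mem_iota blk_cons => /andP[/ltn_eqF ->].
by rewrite -[X in _ == X]addn0 eqn_add2l /= addnS -addSn IH.
Qed.

(** The first letter joins one of the blocks, at its head, and passes all
blocks before it. *)
Lemma blks_cons W r a z (Xi : seq (seq T) -> W) :
  blks r (a :: z) Xi =
  \sum_(0 <= i < r) blks r z (fun B =>
     sgn (par a && lp (flatten (take i B))) *: Xi (consat i a B)).
Proof.
elim: r z Xi => [|r IH] z Xi; first by rewrite big_nil.
rewrite big_nat_recl //=; congr (_ + _).
  apply: eq_spl => I J; apply: eq_blks => B.
  by case: B => [|C B] /=; rewrite andbF scale1r.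
rewrite -spl_sum; apply: eq_spl => I J; rewrite IH scaler_sumr.
apply: eq_bigr => i _; rewrite -blksZ; apply: eq_blks => B /=.
by rewrite scalerA -signr_addb lp_cat andb_addr.
Qed.

Lemma words_blks W r z (Xi : seq (seq T) -> W) :
  \sum_(w <- words (iota 0 r) (size z))
     ksign w (map par z) *: Xi [seq blk w j z | j <- iota 0 r] = blks r z Xi.
Proof.
elim: z Xi => [|a z IH] Xi.
  rewrite big_seq1 scale1r; elim: r 0%N Xi => [|r IH] m Xi //=.
  by rewrite (IH m.+1 (fun B => Xi (_ :: B))).
rewrite big_words_cons blks_cons /index_iota subn0.
apply: eq_big_seq => i; rewrite mem_iota add0n => /andP[_ hi]; rewrite -IH.
apply: eq_big_seq => w /size_words hw; rewrite scalerA -signr_addb.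
rewrite -(consatE w a z 0 r i) add0n (@kodd_cons i w a z) // -map_take take_iota.
by rewrite (minn_idPl (ltnW hi)) addbC.
Qed.

End Words.

Section Letters.
Variables (k : fieldType) (U : superspace k).
Implicit Types (b : seq bool) (s : seq U) (z : seq (bool * U)).

Local Notation prl := (@fst bool U).

(** A letter carries the parity that is claimed for it: homogeneous arguments
are words of good letters, and a word unzips to the parities and the arguments. *)
Definition good (a : bool * U) : bool := hom a.1 a.2.

Lemma homs_size b s : homs b s -> size b = size s.
Proof. by elim: b s => [|p b IH] [|x s] //= /andP[_ /IH ->]. Qed.

Lemma homs_good b s : homs b s -> all good (zip b s).
Proof. by elim: b s => [|p b IH] [|x s] //= /andP[hx /IH ->]; rewrite andbT. Qed.

Lemma good_homs z : all good z -> homs (unzip1 z) (unzip2 z).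
Proof. by elim: z => [|[p x] z IH] //= /andP[hx /IH hz]; apply/andP. Qed.

Lemma blk_map (T1 T2 : Type) (f : T1 -> T2) w j (s : seq T1) :
  map f (blk w j s) = blk w j (map f s).
Proof. exact: map_mask. Qed.

Lemma lp_unzip z : lp prl z = parsum (unzip1 z). Proof. by []. Qed.

Lemma insl_spl (W : lmodType k) (g : seq U -> W) (h : seq U -> U) z :
  insl g h (unzip1 z) (unzip2 z) =
  spl prl z (fun I J => g (h (unzip2 I) :: unzip2 J)).
Proof.
rewrite -words_spl /insl size_map; apply: eq_bigr => w _.
by rewrite -!blk_map.
Qed.

Lemma Lcomp_blks (W X : lmodType k) (G : seq W -> X) (F : seq U -> W) z :
  Lcomp G F (unzip1 z) (unzip2 z) =
  \sum_(1 <= r < (size z).+1) (r`!%:R)^-1 *: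
    blks prl r z (fun B => G [seq F (unzip2 t) | t <- B]).
Proof.
rewrite /Lcomp size_map; apply: eq_bigr => r _; congr (_ *: _).
rewrite -words_blks; apply: eq_bigr => w _; congr (_ *: G _).
by rewrite -map_comp; apply: eq_map => j /=; rewrite /unzip2 blk_map.
Qed.

End Letters.

(** * Symmetric functions of homogeneous words *)

Section LetterMaps.
Variables (k : fieldType) (U : superspace k).
Local Notation L := (bool * U)%type.
Local Notation prl := (@fst bool U).
Local Notation lp := (lp prl).
Local Notation spl := (spl prl).
Local Notation blks := (blks prl).
Implicit Types (z : seq L) (x y : L) (W : lmodType k).

(** Additivity in each letter; with [lsym] it is all that the reduction to
sorted words uses of multilinearity. *)
Definition ladd W (Phi : seq L -> W) : Prop := forall z1 z2 p u v,
  Phi (z1 ++ (p, u + v) :: z2) = Phi (z1 ++ (p, u) :: z2) + Phi (z1 ++ (p, v) :: z2).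

Definition lsym W (Phi : seq L -> W) : Prop := forall z1 z2 x y,
  good x -> good y ->
  Phi (z1 ++ x :: y :: z2) = sgn (x.1 && y.1) *: Phi (z1 ++ y :: x :: z2).

(** Iterated transpositions bring a letter to the front of a block. *)
Lemma lsym_move W (Phi : seq L -> W) z1 z x z2 : lsym Phi ->
  all (@good k U) z -> good x ->
  Phi (z1 ++ z ++ x :: z2) = sgn (x.1 && lp z) *: Phi (z1 ++ x :: z ++ z2).
Proof.
move=> S gz gx; elim: z z1 gz => [|y z IH] z1 /=; first by rewrite andbF scale1r.
case/andP=> gy gz; have := IH (rcons z1 y) gz; rewrite !cat_rcons => ->.
by rewrite S //; ssign.
Qed.

Lemma spl_ladd W (psi : seq L -> seq L -> W) :
  (forall J, ladd (psi^~ J)) -> (forall I, ladd (psi I)) ->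
  ladd (fun z => spl z psi).
Proof.
move=> H1 H2 z1 z2 p u v; elim: z1 psi H1 H2 => [|a z1 IH] psi H1 H2 /=.
  rewrite -!splD; apply: eq_spl => I J.
  by rewrite (H1 J [::]) (H2 I [::]) scalerDr addrACA.
rewrite [RHS]addrACA; congr (_ + _); apply: IH.
- by move=> J t1 t2 q r s; apply: (H1 J (a :: t1)).
- by move=> I; apply: H2.
- by move=> J t1 t2 q r s; rewrite !lp_cat !lp_cons -scalerDr H1.
- by move=> I t1 t2 q r s; rewrite -scalerDr -(H2 I (a :: t1)).
Qed.

Lemma spl_lsym W (psi : seq L -> seq L -> W) :
  (forall J, lsym (psi^~ J)) -> (forall I, lsym (psi I)) ->
  lsym (fun z => spl z psi).
Proof.
move=> H1 H2 z1 z2 x y gx gy; elim: z1 psi H1 H2 => [|a z1 IH] psi H1 H2 /=.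
  rewrite -!splD -!splZ; apply: eq_spl => I J /=.
  rewrite (H1 J [::]) // (H2 I [::]) // !lp_cons !scalerDr -!addrA.
  by congr (_ + _); rewrite addrCA; congr (_ + (_ + _)); ssign.
rewrite scalerDr; congr (_ + _); apply: IH.
- by move=> J t1 t2 x' y' gx' gy'; apply: (H1 J (a :: t1)).
- by move=> I; apply: H2.
- by move=> J t1 t2 x' y' gx' gy'; rewrite H1 //; ssign.
- by move=> I t1 t2 x' y' gx' gy'; rewrite -cat_cons (H2 I) //; ssign.
Qed.

Section Blocks.
Variables (X : superspace k) (F : seq L -> X).
Hypothesis Fadd : ladd F.
Hypothesis Fsym : lsym F.

Lemma mlin_add W (G : seq X -> W) s1 s2 u v : mlin G ->
  G (s1 ++ (u + v) :: s2) = G (s1 ++ u :: s2) + G (s1 ++ v :: s2).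
Proof. by move=> HG; have := mlinE HG s1 s2 1 u v; rewrite !scale1r. Qed.

Lemma blks_ladd W r (G : seq X -> W) : mlin G ->
  ladd (fun z => blks r z (fun B => G (map F B))).
Proof.
elim: r G => [|r IH] G HG; first by case=> [|a z1] z2 p u v; rewrite /= addr0.
apply: spl_ladd => [J z1 z2 p u v|I].
  by rewrite -blksD; apply: eq_blks => B; rewrite /= Fadd (mlin_add [::]).
exact: (IH (fun s => G (F I :: s)) (mlin_cons _ HG)).
Qed.

Lemma blks_lsym W r (G : seq X -> W) : mlin G ->
  lsym (fun z => blks r z (fun B => G (map F B))).
Proof.
elim: r G => [|r IH] G HG.
  by case=> [|a z1] z2 x y gx gy; rewrite /= scaler0.
apply: spl_lsym => [J z1 z2 x y gx gy|I].
  by rewrite -blksZ; apply: eq_blks => B; rewrite /= Fsym // (mlinZ [::]).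
exact: (IH (fun s => G (F I :: s)) (mlin_cons _ HG)).
Qed.

Hypothesis F0 : F [::] = 0.
Hypothesis Fpar : forall z, all (@good k U) z -> hom (lp z) (F z).

Lemma blks_big W r z (G : seq X -> W) : mlin G -> (size z < r)%N ->
  blks r z (fun B => G (map F B)) = 0.
Proof.
elim: r z G => [|r IH] z G HG //= hr.
rewrite -[RHS](spl0 prl W z); apply: (@eq_spl_in _ _ _ predT).
  exact: all_predT.
case=> [|a I] J _ _ /= hs _.
  by rewrite -[RHS](blks0 prl W r J); apply: eq_blks => B; rewrite F0 (mlin0 [::]).
apply: (IH J (fun s => G (F (a :: I) :: s))); first exact: mlin_cons.
by rewrite -ltnS; apply: leq_ltn_trans hr; rewrite -hs addSn ltnS leq_addl.
Qed.

(** By symmetry the block that contains the first letter may be put first;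
the r + 1 positions of that block contribute equally. *)
Lemma blks_first W r a z (G : seq X -> W) : mlin G -> ksym G ->
  all (@good k U) (a :: z) ->
  blks r.+1 (a :: z) (fun B => G (map F B)) =
  r.+1%:R *: spl z (fun I J =>
     blks r J (fun B => G (F (a :: I) :: map F B))).
Proof.
elim: r a z G => [|r IH] a z G HG SG /= /andP[ga gz].
  rewrite scale1r -[RHS]addr0; congr (_ + _).
  rewrite -[RHS](spl0 prl W z); apply: eq_spl => I J.
  by rewrite scaler0.
rewrite -natr1 scalerDl scale1r addrC; congr (_ + _).
pose chi J1 I J2 := blks r J2 (fun B => G (F (a :: J1) :: F I :: map F B)).
transitivity (spl z (fun I J => spl J (fun J1 J2 =>
   sgn (lp J1 && lp I) *: (r.+1%:R *: chi J1 I J2)))).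
  apply: (@eq_spl_in _ _ _ (@good k U)) => // I J gI gJ _ _.
  have SG' : ksym (fun s : seq X => G (F I :: s)).
    by move=> s1 s2 p q u v hu hv _; rewrite -!cat_cons (ksymE SG _ _ hu hv).
  have gaJ : all (@good k U) (a :: J) by rewrite /= ga.
  have E := IH a J (fun s : seq X => G (F I :: s)) (mlin_cons _ HG) SG' gaJ.
  transitivity (sgn (a.1 && lp I) *: (r.+1%:R *: spl J (fun J1 J2 =>
      blks r J2 (fun B => G (F I :: F (a :: J1) :: map F B))))).
    by congr (_ *: _); exact: E.
  rewrite scalerA mulrC -scalerA -!splZ.
  apply: (@eq_spl_in _ _ _ (@good k U)) => // J1 J2 g1 g2 _ _.
  rewrite scalerA [in RHS]scalerA [in RHS]mulrC -!scalerA; congr (_ *: _).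
  rewrite -!blksZ; apply: eq_blks => B.
  have gF : hom (lp (a :: J1)) (F (a :: J1)) by apply: Fpar => /=; rewrite ga.
  by rewrite (ksymE SG [::] _ (Fpar gI) gF); ssign.
rewrite -(spl_swap prl z (fun J1 I J2 => r.+1%:R *: chi J1 I J2)) -splZ.
apply: eq_spl => I J.
by rewrite -splZ.
Qed.

End Blocks.

Section Reduction.
Variables (A B : pred L).
Hypothesis dec : forall p u, hom p u -> exists u1 u2,
  [/\ u = u1 + u2, hom p u1, hom p u2, A (p, u1) & B (p, u2)].

(** Each letter is split into a part in A and a part in B, and symmetry moves
the parts in A to the left. *)
Lemma sorted_zero W (Phi : seq L -> W) : ladd Phi -> lsym Phi ->
  (forall fs ws, all (@good k U) fs -> all (@good k U) ws ->
     all A fs -> all B ws -> Phi (fs ++ ws) = 0) ->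
  forall z, all (@good k U) z -> Phi z = 0.
Proof.
move=> HA HS H0 z; rewrite -[z in Phi z]cat0s.
have: all (@good k U) [::] by [].
move: (H0 [::] [::]).
suff: forall fs ws, all (@good k U) fs -> all (@good k U) ws ->
    all A fs -> all B ws -> all (@good k U) z -> Phi (fs ++ ws ++ z) = 0.
  by move=> H _ _ gz; apply: (H [::] [::]).
elim: z => [|[p u] z IH] fs ws gf gw Af Bw /=.
  by rewrite cats0 => _; apply: H0.
case/andP=> /dec[u1 [u2 [/= -> h1 h2 A1 B2]]] gz.
rewrite catA HA -!catA (@lsym_move _ Phi fs ws (p, u1) z HS) //.
rewrite -cat_rcons -[ws ++ (p, u2) :: z]cat_rcons.
rewrite !IH ?scaler0 ?addr0 //.
- by rewrite all_rcons gw /good /= h2.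
- by rewrite all_rcons Bw B2.
- by rewrite all_rcons gf /good /= h1.
- by rewrite all_rcons Af A1.
Qed.

End Reduction.

End LetterMaps.

(** * Exponentials of symmetric functions *)

Section Exponential.
Variables (k : fieldType) (U X : superspace k) (F : seq (bool * U) -> X).
Local Notation L := (bool * U)%type.
Local Notation prl := (@fst bool U).
Local Notation lp := (lp prl).
Local Notation spl := (spl prl).
Local Notation blks := (blks prl).
Implicit Types (z : seq L) (x y : L) (W : lmodType k).

(** The composition of G with the coalgebra map exp(F); its terms are indexed by
the number of blocks. *)
Definition expc W (G : seq X -> W) z : W :=
  \sum_(0 <= r < (size z).+1) (r`!%:R)^-1 *: blks r z (fun B => G (map F B)).

Hypothesis char0 : [pchar k] =i pred0.
Hypothesis F0 : F [::] = 0.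
Hypothesis Fpar : forall z, all (@good k U) z -> hom (lp z) (F z).

Lemma expc_nil W (G : seq X -> W) : expc G [::] = G [::].
Proof. by rewrite /expc big_nat1 invr1 scale1r. Qed.

(** Partitions with more blocks than letters have an empty block, on which F
vanishes. *)
Lemma expc_bound W (G : seq X -> W) z n : mlin G -> (size z <= n)%N ->
  expc G z = \sum_(0 <= r < n.+1) (r`!%:R)^-1 *: blks r z (fun B => G (map F B)).
Proof.
move=> HG hn; rewrite [RHS](@big_cat_nat _ _ _ (size z).+1) //= -[LHS]addr0.
congr (_ + _); rewrite big_nat big1 // => r /andP[hr _].
by rewrite blks_big // scaler0.
Qed.

Lemma natr_neq0 n : (n.+1)%:R != 0 :> k.
Proof. by move/pcharf0P: char0 => ->. Qed.

(** Differentiating the exponential: the block of the first letter is split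
off, and the factor from [blks_first] cancels against the factorial. *)
Lemma expc_cons W (G : seq X -> W) a z : mlin G -> ksym G ->
  all (@good k U) (a :: z) ->
  expc G (a :: z) =
  spl z (fun I J => expc (fun t => G (F (a :: I) :: t)) J).
Proof.
move=> HG SG ga; rewrite /expc big_nat_recl // [blks 0 _ _]/= scaler0 add0r.
transitivity (spl z (fun I J => \sum_(0 <= r < (size z).+1) (r`!%:R)^-1 *:
   blks r J (fun B => G (F (a :: I) :: map F B)))).
  rewrite spl_sum; apply: eq_bigr => r _; rewrite splZ blks_first // scalerA.
  congr (_ *: _); rewrite factS natrM invfM -mulrA mulrC -mulrA mulfV ?mulr1 //.
  exact: natr_neq0.
apply: (@eq_spl_in _ _ _ predT); first exact: all_predT.
move=> I J _ _ hs _; rewrite -(expc_bound (G := fun t : seq X => G (F (a :: I) :: t))) //.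
  exact: mlin_cons.
by rewrite -hs leq_addl.
Qed.

(** If F vanishes on all longer blocks, every block is a single letter and the
factorial cancels against the orderings. *)
Lemma expc_single W (G : seq X -> W) z : mlin G -> ksym G ->
  all (@good k U) z ->
  (forall (a : L) (I : seq L), a \in z -> {subset I <= z} -> I != [::] ->
     F (a :: I) = 0) ->
  expc G z = G [seq F [:: a] | a <- z].
Proof.
elim: z G => [|a z IH] G HG SG; first by rewrite expc_nil.
move=> gaz H; have /andP[ga gz] := gaz.
rewrite expc_cons //= -(IH (fun t : seq X => G (F [:: a] :: t))) //; last first.
- move=> b I hb hI; apply: H; first by rewrite inE hb orbT.
  by move=> c /hI hc; rewrite inE hc orbT.
- by move=> s1 s2 p q u v hu hv _; rewrite -!cat_cons (ksymE SG _ _ hu hv).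
- exact: mlin_cons.
rewrite -[RHS](spl_nill prl z (fun J => expc (fun t => G (F [:: a] :: t)) J)).
apply: (@eq_spl_in _ _ _ (mem z)) => [|[|b I] J hI hJ _ _] //.
rewrite /expc big1 // => r _.
rewrite (_ : blks _ _ _ = 0) ?scaler0 //.
rewrite -[RHS](blks0 prl W r J); apply: eq_blks => B.
rewrite H ?(mlin0 [::]) ?inE ?eqxx //.
by move=> c /(allP hI) hc; rewrite inE; apply/orP; right.
Qed.

End Exponential.

Section LcompExponential.
Variables (k : fieldType) (U X : superspace k) (F : seq U -> X).
Implicit Types (z : seq (bool * U)) (W : lmodType k).

Lemma Lcomp_expc W (G : seq X -> W) a z :
  Lcomp G F (unzip1 (a :: z)) (unzip2 (a :: z)) =
  expc (fun z => F (unzip2 z)) G (a :: z).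
Proof.
by rewrite Lcomp_blks /expc [in RHS]big_nat_recl // [blks _ 0 _ _]/= scaler0 add0r big_add1.
Qed.

End LcompExponential.

(** * Homogeneous arguments *)

Section LetterBasics.
Variables (k : fieldType) (U : superspace k).
Local Notation L := (bool * U)%type.
Local Notation prl := (@fst bool U).
Implicit Types (z : seq L) (W : lmodType k).

Lemma spl_mapl (T T' : Type) (par : T -> bool) (par' : T' -> bool) (f : T -> T') W
    (z : seq T) (psi : seq T' -> seq T' -> W) : (forall a, par' (f a) = par a) ->
  spl par' (map f z) psi = spl par z (fun I J => psi (map f I) (map f J)).
Proof.
move=> Hf; elim: z psi => //= a z IH psi; rewrite !IH; congr (_ + _).
apply: eq_spl => I J; rewrite Hf; congr ((-1) ^+ nat_of_bool (_ && _) *: _).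
by rewrite /lp -map_comp; congr parsum; apply: eq_map.
Qed.

Lemma mlin_ladd W (f : seq U -> W) : mlin f -> ladd (fun z => f (unzip2 z)).
Proof.
move=> Hf z1 z2 p u v; rewrite /unzip2 !map_cat /=.
exact: mlin_add.
Qed.

Lemma ksym_lsym W (f : seq U -> W) : ksym f -> lsym (fun z => f (unzip2 z)).
Proof.
move=> Hf z1 z2 x y gx gy; rewrite /unzip2 !map_cat /=.
exact: ksymE.
Qed.

Lemma kext_good W (G : seq bool -> seq U -> W) z : (forall b, mlin (G b)) ->
  all (@good k U) z -> kext G (unzip2 z) = G (unzip1 z) (unzip2 z).
Proof. by move=> HG /good_homs; apply: kext_hom. Qed.

Lemma zip_cat_cons2 (A B : Type) (b1 b2 : seq A) (s1 s2 : seq B) p q u v :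
  size b1 = size s1 ->
  zip (b1 ++ p :: q :: b2) (s1 ++ u :: v :: s2) =
  zip b1 s1 ++ (p, u) :: (q, v) :: zip b2 s2.
Proof. by move=> h; rewrite zip_cat. Qed.

Lemma kext_lsym W (G : seq bool -> seq U -> W) : (forall b, mlin (G b)) ->
  lsym (fun z => G (unzip1 z) (unzip2 z)) -> ksym (kext G).
Proof.
move=> HG HS; pose G' b s := if size b == size s then G b s else 0.
have -> : kext G = kext G'.
  apply: funext => s; apply: eq_big_seq => b /size_words hb.
  by rewrite /G' size_map size_zip hb minnn eqxx.
apply: kext_ksym => [b|b1 p q b2 s1 u v s2 h1 hu hv].
  move=> s1 s2 a u v _; rewrite /G' !size_cat /=; case: eqP => _.
    by rewrite (mlinE (HG b)).
  by rewrite scaler0 addr0.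
rewrite /G' !size_cat /=; case: eqP => [h|_]; last by rewrite scaler0.
have h2 : size b2 = size s2.
  by move: h; rewrite h1 => /addnI [].
have := HS (zip b1 s1) (zip b2 s2) (p, u) (q, v) hu hv.
rewrite /= -!zip_cat_cons2 // !unzip1_zip ?unzip2_zip //;
  by rewrite !size_cat /= h1 h2.
Qed.

(** Every argument is the sum of its homogeneous parts. *)
Lemma mlin_eq W (f g : seq U -> W) : mlin f -> mlin g ->
  (forall z, all (@good k U) z -> f (unzip2 z) = g (unzip2 z)) -> f = g.
Proof.
have E (h : seq U -> W) s : mlin h -> h s = kext (fun _ => h) s.
  elim: s h => [|x s IH] h Hh; first by rewrite kext_nil.
  rewrite kext_cons {1}(pr_dec x) (mlin_add [::]) //.
  by rewrite -!IH //; apply: mlin_cons.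
move=> Hf Hg H; apply: funext => s; rewrite E // [RHS]E //.
apply: eq_big_seq => b /size_words hb.
have hs : size b = size (prs b s) by rewrite size_map size_zip hb minnn.
have := H (zip b (prs b s)); rewrite unzip2_zip ?hs //; apply.
by apply: homs_good; apply: homs_prs.
Qed.

Lemma hom_opp p (u : U) : hom p u -> hom p (- u).
Proof.
rewrite /hom => /eqP h; have := pr_linear p (-1) u 0.
have -> : pr p (0 : U) = 0.
  by have := pr_linear p (-1) (0 : U) 0; rewrite scaler0 addr0 scaleN1r addNr.
by rewrite !addr0 !scaleN1r h => ->.
Qed.

Lemma prD p (u v : U) : pr p (u + v) = pr p u + pr p v.
Proof. by have := pr_linear p 1 u v; rewrite !scale1r. Qed.

Lemma prZ p c (u : U) : pr p (c *: u) = c *: pr p u.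
Proof. by have := pr_linear p c u 0; rewrite addr0 => ->; rewrite Defs.pr0 addr0. Qed.

Lemma hom0 p : hom p (0 : U).
Proof. by rewrite /hom Defs.pr0. Qed.

Lemma homD p (u v : U) : hom p u -> hom p v -> hom p (u + v).
Proof. by rewrite /hom prD => /eqP -> /eqP ->. Qed.

Lemma homZ p c (u : U) : hom p u -> hom p (c *: u).
Proof. by rewrite /hom prZ => /eqP ->. Qed.

Lemma hom_pr p q (u : U) : hom p u -> pr q u = if q == p then u else 0.
Proof. by move/eqP => h; rewrite -{1}h pr_pr; case: eqP => // ->. Qed.

Lemma mlin_opp W (f : seq U -> W) s : mlin f ->
  f (map -%R s) = (-1) ^+ size s *: f s.
Proof.
elim: s f => [|x s IH] f Hf; first by rewrite scale1r.
rewrite /= (IH (fun t => f (- x :: t))); last exact: mlin_cons.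
by rewrite -(scaleN1r x) (mlinZ [::]) //= scalerA exprSr.
Qed.

Lemma mlin_has0 W (f : seq U -> W) s : mlin f -> 0 \in s -> f s = 0.
Proof. by move=> Hf /path.splitPr [s1 s2]; apply: mlin0. Qed.

(** The first letter lies in either part of the unshuffle; by symmetry the two
terms agree up to the sign of (-1)^|J|, so they cancel in pairs. *)
Lemma spl_alt W (Phi : seq L -> W) z : lsym Phi -> all (@good k U) z ->
  spl prl z (fun I J => (-1) ^+ size J *: Phi (I ++ J)) =
  if z is [::] then Phi [::] else 0.
Proof.
case: z => [|a z] S; first by rewrite /= scale1r.
case/andP=> ga gz /=; rewrite -splD -[RHS](spl0 prl W z).
apply: (@eq_spl_in _ _ _ (@good k U)) => // I J gI gJ _ _ /=.
have := @lsym_move _ _ _ Phi [::] I a J S gI ga; rewrite /= => ->.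
rewrite exprS mulN1r scaleNr scalerN !scalerA mulrAC -signr_addb addbb.
by rewrite mul1r subrr.
Qed.

End LetterBasics.

Section FrontSums.
Variables (k : fieldType) (U W : lmodType k).

(** The recursive form of the sums that occur in the products of g~(V), in which
the i-th entry s_i is singled out. *)
Fixpoint fsum (K : U -> seq U -> W) (c : nat -> k) (s : seq U) : W :=
  if s is x :: s' then
    c 0%N *: K x s' + fsum (fun y t => K y (x :: t)) (fun i => c i.+1) s'
  else 0.

Lemma fsumE (K : U -> seq U -> W) (c : nat -> k) (s : seq U) :
  \sum_(i < size s) c i *: K (nth 0 s i) (take i s ++ drop i.+1 s) = fsum K c s.
Proof.
elim: s K c => [|x s IH] K c; first by rewrite big_ord0.
rewrite big_ord_recl /= drop0; congr (_ + _).
exact: (IH (fun y t => K y (x :: t)) (fun i => c i.+1)).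
Qed.

Lemma eq_fsum (K K' : U -> seq U -> W) c c' s : (forall y t, K y t = K' y t) ->
  (forall i, c i = c' i) -> fsum K c s = fsum K' c' s.
Proof.
move=> H Hc; congr (fsum _ _ _); last exact: funext.
by apply: funext => y; apply: funext => t.
Qed.

Lemma fsum_lin a (K K' : U -> seq U -> W) c s :
  fsum (fun y t => a *: K y t + K' y t) c s = a *: fsum K c s + fsum K' c s.
Proof.
elim: s K K' c => [|x s IH] K K' c /=; first by rewrite scaler0 addr0.
by rewrite IH !scalerDr !scalerA [a * _]mulrC addrACA.
Qed.

Lemma fsum_mlin (K : U -> seq U -> W) c :
  (forall t, linear (K^~ t)) -> (forall y, mlin (K y)) -> mlin (fsum K c).
Proof.
move=> H1 H2 s1 s2 a u v _; elim: s1 K c H1 H2 => [|x s1 IH] K c H1 H2 /=.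
  rewrite H1 (eq_fsum (K' := fun y t => a *: K y (u :: t) + K y (v :: t)) (c' := fun i => c i.+1)) //.
    by rewrite fsum_lin !scalerDr !scalerA [a * _]mulrC addrACA.
  by move=> y t; rewrite (mlinE (H2 y) [::]).
rewrite (mlinE (H2 x)) IH //.
  by rewrite !scalerDr !scalerA [a * _]mulrC addrACA.
by move=> y t1 t2 b u' v' _; rewrite -!cat_cons (mlinE (H2 y)).
Qed.

End FrontSums.

(** On good letters, the sign in front of the i-th term is the one of moving
the i-th letter to the front; q accounts for letters that were passed before. *)
Lemma fsum_front (k : fieldType) (U : superspace k) (W : lmodType k)
    (K : U -> seq U -> W) (q : bool) (z : seq (bool * U)) :
  fsum K (fun i => sgn (nth false (unzip1 z) i &&
                        (q (+) parsum (take i (unzip1 z))))) (unzip2 z) =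
  front (@fst bool U) z (fun a J => sgn (a.1 && q) *: K a.2 (unzip2 J)).
Proof.
elim: z K q => [|a z IH] K q //.
rewrite front_cons /= addbF; congr (_ + _).
rewrite (eq_fsum (K' := fun y t => K y (a.2 :: t)) (c' := fun i => sgn (nth false (unzip1 z) i &&
                        ((q (+) a.1) (+) parsum (take i (unzip1 z)))))) //; last first.
  by move=> i /=; rewrite addbA.
rewrite IH; congr (spl _ _ _); apply: funext => -[|c [|d I]] //; apply: funext => J.
by rewrite scalerA -signr_addb; congr ((-1) ^+ nat_of_bool _ *: _); bcase.
Qed.

Lemma front_lsym (k : fieldType) (U : superspace k) (W : lmodType k)
    (K : bool * U -> seq (bool * U) -> W) :
  (forall a, lsym (K a)) -> lsym (fun z => front (@fst bool U) z K).
Proof.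
move=> HK; apply: spl_lsym => [J|[|a [|b I]]].
- by case=> [|a [|b z1]] z2 x y gx gy /=; rewrite scaler0.
- by move=> z1 z2 x y gx gy; rewrite scaler0.
- exact: HK.
by move=> z1 z2 x y gx gy; rewrite scaler0.
Qed.

(** * Twistable structures and their twisting map *)

(** The data of the twisting argument: tcomp q g h is a composition, q being the
parity of h; tdd is the element whose bracket is the differential; tact is the
action on words; tplug fixes the first arguments.  Axioms that involve
parities of words are stated for good letters. *)
Record twistable (k : fieldType) (V : dgspace k) := Twistable {
  tG :> superspace k;
  tcomp : bool -> tG -> tG -> tG;
  tdd : tG;
  tact : tG -> seq V -> V;
  tplug : tG -> seq V -> tG;
  tcomp_linl : forall q h, linear (fun g => tcomp q g h);
  tcomp_linr : forall q g, linear (tcomp q g);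
  tdd_odd : hom true tdd;
  tact_linl : forall s, linear (tact^~ s);
  tact_mlin : forall g, mlin (tact g);
  tact_sym : forall g, @ksym k (Pi V) V (tact g);
  tact_nil : forall g, tact g [::] = 0;
  tact_hom : forall p g (z : seq (bool * Pi V)), hom p g ->
    all (@good k (Pi V)) z ->
    @hom k (Pi V) (p (+) lp (@fst bool (Pi V)) z) (tact g (unzip2 z));
  tplug_linl : forall s, linear (tplug^~ s);
  tplug_mlin : forall g, mlin (tplug g);
  tplug_sym : forall g, @ksym k (Pi V) tG (tplug g);
  tplug_nil : forall g, tplug g [::] = g;
  tplug_hom : forall p g (z : seq (bool * Pi V)), hom p g ->
    all (@good k (Pi V)) z ->
    hom (p (+) lp (@fst bool (Pi V)) z) (tplug g (unzip2 z));
  tact_plug : forall g (z1 z2 : seq (bool * Pi V)),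
    all (@good k (Pi V)) z1 -> all (@good k (Pi V)) z2 -> z2 != [::] ->
    tact (tplug g (unzip2 z1)) (unzip2 z2) = tact g (unzip2 (z1 ++ z2));
  tplug_plug : forall g (z1 z2 : seq (bool * Pi V)),
    all (@good k (Pi V)) z1 -> all (@good k (Pi V)) z2 ->
    tplug (tplug g (unzip2 z1)) (unzip2 z2) = tplug g (unzip2 (z1 ++ z2));
  tplug_comp : forall p q g h (z : seq (bool * Pi V)), hom p g -> hom q h ->
    all (@good k (Pi V)) z ->
    tplug (tcomp q g h) (unzip2 z) =
    spl (@fst bool (Pi V)) z (fun I J => sgn (q && lp (@fst bool (Pi V)) I) *:
      tcomp (q (+) lp (@fst bool (Pi V)) J) (tplug g (unzip2 I)) (tplug h (unzip2 J))) +
    spl (@fst bool (Pi V)) z (fun I J =>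
      tplug g (tact h (unzip2 I) :: unzip2 J));
  tdd_act : forall s, tact tdd s = if s is [:: w] then - dif w else 0;
  tdd_plug : forall s, s != [::] -> tplug tdd s = 0 }.

Section Twist.
Variables (k : fieldType) (V : dgspace k) (T : twistable V).
Local Notation G := (tG T).
Local Notation P := (Pi V).
Local Notation D := (dsum G V).
Local Notation U := (Pi D).
Local Notation L := (bool * U)%type.
Local Notation pu := (@fst bool U).
Local Notation pp := (@fst bool P).
Local Notation br := (bracket (@tcomp k V T)).
Local Notation plug := (@tplug k V T).
Local Notation act := (@tact k V T).
Local Notation comp := (@tcomp k V T).
Local Notation dd := (tdd T).

(** The components of the twisting map: in the first component one entry supplies
the derivation and the others are plugged into it, as for the products of g~(V). *)
Definition tw_form (b : seq bool) (s : seq U) : D :=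
  (\sum_(i < size s) sgn (nth false b i && parsum (take i b)) *:
       plug (nth (0 : U) s i).1 [seq x.2 | x <- take i s ++ drop i.+1 s],
   if s is [:: x] then - x.2 else 0).

Definition tw : seq D -> D := @kext k U D tw_form.

Definition op_form (b : seq bool) (s : seq U) : D :=
    (if s is [:: x; y] then sgn (~~ head false b) *: br x.1 y.1 else 0,
     \sum_(i < size s) sgn (nth false b i && parsum (take i b)) *:
       act (nth (0 : U) s i).1 [seq x.2 | x <- take i s ++ drop i.+1 s]).

Definition LD := tilde (fun _ : G => True) br dd act (@dif k V).

Lemma LopE : @Lop k LD = @kext k U D op_form.
Proof. by []. Qed.

Lemma lin_add (W W' : lmodType k) (f : W -> W') : linear f ->
  forall u v, f (u + v) = f u + f v.
Proof. by move=> H u v; have := H 1 u v; rewrite !scale1r. Qed.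

Lemma lin_0 (W W' : lmodType k) (f : W -> W') : linear f -> f 0 = 0.
Proof. by move=> H; have := H (-1) 0 0; rewrite scaler0 addr0 scaleN1r addNr. Qed.

Lemma lin_scale (W W' : lmodType k) (f : W -> W') : linear f ->
  forall c u, f (c *: u) = c *: f u.
Proof. by move=> H c u; have := H c u 0; rewrite (lin_0 H) !addr0. Qed.

Lemma mlin_map2 (W : lmodType k) (f : seq V -> W) : mlin f ->
  @mlin k U W (fun t : seq U => f [seq x.2 | x <- t]).
Proof. by move=> Hf s1 s2 a u v _; rewrite !map_cat /= (mlinE Hf). Qed.

Lemma pair_mlin (W W' : lmodType k) (f : seq U -> W) (g : seq U -> W') :
  mlin f -> mlin g -> mlin (fun s => (f s, g s) : (W * W')%type).
Proof.
by move=> Hf Hg s1 s2 a u v _; rewrite (mlinE Hf) (mlinE Hg).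
Qed.

Lemma front_form_mlin (W : lmodType k) (K : G -> seq V -> W) b :
  (forall t, linear (K^~ t)) -> (forall g, mlin (K g)) ->
  @mlin k U W (fun s => \sum_(i < size s)
     sgn (nth false b i && parsum (take i b)) *:
       K (nth (0 : U) s i).1 [seq x.2 | x <- take i s ++ drop i.+1 s]).
Proof.
move=> H1 H2.
pose K' (y : U) (t : seq U) := K y.1 [seq x.2 | x <- t].
pose c i : k := sgn (nth false b i && parsum (take i b)).
have HK : @mlin k U W (fsum K' c).
  apply: fsum_mlin => [t c' x y|y]; first exact: H1.
  exact: mlin_map2.
by move=> s1 s2 a u v _; rewrite !(fsumE K' c) (mlinE HK).
Qed.

Lemma mlin1 (W : lmodType k) (f : U -> W) : linear f ->
  @mlin k U W (fun s => if s is [:: x] then f x else 0).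
Proof.
move=> Hd [|x [|y s1]] [|z s2] a u v _ //=; rewrite ?Hd //;
  by rewrite scaler0 addr0.
Qed.

Lemma tw_form_mlin b : mlin (tw_form b).
Proof.
apply: pair_mlin; first by apply: front_form_mlin; [exact: tplug_linl|exact: tplug_mlin].
by apply: mlin1 => a x y; rewrite opprD scalerN.
Qed.

Lemma lin_subZ (W W' : lmodType k) (f f' : W -> W') c : linear f -> linear f' ->
  linear (fun x => f x - c *: f' x).
Proof.
move=> H H' a u v; rewrite H H' !scalerDr opprD !scalerN !scalerA mulrC.
by rewrite addrACA.
Qed.

Lemma lin_bigsum (W W' : lmodType k) (I : Type) (r : seq I) (F : I -> W -> W') :
  (forall i, linear (F i)) -> linear (fun x => \sum_(i <- r) F i x).
Proof.
move=> H a u v; rewrite scaler_sumr -big_split /=.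
by apply: eq_bigr => i _; rewrite H.
Qed.

Lemma br_linl h : linear (fun g => br g h).
Proof.
apply: lin_bigsum => p; apply: lin_bigsum => q; apply: lin_subZ => a u v.
  by rewrite pr_linear tcomp_linl.
by rewrite pr_linear tcomp_linr.
Qed.

Lemma br_linr g : linear (br g).
Proof.
apply: lin_bigsum => p; apply: lin_bigsum => q; apply: lin_subZ => a u v.
  by rewrite pr_linear tcomp_linr.
by rewrite pr_linear tcomp_linl.
Qed.

Lemma br_hom p q g h : hom p g -> hom q h ->
  br g h = comp q g h - sgn (p && q) *: comp p h g.
Proof.
move=> hg hh; rewrite /bracket !big_cons !big_nil.
have c0l r x : comp r 0 x = 0 by apply: lin_0 (tcomp_linl _ _).
have c0r r x : comp r x 0 = 0 by apply: lin_0 (tcomp_linr _ _).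
case: p hg => hg; case: q hh => hh; rewrite !(hom_pr _ hg) !(hom_pr _ hh) /=;
  by rewrite ?(c0l, c0r) ?scaler0 ?subrr ?(add0r, addr0).
Qed.

Lemma br_sym p q g h : hom p g -> hom q h ->
  br g h = - sgn (p && q) *: br h g.
Proof.
move=> hg hh; rewrite (br_hom hg hh) (br_hom hh hg) scalerBr !scaleNr opprK.
by rewrite scalerA -signr_addb [q && p]andbC addbb scale1r addrC.
Qed.

Lemma op_form_mlin b : mlin (op_form b).
Proof.
apply: pair_mlin; last by apply: front_form_mlin; [exact: tact_linl|exact: tact_mlin].
move=> [|x [|y [|z s1]]] [|x' [|y' s2]] a u v _ //=;
  rewrite ?scaler0 ?addr0 //.
  by rewrite br_linl scalerDr !scalerA [a * _]mulrC.
by rewrite br_linr scalerDr !scalerA [a * _]mulrC.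
Qed.

(** Letters of Pi (G + V) have underlying letters of Pi V; the converse inclusion is
[iW], and [iF] includes G, with the parity of Pi g. *)
Definition vl (a : L) : bool * P := (a.1, a.2.2).
Definition iW (a : bool * P) : L := (a.1, (0, a.2)).

Lemma good_dsum (a : L) :
  good a = @hom k G (~~ a.1) a.2.1 && @hom k P a.1 a.2.2.
Proof.
rewrite /good /hom Pi_prE Pi_prE; case: a => -[] [g w] /=; rewrite /pr //=.
Qed.

Lemma vl_good z : all (@good k U) z -> all (@good k P) (map vl z).
Proof.
move=> h; rewrite all_map; apply: sub_all h => a.
by rewrite good_dsum => /andP[].
Qed.

Lemma iW_good z : all (@good k P) z -> all (@good k U) (map iW z).
Proof.
move=> h; rewrite all_map; apply: sub_all h => a h.
by rewrite /= good_dsum /= hom0.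
Qed.

Lemma front_letters (W : lmodType k) (K : G -> seq V -> W) (z : seq L) :
  \sum_(i < size (unzip2 z))
     sgn (nth false (unzip1 z) i && parsum (take i (unzip1 z))) *:
       K (nth (0 : U) (unzip2 z) i).1
         [seq x.2 | x <- take i (unzip2 z) ++ drop i.+1 (unzip2 z)] =
  front pu z (fun a J => K a.2.1 (unzip2 (map vl J))).
Proof.
pose K' (y : U) (t : seq U) := K y.1 [seq x.2 | x <- t].
pose c i : k := sgn (nth false (unzip1 z) i && (false (+) parsum (take i (unzip1 z)))).
rewrite (fsumE K' c) (fsum_front K' false).
congr (spl _ _ _); apply: funext => -[|a [|b I]] //; apply: funext => J.
rewrite andbF scale1r /K'; congr (K _ _).
by rewrite /unzip2 -!map_comp.
Qed.

(** The common shape of the products and of the twisting map on good letters: a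
letter is moved to the front, and K applies its derivation to the other letters. *)
Definition front_op (W : lmodType k) (K : G -> seq V -> W) (z : seq L) : W :=
  front pu z (fun a J => K a.2.1 (unzip2 (map vl J))).

Lemma tw_good z : all (@good k U) z ->
  tw (unzip2 z) = (front_op plug z, if z is [:: a] then - a.2.2 else 0).
Proof.
move=> gz; rewrite /tw (kext_good tw_form_mlin) // /tw_form front_letters.
by congr pair; case: z {gz} => [|a [|b z]].
Qed.

Lemma op_good z : all (@good k U) z ->
  @Lop k LD (unzip2 z) =
  (if z is [:: a; c] then sgn (~~ a.1) *: br a.2.1 c.2.1 else 0, front_op act z).
Proof.
move=> gz; rewrite LopE (kext_good op_form_mlin) // /op_form front_letters.
by congr pair; case: z {gz} => [|a [|b [|c z]]].
Qed.

Lemma front_op_lsym (W : lmodType k) (K : G -> seq V -> W) :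
  (forall g, @ksym k P W (K g)) -> lsym (front_op K).
Proof.
move=> H; apply: front_lsym => a z1 z2 x y gx gy.
rewrite !map_cat /= /unzip2 !map_cat /=.
move: gx gy; rewrite !good_dsum => /andP[_ gx] /andP[_ gy].
exact: (ksymE (H _) _ _ gx gy).
Qed.

Lemma tw_mlin : @mlin k U D tw.
Proof. exact/kext_mlin/tw_form_mlin. Qed.

Lemma op_mlin : @mlin k U D (@Lop k LD).
Proof. exact/kext_mlin/op_form_mlin. Qed.

Lemma lsym_pair (W W' : lmodType k) (f : seq L -> W) (g : seq L -> W') :
  lsym f -> lsym g -> lsym (fun z => (f z, g z) : (W * W')%type).
Proof. by move=> Hf Hg z1 z2 x y gx gy; rewrite Hf // Hg. Qed.

Lemma lsym_ext (W : lmodType k) (f g : seq L -> W) : (forall z, f z = g z) ->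
  lsym f -> lsym g.
Proof. by move=> H Hf z1 z2 x y gx gy; rewrite -!H Hf. Qed.

Lemma tw_sym : @ksym k U D tw.
Proof.
apply: kext_lsym; first exact: tw_form_mlin.
pose f z : D := (front_op plug z, if z is [:: a] then - a.2.2 else 0).
apply: (@lsym_ext _ f) => [z|].
  rewrite /f /tw_form front_letters.
  by congr pair; case: z => [|a [|b z]].
apply: lsym_pair; first exact/front_op_lsym/tplug_sym.
by move=> [|a [|b z1]] z2 x y gx gy /=; rewrite scaler0.
Qed.

Lemma op_sym : @ksym k U D (@Lop k LD).
Proof.
rewrite LopE; apply: kext_lsym; first exact: op_form_mlin.
pose f z : D := (if z is [:: a; c] then sgn (~~ a.1) *: br a.2.1 c.2.1 else 0,
  front_op act z).
apply: (@lsym_ext _ f) => [z|].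
  rewrite /f /op_form front_letters.
  by congr pair; case: z => [|a [|b [|c z]]].
apply: lsym_pair; last exact/front_op_lsym/tact_sym.
move=> [|a [|b [|c z1]]] [|d z2] x y gx gy /=; rewrite ?scaler0 //.
move: gx gy; rewrite !good_dsum => /andP[gx _] /andP[gy _].
rewrite (br_sym gx gy).
case: (x.1); case: (y.1); rewrite /= ?(expr0, expr1, scale1r, scaleN1r, opprK, scaleNr) //.
Qed.

End Twist.

(** * Values of the twisting map and of the products *)

Section TwistRaw.
Variables (k : fieldType) (V : dgspace k) (T : twistable V).
Local Notation G := (tG T).
Local Notation P := (Pi V).
Local Notation D := (dsum G V).
Local Notation U := (Pi D).
Local Notation L := (bool * U)%type.
Local Notation pu := (@fst bool U).
Local Notation pp := (@fst bool P).
Local Notation br := (bracket (@tcomp k V T)).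
Local Notation plug := (@tplug k V T).
Local Notation act := (@tact k V T).
Local Notation comp := (@tcomp k V T).
Local Notation dd := (tdd T).

Local Notation LD := (@LD k V T).
Local Notation tw := (@tw k V T).
Local Notation vl := (@vl k V T).
Local Notation iW := (@iW k V T).

Definition iF (p : bool) (g : G) : L := (p, (g, 0)).
Definition inV (w : V) : D := (0, w).

Lemma tact0 s : act 0 s = 0. Proof. exact: lin_0 (tact_linl s). Qed.
Lemma tplug0 s : plug 0 s = 0. Proof. exact: lin_0 (tplug_linl s). Qed.

Lemma unzip2_iW (z : seq (bool * P)) :
  unzip2 (map iW z) = [seq inV w | w <- unzip2 z].
Proof. by rewrite /unzip2 -!map_comp. Qed.

Lemma vl_iW (z : seq (bool * P)) : map vl (map iW z) = z.
Proof. by rewrite -map_comp map_id_in // => -[]. Qed.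

Lemma lp_iW (z : seq (bool * P)) : lp pu (map iW z) = lp pp z.
Proof. by rewrite /lp -map_comp. Qed.

Lemma front_op_iW (W : lmodType k) (K : G -> seq V -> W) (z : seq (bool * P)) :
  (forall s, K 0 s = 0) -> front_op K (map iW z) = 0 :> W.
Proof.
move=> H; rewrite /front_op /front (spl_mapl (par := pp)) //.
rewrite -[RHS](spl0 pp W z); apply: eq_spl => -[|a [|b I]] J //=.
Qed.

Lemma front_op_iF (W : lmodType k) (K : G -> seq V -> W) p g (z : seq (bool * P)) :
  (forall s, K 0 s = 0) -> front_op K (iF p g :: map iW z) = K g (unzip2 z) :> W.
Proof.
move=> H; rewrite /front_op front_cons vl_iW /= -[RHS]addr0; congr (_ + _).
rewrite /front (spl_mapl (par := pp)) //.
rewrite -[RHS](spl0 pp W z); apply: eq_spl => -[|a [|b I]] J //=.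
by rewrite H scaler0.
Qed.

Lemma good_iF p g : hom (~~ p) g -> good (iF p g).
Proof. by move=> h; rewrite good_dsum h /= hom0. Qed.

Lemma mlin_inV (W : lmodType k) (f : seq U -> W) : mlin f ->
  @mlin k P W (fun s : seq P => f [seq inV w | w <- s]).
Proof.
move=> Hf s1 s2 a u v _; rewrite !map_cat /= -(mlinE Hf).
by congr (f (_ ++ _ :: _)); congr pair; rewrite /= scaler0 addr0.
Qed.

Lemma tw_iF g (ws : seq V) :
  tw ((g, 0) :: [seq inV w | w <- ws]) = (plug g ws, 0).
Proof.
pose f1 (g : G) (s : seq P) := tw ((g, 0) :: [seq inV w | w <- s]).
pose f2 (g : G) (s : seq P) : D := (plug g s, 0).
have fE p h : hom p h -> f1 h = f2 h.
  move=> hh; apply: mlin_eq.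
  - apply: (@mlin_inV _ (fun s => tw ((h, 0) :: s))).
    exact: (mlin_cons ((h, 0) : U) (@tw_mlin k V T)).
  - move=> s1 s2 a u v _; rewrite /f2 (mlinE (tplug_mlin h)).
    by congr pair; rewrite /= scaler0 addr0.
  move=> z gz; rewrite /f1 /f2 -unzip2_iW -[_ :: unzip2 _]/(unzip2 (iF (~~ p) h :: map iW z)).
  rewrite tw_good.
    rewrite front_op_iF; last exact: tplug0.
    by congr pair; case: z {gz} => [|a z] //=; rewrite oppr0.
  by rewrite /= good_iF ?negbK // iW_good.
have -> : tw ((g, 0) :: [seq inV w | w <- ws]) = f1 (pr false g) ws + f1 (pr true g) ws.
  rewrite /f1 -(mlin_add [::] _ _ _ (@tw_mlin k V T)).
  by congr (tw ((_ : U) :: _)); congr pair; rewrite /= ?addr0 -?pr_dec.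
rewrite (fE false) ?pr_hom // (fE true) ?pr_hom // /f2.
congr pair; last by rewrite /= addr0.
by rewrite -(lin_add (tplug_linl ws)) -pr_dec.
Qed.

Lemma tw_iW (ws : seq V) :
  tw [seq inV w | w <- ws] = if ws is [:: w] then (0, - w) else 0.
Proof.
pose f1 (s : seq P) := tw [seq inV w | w <- s].
pose f2 (s : seq P) : D := if s is [:: w] then (0, - w) else 0.
suff: f1 = f2 by move=> /(congr1 (fun f => f ws)).
apply: mlin_eq.
- exact: (@mlin_inV _ tw (@tw_mlin k V T)).
- move=> [|x [|y s1]] [|c s2] a u v _ //=; rewrite ?scaler0 ?addr0 //.
  by congr pair; rewrite /= ?scaler0 ?addr0 // opprD scalerN.
move=> z gz; rewrite /f1 /f2 -unzip2_iW tw_good ?iW_good // front_op_iW; last exact: tplug0.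
by case: z {gz} => [|a [|b z]].
Qed.

Lemma tw_nil : tw [::] = 0.
Proof. exact: (tw_iW [::]). Qed.

Lemma op_nil : @Lop k LD [::] = 0.
Proof. by rewrite (@op_good _ _ _ [::]). Qed.

Definition in_G (x : U) : bool := x.2 == 0.

Lemma count_prs b (s : seq U) : size b = size s ->
  (count in_G s <= count in_G (prs b s))%N.
Proof.
elim: s b => [|x s IH] [|p b] //= [/IH h]; apply: leq_add => //.
by rewrite /in_G; case: eqP => //; case: x => g w /= ->; case: p;
  rewrite /pr /= ?(lin_0 (@ev_linear _ _)) ?subrr ?eqxx.
Qed.

(** A letter without V-component that is not the one moved to the front is an
argument 0. *)
Lemma form_two (W : lmodType k) (K : G -> seq V -> W) b (s : seq U) :
  (forall g, mlin (K g)) -> (1 < count in_G s)%N ->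
  \sum_(i < size s) sgn (nth false b i && parsum (take i b)) *:
       K (nth (0 : U) s i).1 [seq x.2 | x <- take i s ++ drop i.+1 s] = 0.
Proof.
move=> HK hs; rewrite big1 // => -[i hi] _ /=.
rewrite (mlin_has0 (U := Pi V) (HK _)) ?scaler0 //.
have: (0 < count in_G (take i s ++ drop i.+1 s))%N.
  rewrite count_cat; move: hs; rewrite -{1}(cat_take_drop i s) (drop_nth 0) //.
  rewrite count_cat /= addnCA; case: (in_G _) => //=.
  by move/ltnW.
rewrite -has_count => /hasP[x hx /eqP hx2]; apply/mapP; exists x => //.
Qed.

Lemma tw_two (s : seq D) : (1 < count in_G s)%N -> tw s = 0.
Proof.
move=> hs; rewrite /tw /kext big_seq big1 // => b /size_words hb.
have hp := leq_trans hs (count_prs hb).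
rewrite /tw_form form_two //; last exact: tplug_mlin.
by case: (@prs k U b s) hp => [|x [|y t]] //=; rewrite addn0; case: (in_G _).
Qed.

Lemma op_two (s : seq D) : (1 < count in_G s)%N -> (@Lop k LD s).2 = 0.
Proof.
move=> hs; rewrite LopE /kext.
rewrite (big_morph (fun x : D => x.2) (id1 := 0) (op1 := +%R)) //.
rewrite big_seq big1 // => b /size_words hb.
have hp := leq_trans hs (count_prs hb).
by rewrite /op_form /= form_two //; exact: tact_mlin.
Qed.

Lemma op_three (s : seq D) : (2 < count in_G s)%N -> @Lop k LD s = 0.
Proof.
move=> hs; apply/eqP; rewrite -pair_eqE /pair_eq op_two ?eqxx ?andbT; last exact: ltnW.
rewrite LopE /kext (big_morph (fun x : D => x.1) (id1 := 0) (op1 := +%R)) //.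
rewrite big_seq big1 // => b /size_words hb.
have /leq_trans/(_ (count_size _ _)) := leq_trans hs (count_prs hb).
by rewrite /op_form /=; case: (@prs k U b s) => [|x [|y [|c t]]].
Qed.

Lemma op_iW (ws : seq V) : @Lop k LD [seq inV w | w <- ws] = 0.
Proof.
pose f1 (s : seq P) := @Lop k LD [seq inV w | w <- s].
suff: f1 = fun _ => 0 by move=> /(congr1 (fun f => f ws)).
apply: mlin_eq.
- exact: (@mlin_inV _ _ (@op_mlin k V T)).
- by move=> s1 s2 a u v _; rewrite scaler0 addr0.
move=> z gz; rewrite /f1 -unzip2_iW op_good ?iW_good // front_op_iW; last exact: tact0.
by case: z {gz} => [|a [|b [|c z]]] //=; rewrite (lin_0 (br_linl _)) scaler0.
Qed.

Lemma op_iF p g (z : seq (bool * P)) : hom (~~ p) g -> all (@good k P) z ->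
  @Lop k LD ((g, 0) :: [seq inV w | w <- unzip2 z]) = (0, act g (unzip2 z)).
Proof.
move=> hg gz; rewrite -unzip2_iW -[_ :: unzip2 _]/(unzip2 (iF p g :: map iW z)).
rewrite op_good; last by rewrite /= good_iF // iW_good.
rewrite front_op_iF; last exact: tact0.
by congr pair; case: z {gz} => [|a [|b z]] //=; rewrite (lin_0 (br_linr _)) scaler0.
Qed.

Lemma op_iFF p q g h (z : seq (bool * P)) : hom (~~ p) g -> hom (~~ q) h ->
  all (@good k P) z ->
  @Lop k LD ((g, 0) :: (h, 0) :: [seq inV w | w <- unzip2 z]) =
  (if z is [::] then sgn (~~ p) *: br g h else 0, 0).
Proof.
move=> hg hh gz; rewrite [LHS]surjective_pairing op_two; last first.
  by rewrite /= /in_G /= eqxx.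
have -> : (g, 0) :: (h, 0) :: [seq inV w | w <- unzip2 z] =
    unzip2 (iF p g :: iF q h :: map iW z) by rewrite /= -unzip2_iW.
rewrite op_good; last by rewrite /= !good_iF // iW_good.
by congr pair; case: z {gz}.
Qed.

End TwistRaw.

(** * The total structure *)

Section MoreExponential.
Variables (k : fieldType) (U X : superspace k) (F : seq (bool * U) -> X).
Hypothesis Fadd : ladd F.
Hypothesis Fsym : lsym F.

Lemma expc_ladd (W : lmodType k) (G : seq X -> W) : mlin G -> ladd (expc F G).
Proof.
move=> HG z1 z2 p u v; rewrite /expc !size_cat /= -big_split /=.
by apply: eq_bigr => r _; rewrite (blks_ladd Fadd _ HG) scalerDr.
Qed.

Lemma expc_lsym (W : lmodType k) (G : seq X -> W) : mlin G -> lsym (expc F G).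
Proof.
move=> HG z1 z2 x y gx gy; rewrite /expc !size_cat /= scaler_sumr /=.
apply: eq_bigr => r _; rewrite (blks_lsym Fsym _ HG) //.
by rewrite scalerA mulrC -scalerA.
Qed.

Lemma expc0 (W : lmodType k) (G : seq X -> W) z : (forall s, G s = 0) ->
  expc F G z = 0.
Proof.
move=> HG; rewrite /expc big1 // => r _.
rewrite (_ : blks _ _ _ _ = 0) ?scaler0 // -[RHS](blks0 (@fst bool U) W r z).
exact: eq_blks.
Qed.

End MoreExponential.

Lemma ladd_sub (k : fieldType) (U : superspace k) (W : lmodType k)
  (f g : seq (bool * U) -> W) : ladd f -> ladd g -> ladd (fun z => f z - g z).
Proof. by move=> Hf Hg z1 z2 p u v; rewrite Hf Hg opprD addrACA. Qed.

Lemma lsym_sub (k : fieldType) (U : superspace k) (W : lmodType k)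
  (f g : seq (bool * U) -> W) : lsym f -> lsym g -> lsym (fun z => f z - g z).
Proof. by move=> Hf Hg z1 z2 x y gx gy; rewrite Hf // Hg // scalerBr. Qed.

Lemma spl_hom (k : fieldType) (U X : superspace k) q (z : seq (bool * U))
  (psi : seq (bool * U) -> seq (bool * U) -> X) : all (@good k U) z ->
  (forall I J, all (@good k U) I -> all (@good k U) J ->
     lp (@fst bool U) I (+) lp (@fst bool U) J = lp (@fst bool U) z ->
     hom q (psi I J)) ->
  hom q (spl (@fst bool U) z psi).
Proof.
elim: z psi => [|a z IH] psi /=; first by move=> _; apply.
case/andP=> ga gz H; apply: homD; apply: IH => // I J gI gJ hl.
  by apply: H => //=; rewrite ?ga // !lp_cons -hl addbA.
by apply/homZ/H => //=; rewrite ?ga // !lp_cons -hl addbCA.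
Qed.

Section TwistTotal.
Variables (k : fieldType) (V : dgspace k) (T : twistable V).
Local Notation G := (tG T).
Local Notation P := (Pi V).
Local Notation D := (dsum G V).
Local Notation U := (Pi D).
Local Notation L := (bool * U)%type.
Local Notation pu := (@fst bool U).
Local Notation pp := (@fst bool P).
Local Notation br := (bracket (@tcomp k V T)).
Local Notation plug := (@tplug k V T).
Local Notation act := (@tact k V T).
Local Notation comp := (@tcomp k V T).
Local Notation dd := (tdd T).

Local Notation LD := (@LD k V T).
Local Notation tw := (@tw k V T).
Local Notation vl := (@vl k V T).
Local Notation iW := (@iW k V T).
Local Notation iF := (@iF k V T).
Local Notation inV := (@inV k V T).
Local Notation in_G := (@in_G k V T).
Local Notation tot := (@Ltot k LD).

Lemma totE s : tot s = @Lop k LD s +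
  (if s is [:: x] then - (br dd x.1, dif x.2) else 0).
Proof. by []. Qed.

Lemma tot_mlin : @mlin k U D tot.
Proof.
move=> s1 s2 a u v _; rewrite !totE (mlinE (@op_mlin k V T)) scalerDr addrACA.
congr (_ + _); apply: (mlinE (@mlin1 k V T D (fun x => - (br dd x.1, dif x.2)) _)).
move=> {}a {}u {}v; congr pair => /=.
  by rewrite br_linr opprD scalerN.
by rewrite dif_linear opprD scalerN.
Qed.

Lemma tot_sym : @ksym k U D tot.
Proof.
move=> s1 s2 p q u v hu hv _; rewrite !totE (ksymE (@op_sym k V T) _ _ hu hv).
by rewrite scalerDr; case: s1 => [|x [|y s1]] /=; rewrite scaler0.
Qed.

Lemma tot_nil : tot [::] = 0.
Proof. by rewrite totE op_nil addr0. Qed.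

Lemma tot_iW (ws : seq V) :
  tot [seq inV w | w <- ws] = if ws is [:: w] then (0, - dif w) else 0.
Proof.
rewrite totE op_iW add0r; case: ws => [|w [|w' ws]] //=.
by rewrite (lin_0 (br_linr _)); congr pair; rewrite /= oppr0.
Qed.

(** The differential of G is the bracket with dd, and enters only when no letter
of V is present. *)
Lemma tot_iF p g (z : seq (bool * P)) : hom (~~ p) g -> all (@good k P) z ->
  tot ((g, 0) :: [seq inV w | w <- unzip2 z]) =
  ((if z is [::] then - br dd g else 0), act g (unzip2 z)).
Proof.
move=> hg gz; rewrite totE (op_iF hg gz); case: z {gz} => [|a z] /=.
  rewrite (lin_0 (@dif_linear k V)).
  by congr pair => /=; rewrite ?add0r // oppr0 addr0.
by rewrite addr0.
Qed.

Lemma tot_iFF p q g h (z : seq (bool * P)) : hom (~~ p) g -> hom (~~ q) h ->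
  all (@good k P) z ->
  tot ((g, 0) :: (h, 0) :: [seq inV w | w <- unzip2 z]) =
  (if z is [::] then sgn (~~ p) *: br g h else 0, 0).
Proof. by move=> hg hh gz; rewrite totE (op_iFF hg hh gz) addr0. Qed.

Lemma tot_two (s : seq D) : (1 < count in_G s)%N -> (tot s).2 = 0.
Proof.
move=> hs; rewrite totE [LHS]/= op_two // add0r; move: hs.
by case: s => [|x [|y s]] //=; rewrite addn0; case: (in_G x).
Qed.

Lemma tot_three (s : seq D) : (2 < count in_G s)%N -> tot s = 0.
Proof.
move=> hs; rewrite totE op_three // add0r; move: hs.
by case: s => [|x [|y s]] //=; rewrite addn0; case: (in_G x).
Qed.

Lemma hom_dsum p (x : D) :
  @hom k U p x = @hom k G (~~ p) x.1 && @hom k P p x.2.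
Proof. exact: (@good_dsum k V T (p, x)). Qed.

Lemma lp_vl z : lp pp (map vl z) = lp pu z.
Proof. by rewrite /lp -map_comp. Qed.

Lemma tw_hom z : all (@good k U) z -> @hom k U (lp pu z) (tw (unzip2 z)).
Proof.
move=> gz; rewrite tw_good // hom_dsum /=; apply/andP; split.
  apply: spl_hom => // -[|a [|b I]] J; rewrite ?hom0 //=.
  rewrite good_dsum andbT => /andP[ga _] gJ; rewrite lp_cons /= addbF => <-.
  by have := tplug_hom ga (vl_good gJ); rewrite lp_vl addNb.
case: z gz => [|a [|b z]]; rewrite ?hom0 //= andbT good_dsum => /andP[_ h].
by rewrite lp_cons addbF; apply: hom_opp.
Qed.

Lemma tw_ladd : ladd (fun z : seq L => tw (unzip2 z)).
Proof. exact/mlin_ladd/tw_mlin. Qed.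

Lemma tw_lsym : lsym (fun z : seq L => tw (unzip2 z)).
Proof. exact/ksym_lsym/tw_sym. Qed.

Lemma iW_vl z : all (fun a : L => a.2.1 == 0) z -> z = map iW (map vl z).
Proof.
elim: z => [|[p [g w]] z IH] //= /andP[/eqP /= -> /IH {1}->].
by [].
Qed.

Hypothesis char0 : [pchar k] =i pred0.
Local Notation ttw := (fun z : seq L => tw (unzip2 z) : U).

(** On letters of V the twisting map has the single component w |-> - w. *)
Lemma expc_iW (W : lmodType k) (H : seq U -> W) (z : seq (bool * P)) :
  mlin H -> ksym H -> all (@good k P) z ->
  expc ttw H (map iW z) = H [seq inV (- w) | w <- unzip2 z].
Proof.
move=> HH SH gz; rewrite (expc_single char0) ?iW_good //.
- congr H; rewrite /unzip2 -!map_comp; apply: eq_map => a /=.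
  exact: (tw_iW T [:: a.2]).
- exact: tw_nil.
- exact: tw_hom.
move=> a I ha hI I0.
have E : a :: I = map iW (map vl (a :: I)).
  apply: iW_vl; apply/allP => c; rewrite inE => hc.
  have : c \in map iW z by case/orP: hc => [/eqP ->|/hI].
  by case/mapP => d _ ->.
rewrite E unzip2_iW; rewrite (tw_iW T (unzip2 (map vl (a :: I)))).
by case: I I0 {ha hI E}.
Qed.

(** The decomposition to which [sorted_zero] is applied. *)
Lemma dec_dsum p (u : U) : hom p u -> exists u1 u2,
  [/\ u = u1 + u2, hom p u1, hom p u2, in_G u1 & u2.1 == 0].
Proof.
case: u => g w; rewrite hom_dsum /= => /andP[hg hw].
exists (g, 0), (0, w); split; rewrite ?hom_dsum /in_G /= ?hg ?hw ?hom0 ?eqxx //.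
by congr pair; rewrite /= ?addr0 ?add0r.
Qed.

End TwistTotal.

(** * Compatibility with at most one derivation *)

Section TwistMap.
Variables (k : fieldType) (V : dgspace k) (T : twistable V).
Local Notation G := (tG T).
Local Notation P := (Pi V).
Local Notation D := (dsum G V).
Local Notation U := (Pi D).
Local Notation L := (bool * U)%type.
Local Notation pu := (@fst bool U).
Local Notation pp := (@fst bool P).
Local Notation br := (bracket (@tcomp k V T)).
Local Notation plug := (@tplug k V T).
Local Notation act := (@tact k V T).
Local Notation comp := (@tcomp k V T).
Local Notation dd := (tdd T).

Local Notation LD := (@LD k V T).
Local Notation tw := (@tw k V T).
Local Notation vl := (@vl k V T).
Local Notation iW := (@iW k V T).
Local Notation iF := (@iF k V T).
Local Notation inV := (@inV k V T).
Local Notation in_G := (@in_G k V T).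
Local Notation tot := (@Ltot k LD).
Local Notation ttw := (fun z : seq L => tw (unzip2 z) : U).
Hypothesis char0 : [pchar k] =i pred0.

Local Notation psi := (fun I J : seq L => tw (tot (unzip2 I) :: unzip2 J)).

Lemma tw0l s : tw (0 :: s) = 0.
Proof. exact: (mlin0 [::] s (@tw_mlin k V T)). Qed.

Lemma tw_pair (x : D) s : tw (x :: s) = tw ((x.1, 0) :: s) + tw (inV x.2 :: s).
Proof.
have {1}-> : x = ((x.1, 0) : U) + inV x.2 :> U.
  by case: x => a b; congr pair; rewrite /= ?addr0 ?add0r.
exact: (mlin_add [::] s _ _ (@tw_mlin k V T)).
Qed.

(** Only the differential of V contributes, and - 1 commutes with it. *)
Lemma tw_tot_V (z : seq (bool * P)) : all (@good k P) z ->
  spl pu (map iW z) psi = expc ttw tot (map iW z).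
Proof.
move=> gz; rewrite expc_iW ?tot_iW //; [|exact: tot_mlin|exact: tot_sym].
rewrite (spl_mapl (par := pp)) //.
rewrite [LHS](_ : _ = spl pp z (fun I J => if J is [::] then
   if I is [:: a] then (0, dif a.2) else 0 else 0)); last first.
  apply: eq_spl => I J; rewrite !unzip2_iW tot_iW.
  case: I => [|a [|b I]] /=; try by rewrite tw0l; case: J.
  rewrite -[_ :: map inV _]/([seq inV w | w <- - dif a.2 :: unzip2 J]) tw_iW.
  by case: J => //=; rewrite opprK.
rewrite spl_nilr (map_comp inV -%R) tot_iW; case: z {gz} => [|a [|b z]] //=.
have -> : dif (- a.2) = - dif a.2 by rewrite -scaleN1r (lin_scale (@dif_linear k V)) scaleN1r.
by rewrite opprK.
Qed.

Lemma spl_pair (z : seq (bool * P)) (x : seq (bool * P) -> seq (bool * P) -> G)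
   (y : seq (bool * P) -> seq (bool * P) -> V) :
  spl pp z (fun I J => (x I J, y I J) : D) = (spl pp z x, spl pp z y).
Proof.
rewrite [LHS]surjective_pairing; congr pair.
  exact: (@spl_map _ _ pp D G (fun u : D => u.1)).
exact: (@spl_map _ _ pp D V (fun u : D => u.2)).
Qed.

(** A letter of V is moved past a letter of G, at the cost of a sign. *)
Lemma tw_iW_iF p q w g (z : seq (bool * P)) : @hom k P p w -> hom (~~ q) g ->
  tw (inV w :: (g, 0) :: [seq inV v | v <- unzip2 z]) =
  (sgn (p && q) *: plug g (w :: unzip2 z), 0).
Proof.
move=> hw hg.
rewrite (@ksymE k U D _ (@tw_sym k V T) [::] _ p q); first last.
- by rewrite hom_dsum /= hg hom0.
- by rewrite hom_dsum /= hom0 hw.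
rewrite -[inV w :: _]/([seq inV v | v <- w :: unzip2 z]) tw_iF.
by congr pair; rewrite /= scaler0.
Qed.

(** The component of y in G is lost since the twisting map vanishes on two
letters of G. *)
Lemma tw_split_iF g (y : D) q (z : seq (bool * P)) p : hom (~~ q) g ->
  @hom k P p y.2 ->
  tw (y :: (g, 0) :: [seq inV v | v <- unzip2 z]) =
  (sgn (p && q) *: plug g (y.2 :: unzip2 z), 0).
Proof.
move=> hg hy; rewrite -(tw_iW_iF _ hy hg).
rewrite tw_pair [X in X + _]tw_two ?add0r //.
by rewrite /= /in_G /= !eqxx.
Qed.

(** The axiom [tplug_comp] for compositions with dd, which plugs to zero except
on the empty word and acts by the differential of V. *)
Lemma plug_dd_comp p g (z : seq (bool * P)) : hom p g -> all (@good k P) z ->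
  plug (br dd g) (unzip2 z) = br dd (plug g (unzip2 z)) -
  sgn p *: spl pp z (fun I J =>
     if I is [:: a] then plug g (- dif a.2 :: unzip2 J) else 0).
Proof.
move=> hg gz.
have E1 : plug (comp p dd g) (unzip2 z) =
    comp (p (+) lp pp z) dd (plug g (unzip2 z)).
  rewrite (tplug_comp (tdd_odd T) hg gz) [X in _ + X](_ : _ = 0) ?addr0.
    rewrite -[RHS](spl_nill pp z (fun J => comp (p (+) lp pp J) dd (plug g (unzip2 J)))).
    apply: eq_spl => -[|a I] J; first by rewrite tplug_nil andbF scale1r.
    by rewrite tdd_plug // (lin_0 (tcomp_linl _ _)) scaler0.
  rewrite -[RHS](spl0 pp G z); apply: eq_spl => I J.
  exact: tdd_plug.
have E2 : plug (comp true g dd) (unzip2 z) =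
    sgn (lp pp z) *: comp true (plug g (unzip2 z)) dd +
    spl pp z (fun I J => if I is [:: a] then plug g (- dif a.2 :: unzip2 J) else 0).
  rewrite (tplug_comp hg (tdd_odd T) gz); congr (_ + _).
    rewrite -[RHS](spl_nilr pp z (fun I => sgn (lp pp I) *: comp true (plug g (unzip2 I)) dd)).
    apply: eq_spl => I [|a J]; first by rewrite tplug_nil /lp.
    by rewrite tdd_plug // (lin_0 (tcomp_linr _ _)) scaler0.
  apply: eq_spl => -[|a [|b I]] J; rewrite tdd_act //=;
    by rewrite (mlin0 [::] _ (tplug_mlin g)).
rewrite (br_hom (tdd_odd T) hg) (br_hom (tdd_odd T) (tplug_hom hg gz)) /=.
rewrite (lin_add (tplug_linl _)) -scaleNr (lin_scale (tplug_linl _)) E1 E2.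
rewrite scalerDr !scaleNr scalerA -signr_addb addrA.
by [].
Qed.

(** On the right, tot is applied to plug g I and to - J, that is, to a sum of
+- act g (I ++ J) with the sign (-1)^|J|; by [spl_alt] it telescopes, except for
the term with J empty, where plug g I would act on the empty word. *)
Lemma tw_tot_g p g (z : seq (bool * P)) : hom (~~ p) g -> all (@good k P) z ->
  spl pu (iF p g :: map iW z) psi = expc ttw tot (iF p g :: map iW z).
Proof.
move=> hg gz; have gF : all (@good k U) (iF p g :: map iW z).
  by rewrite /= good_iF // iW_good.
pose S := spl pp z (fun I J =>
     if I is [:: a] then plug g (- dif a.2 :: unzip2 J) else 0).
(* On the left, tot takes g alone, one letter of V, or g and all its arguments. *)
transitivity ((- br dd (plug g (unzip2 z)), - act g (unzip2 z)) : D).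
  rewrite /= !(spl_mapl (par := pp)) // -splD.
  transitivity (spl pp z (fun I J =>
     ((if I is [::] then - plug (br dd g) (unzip2 J) else 0) +
      sgn p *: (if I is [:: a] then plug g (- dif a.2 :: unzip2 J) else 0),
      if J is [::] then - act g (unzip2 I) else 0) : D)).
    apply: (@eq_spl_in _ _ _ (@good k P)) => // I J gI gJ _ _.
    rewrite !unzip2_iW (tot_iF hg gI) tot_iW.
    have -> (x : G) (y : V) : tw ((x, y) :: [seq inV w | w <- unzip2 J]) =
        (plug x (unzip2 J), if J is [::] then - y else 0).
      rewrite tw_pair tw_iF.
      rewrite -[_ :: _]/([seq inV v | v <- y :: unzip2 J]) tw_iW.
      by case: J {gJ} => [|a J]; congr pair; rewrite /= ?addr0 ?add0r.
    have -> : plug (if I is [::] then - br dd g else 0) (unzip2 J) =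
        if I is [::] then - plug (br dd g) (unzip2 J) else 0.
      case: I {gI} => [|a I]; last exact: tplug0.
      by rewrite -scaleN1r (lin_scale (tplug_linl _)) scaleN1r.
    case: I gI => [|a [|b I]] gI /=.
    - rewrite tw0l !scaler0 !addr0.
      by congr pair; rewrite /= addr0.
    - have hd : @hom k P (~~ a.1) (- dif a.2).
        apply: hom_opp; move: gI; rewrite /= andbT /good /hom !Pi_prE.
        by move=> /(@dif_odd k V (~~ a.1)); rewrite /hom.
      rewrite (tw_iW_iF _ hd hg) lp_cons addbF /=.
      congr pair; last by rewrite /= scaler0 addr0.
      rewrite /= !add0r scalerA -signr_addb.
      by congr ((-1) ^+ nat_of_bool _ *: _); case: (a.1); case: (p).
    rewrite tw0l !scaler0 !addr0.
    by congr pair; rewrite /= addr0.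
  rewrite spl_pair splD splZ -/S spl_nilr; congr pair.
  rewrite (spl_nill pp z (fun J => - plug (br dd g) (unzip2 J))).
  rewrite (plug_dd_comp hg gz) -/S opprB signrN.
  by rewrite addrAC scaleNr addNr add0r.
rewrite (expc_cons char0) //; [|exact: tw_nil|exact: tw_hom|exact: tot_mlin|exact: tot_sym].
rewrite (spl_mapl (par := pp)) //.
transitivity (spl pp z (fun I J =>
    (if J is [::] then - br dd (plug g (unzip2 I)) else 0,
     (-1) ^+ size J *: act g (unzip2 (I ++ J)) +
     if J is [::] then - act g (unzip2 I) else 0) : D)).
  rewrite spl_pair (spl_nilr pp z (fun I => - br dd (plug g (unzip2 I)))).
  rewrite splD (spl_nilr pp z (fun I => - act g (unzip2 I))).
  rewrite (@spl_alt k P V (fun z => act g (unzip2 z))) //; last first.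
    exact: (@ksym_lsym k P V _ (tact_sym g)).
  by case: (z) => [|a z']; rewrite /= ?tact_nil add0r.
apply: (@eq_spl_in _ _ _ (@good k P)) => // I J gI gJ _ _; apply/esym.
rewrite expc_iW //; first last.
- by move=> s1 s2 r q u v hu hv _; rewrite -!cat_cons (ksymE (@tot_sym k V T) _ _ hu hv).
- exact: mlin_cons (@tot_mlin k V T).
rewrite [X in tot (X :: _)](_ : _ = (plug g (unzip2 I), 0)); last first.
  by rewrite /= unzip2_iW tw_iF.
pose Jo := [seq (a.1, - a.2) : bool * P | a <- J].
have -> : [seq inV (- w) | w <- unzip2 J] = [seq inV w | w <- unzip2 Jo].
  by rewrite /unzip2 -!map_comp.
have gJo : all (@good k P) Jo.
  by rewrite all_map; apply: sub_all gJ => a; exact: (@hom_opp k P a.1 a.2).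
have hp : hom (~~ (p (+) lp pp I)) (plug g (unzip2 I)).
  by rewrite -addNb; apply: tplug_hom.
rewrite (tot_iF hp gJo); congr pair; first by rewrite /Jo; case: (J).
have -> : unzip2 Jo = map -%R (unzip2 J) by rewrite /unzip2 -!map_comp.
rewrite (mlin_opp (U := P) _ (tact_mlin _)) size_map.
case: J {gJ Jo gJo} (gJ) => [|a J] gJ; first by rewrite tact_nil scaler0 cats0 scale1r subrr.
by rewrite tact_plug // addr0.
Qed.

End TwistMap.

(** * The twisting map is a morphism *)

Section TwistMap2.
Variables (k : fieldType) (V : dgspace k) (T : twistable V).
Local Notation G := (tG T).
Local Notation P := (Pi V).
Local Notation D := (dsum G V).
Local Notation U := (Pi D).
Local Notation L := (bool * U)%type.
Local Notation pu := (@fst bool U).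
Local Notation pp := (@fst bool P).
Local Notation br := (bracket (@tcomp k V T)).
Local Notation plug := (@tplug k V T).
Local Notation act := (@tact k V T).
Local Notation comp := (@tcomp k V T).
Local Notation dd := (tdd T).

Local Notation LD := (@LD k V T).
Local Notation tw := (@tw k V T).
Local Notation vl := (@vl k V T).
Local Notation iW := (@iW k V T).
Local Notation iF := (@iF k V T).
Local Notation inV := (@inV k V T).
Local Notation in_G := (@in_G k V T).
Local Notation tot := (@Ltot k LD).
Local Notation ttw := (fun z : seq L => tw (unzip2 z) : U).
Hypothesis char0 : [pchar k] =i pred0.

Local Notation psi := (fun I J : seq L => tw (tot (unzip2 I) :: unzip2 J)).

(** The axiom [tplug_comp] for both terms of a bracket; the second one is brought
to the form of the first by exchanging the parts of the unshuffle. *)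
Lemma plug_br p q g h (z : seq (bool * P)) : hom p g -> hom q h ->
  all (@good k P) z ->
  plug (br g h) (unzip2 z) =
  spl pp z (fun I J => sgn (q && lp pp I) *:
     br (plug g (unzip2 I)) (plug h (unzip2 J))) +
  spl pp z (fun I J => plug g (act h (unzip2 I) :: unzip2 J)) -
  sgn (p && q) *: spl pp z (fun I J => plug h (act g (unzip2 I) :: unzip2 J)).
Proof.
move=> hg hh gz; rewrite (br_hom hg hh) (lin_add (tplug_linl _)) -scaleNr.
rewrite (lin_scale (tplug_linl _)) (tplug_comp hg hh gz) (tplug_comp hh hg gz).
rewrite [X in _ + _ *: (X + _)]spl_comm scalerDr addrA; congr (_ + _); last by rewrite scaleNr.
rewrite addrAC; congr (_ + _); rewrite -splZ -splD.
apply: (@eq_spl_in _ _ _ (@good k P)) => // I J gI gJ _ _.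
rewrite (br_hom (tplug_hom hg gI) (tplug_hom hh gJ)) scalerBr; congr (_ + _).
rewrite scaleNr; congr (- _); ssign.
Qed.

Lemma expc_tw (W : lmodType k) (H : seq U -> W) a z : mlin H -> ksym H ->
  all (@good k U) (a :: z) ->
  expc ttw H (a :: z) =
  spl pu z (fun I J => expc ttw (fun t => H (tw (unzip2 (a :: I)) :: t)) J).
Proof. by apply: expc_cons => //; [exact: tw_nil|exact: tw_hom]. Qed.

Lemma ksym_cons (W : lmodType k) (H : seq U -> W) x : ksym H ->
  ksym (fun t => H (x :: t)).
Proof.
by move=> SH s1 s2 r q u v hu hv _; rewrite -!cat_cons (ksymE SH _ _ hu hv).
Qed.

Lemma mlin_head0 (W : lmodType k) (H : seq U -> W) t : mlin H -> H (0 :: t) = 0.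
Proof. by move=> HH; apply: (mlin0 [::] t HH). Qed.

(** A block with two letters of G does not contribute, so a and b head different
blocks. *)
Lemma expc_tw2 (W : lmodType k) (H : seq U -> W) a b z : mlin H -> ksym H ->
  all (@good k U) (a :: b :: z) -> in_G a.2 -> in_G b.2 ->
  expc ttw H (a :: b :: z) =
  spl pu z (fun I J => sgn (b.1 && lp pu I) *:
     expc ttw (fun t => H (tw (unzip2 (a :: I)) :: t)) (b :: J)).
Proof.
move=> HH SH gabz na nb; rewrite expc_tw //= -[RHS]add0r; congr (_ + _).
rewrite -[RHS](spl0 pu W z); apply: eq_spl => I J; apply: expc0 => t.
by rewrite tw_two ?mlin_head0 //= na nb.
Qed.

(** On the left, tot is applied to both letters of G or to one of them; on the
right, only the bracket of the two twisted derivations remains.  Their equality is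
[plug_br]. *)
Lemma tw_tot_gg p q g h (z : seq (bool * P)) : hom (~~ p) g -> hom (~~ q) h ->
  all (@good k P) z ->
  spl pu (iF p g :: iF q h :: map iW z) psi =
  expc ttw tot (iF p g :: iF q h :: map iW z).
Proof.
move=> hg hh gz.
have gz' := @iW_good k V T _ gz.
have gFH : all (@good k U) (iF p g :: iF q h :: map iW z).
  by rewrite /= !good_iF.
have gH : all (@good k U) (iF q h :: map iW z) by rewrite /= !good_iF.
transitivity ((sgn (~~ p) *: plug (br g h) (unzip2 z) +
   sgn (q && ~~ p) *: spl pp z (fun I J => plug h (act g (unzip2 I) :: unzip2 J)) +
   sgn p *: spl pp z (fun I J => plug g (act h (unzip2 I) :: unzip2 J)), 0) : D).
  rewrite /= !(spl_mapl (par := pp)) // -!splD.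
  transitivity (spl pp z (fun I J =>
     ((if I is [::] then sgn (~~ p) *: plug (br g h) (unzip2 J) else 0) +
      sgn (q && ~~ p) *: plug h (act g (unzip2 I) :: unzip2 J) +
      sgn p *: plug g (act h (unzip2 I) :: unzip2 J), 0) : D)); last first.
    rewrite spl_pair !splD !splZ spl0.
    by rewrite (spl_nill pp z (fun J => sgn (~~ p) *: plug (br g h) (unzip2 J))).
  apply: (@eq_spl_in _ _ _ (@good k P)) => // I J gI gJ _ _.
  rewrite !unzip2_iW (tot_iFF hg hh gI) (tot_iF hg gI) (tot_iF hh gI).
  have ag := tact_hom hg gI; have ah := tact_hom hh gI.
  rewrite (tw_split_iF (y := (_, act g _)) _ hh ag) (tw_split_iF (y := (_, act h _)) _ hg ah).
  have -> : tw [:: tot [seq inV w | w <- unzip2 I], (g, 0), (h, 0)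
                 & [seq inV w | w <- unzip2 J]] = 0.
    by apply: tw_two; rewrite /= /in_G /= !eqxx; case: eqP.
  rewrite tw_iF !scaler0 addr0 lp_cons lp_iW /=.
  have -> : plug (if I is [::] then sgn (~~ p) *: br g h else 0) (unzip2 J) =
      if I is [::] then sgn (~~ p) *: plug (br g h) (unzip2 J) else 0.
    case: (I) => [|a I']; last exact: tplug0.
    by rewrite (lin_scale (tplug_linl _)).
  congr pair; last by rewrite /= !scaler0 !addr0.
  rewrite /= !scalerA -!signr_addb; congr (_ + _ *: _ + _ *: _);
    congr ((-1) ^+ nat_of_bool _); bcase; reflexivity.
rewrite expc_tw2 /in_G /= ?eqxx //; [|exact: tot_mlin|exact: tot_sym].
rewrite (spl_mapl (par := pp)) //.
rewrite [RHS](_ : _ = spl pp z (fun I J => (sgn (q && lp pp I) *: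
    (sgn (~~ (p (+) lp pp I)) *: br (plug g (unzip2 I)) (plug h (unzip2 J))), 0) : D)).
  rewrite spl_pair spl0; congr pair.
  rewrite (plug_br hg hh gz); set A := spl _ _ (fun I J => sgn (~~ q && _) *: _).
  set X := spl _ _ _; set Y := spl _ _ _.
  transitivity (sgn (~~ p) *: A).
    case: (p); case: (q); rewrite /= ?(expr0, expr1, scale1r, scaleN1r) ?opprD ?opprK;
      by rewrite ?addrNK ?addrK ?addrNK.
  by rewrite -splZ; apply: eq_spl => I J; ssign.
apply: (@eq_spl_in _ _ _ (@good k P)) => // I J gI gJ _ _.
have gI' := @iW_good k V T _ gI; have gJ' := @iW_good k V T _ gJ.
have gHJ : all (@good k U) (iF q h :: map iW J) by rewrite /= good_iF.
have tFI : tw (unzip2 (iF p g :: map iW I)) = (plug g (unzip2 I), 0).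
  by rewrite /= unzip2_iW tw_iF.
rewrite tFI lp_iW expc_tw //; first last.
- exact/ksym_cons/tot_sym.
- exact/mlin_cons/tot_mlin.
rewrite (spl_mapl (par := pp)) //.
transitivity (sgn (q && lp pp I) *: spl pp J (fun J1 J2 => if J2 is [::] then
   (sgn (~~ (p (+) lp pp I)) *: br (plug g (unzip2 I)) (plug h (unzip2 J1)), 0) : D
   else 0)).
  congr (_ *: _); apply: (@eq_spl_in _ _ _ (@good k P)) => // J1 J2 g1 g2 _ _.
  have tHJ : tw (unzip2 (iF q h :: map iW J1)) = (plug h (unzip2 J1), 0).
    by rewrite /= unzip2_iW tw_iF.
  rewrite tHJ expc_iW //; first last.
  - by apply: (@ksym_cons D (fun t => tot (_ :: t))); apply: ksym_cons; exact: tot_sym.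
  - by apply: (@mlin_cons k U D (fun t => tot (_ :: t))); apply: mlin_cons; exact: tot_mlin.
  pose Jo := [seq (a.1, - a.2) : bool * P | a <- J2].
  have -> : [seq inV (- w) | w <- unzip2 J2] = [seq inV w | w <- unzip2 Jo].
    by rewrite /unzip2 -!map_comp.
  have gJo : all (@good k P) Jo.
    by rewrite all_map; apply: sub_all g2 => a; exact: (@hom_opp k P a.1 a.2).
  have hp : hom (~~ (p (+) lp pp I)) (plug g (unzip2 I)).
    by rewrite -addNb; apply: tplug_hom.
  have hq : hom (~~ (q (+) lp pp J1)) (plug h (unzip2 J1)).
    by rewrite -addNb; apply: tplug_hom.
  by rewrite (tot_iFF hp hq gJo) /Jo; case: (J2).
rewrite (spl_nilr pp J (fun J1 => (sgn (~~ (p (+) lp pp I)) *: br (plug g (unzip2 I)) (plug h (unzip2 J1)), 0) : D)).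
by congr pair; rewrite /= scaler0.
Qed.

Lemma tw_in_G a z : all (@good k U) (a :: z) -> in_G a.2 -> in_G (tw (unzip2 (a :: z))).
Proof.
move=> gz /eqP a0; rewrite tw_good // /in_G /=; case: z {gz} => [|b z] //.
by rewrite a0 oppr0.
Qed.

(** tw vanishes on two letters of G and tot on three; on two, tot has no component
in V. *)
Lemma tw_tot_ggg a b c z : all (@good k U) [:: a, b, c & z] ->
  in_G a.2 -> in_G b.2 -> in_G c.2 ->
  spl pu [:: a, b, c & z] psi = 0 /\ expc ttw tot [:: a, b, c & z] = 0.
Proof.
move=> gz na nb nc.
have gbc : all (@good k U) [:: b, c & z] by case/andP: gz.
have ga : good a by case/andP: gz.
split.
  have Z (s t : seq U) : (1 < count in_G s)%N -> (0 < count in_G t)%N -> tw (tot s :: t) = 0.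
    move=> hs ht; apply: tw_two; rewrite /= {1}/in_G tot_two // eqxx.
    by rewrite add1n ltnS.
  have Z3 (s t : seq U) : (2 < count in_G s)%N -> tw (tot s :: t) = 0.
    by move=> hs; rewrite tot_three // tw0l.
  have Z2 (y : U) (t : seq U) : (1 < count in_G t)%N -> tw (y :: t) = 0.
    move=> ht; apply: tw_two; apply: leq_trans ht _; exact: leq_addl.
  rewrite /= -!splD -[RHS](spl0 pu D z); apply: eq_spl => I J.
  rewrite (Z3 [:: a.2, b.2, c.2 & _]) /= ?na ?nb ?nc //.
  rewrite (Z [:: a.2, b.2 & _] [:: c.2 & _]) /= ?na ?nb ?nc //.
  rewrite (Z [:: a.2, c.2 & _] [:: b.2 & _]) /= ?na ?nb ?nc //.
  rewrite (Z [:: b.2, c.2 & _] [:: a.2 & _]) /= ?na ?nb ?nc //.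
  rewrite (Z2 _ [:: b.2, c.2 & _]) /= ?na ?nb ?nc //.
  rewrite (Z2 _ [:: a.2, c.2 & _]) /= ?na ?nb ?nc //.
  rewrite (Z2 _ [:: a.2, b.2 & _]) /= ?na ?nb ?nc //.
  rewrite (Z2 _ [:: a.2, b.2, c.2 & _]) /= ?na ?nb ?nc //.
  by rewrite !scaler0 !addr0.
rewrite expc_tw2 //; [|exact: tot_mlin|exact: tot_sym].
rewrite /= -splD -[RHS](spl0 pu D z); have gcz : all (@good k U) (c :: z).
  by case/andP: gbc.
have gz0 : all (@good k U) z by case/andP: gcz.
apply: (@eq_spl_in _ _ _ (@good k U)) => // I J gI gJ _ _.
rewrite [X in X + _](_ : _ = 0) ?add0r; last first.
  rewrite [X in sgn _ *: X](_ : _ = 0) ?scaler0 //; apply: expc0 => t.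
  rewrite (_ : tw _ = 0); first exact: (mlin0 [::] t (@tot_mlin k V T)).
  by apply: tw_two; rewrite /= na nc.
have gbcJ : all (@good k U) [:: b, c & J].
  by move: gbc => /= /andP[-> /andP[-> _]].
rewrite expc_tw2 //; first last.
- exact/ksym_cons/tot_sym.
- exact/mlin_cons/tot_mlin.
rewrite [X in sgn _ *: (sgn _ *: X)](_ : _ = 0) ?scaler0 //.
rewrite -[RHS](spl0 pu D J); apply: (@eq_spl_in _ _ _ (@good k U)) => // I1 J1 g1 g2 _ _.
have gc1 : all (@good k U) (c :: J1) by move: gcz => /= /andP[-> _].
have gb1 : all (@good k U) (b :: I1) by move: gbc => /= /andP[-> _].
rewrite expc_tw //; first last.
- by apply: (@ksym_cons D (fun t => tot (_ :: t))); apply: ksym_cons; exact: tot_sym.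
- by apply: (@mlin_cons k U D (fun t => tot (_ :: t))); apply: mlin_cons; exact: tot_mlin.
rewrite [X in sgn _ *: X](_ : _ = 0) ?scaler0 //.
rewrite -[RHS](spl0 pu D J1); apply: (@eq_spl_in _ _ _ (@good k U)) => // I2 J2 g3 g4 _ _.
have gc2 : all (@good k U) (c :: I2) by move: gcz => /= /andP[-> _].
apply: expc0 => t; apply: tot_three => /=; rewrite !(@tw_in_G _ _) //.
by rewrite /= ga.
Qed.

Lemma in_G_iF (a : L) : good a -> in_G a.2 ->
  exists p g, a = iF p g /\ hom (~~ p) g.
Proof.
case: a => p [g w]; rewrite good_dsum /= => /andP[hg _] /eqP /= ->.
by exists p, g.
Qed.

(** Words of g~(V) are sorted into letters of G followed by letters of V. *)
Lemma sorted_D (W : lmodType k) (Phi : seq L -> W) : ladd Phi -> lsym Phi ->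
  (forall z, all (@good k P) z -> Phi (map iW z) = 0) ->
  (forall p g z, hom (~~ p) g -> all (@good k P) z -> Phi (iF p g :: map iW z) = 0) ->
  (forall p q g h z, hom (~~ p) g -> hom (~~ q) h -> all (@good k P) z ->
     Phi (iF p g :: iF q h :: map iW z) = 0) ->
  (forall a b c z, all (@good k U) [:: a, b, c & z] ->
     in_G a.2 -> in_G b.2 -> in_G c.2 -> Phi [:: a, b, c & z] = 0) ->
  forall z, all (@good k U) z -> Phi z = 0.
Proof.
move=> HA HS H0 H1 H2 H3; apply: (@sorted_zero k U (fun a => in_G a.2) (fun a => a.2.1 == 0)) => //.
  exact: dec_dsum.
move=> fs ws gf gw Af Bw; rewrite (iW_vl Bw); have gv := vl_good gw.
case: fs gf Af => [|a [|b [|c fs]]] gf Af; first exact: H0.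
- move: gf Af => /= /andP[ga _] /andP[na _].
  by have [p [g [-> hg]]] := in_G_iF ga na; apply: H1.
- move: gf Af => /= /and3P[ga gb _] /and3P[na nb _].
  have [p [g [-> hg]]] := in_G_iF ga na; have [q [h [-> hh]]] := in_G_iF gb nb.
  exact: H2.
move: Af => /= /and4P[na nb nc _]; apply: H3 => //.
by rewrite -!cat_cons all_cat gf iW_good.
Qed.

Lemma tw_tot z : all (@good k U) z -> spl pu z psi = expc ttw tot z.
Proof.
move=> gz; apply/eqP; rewrite -subr_eq0; apply/eqP; move: z gz.
apply: sorted_D.
- apply: ladd_sub.
    apply: spl_ladd => [J z1 z2 p u v|I].
      rewrite (mlin_ladd (U := U) (@tot_mlin k V T)).
      exact: (mlin_add [::] _ _ _ (@tw_mlin k V T)).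
    exact: (@mlin_ladd _ U _ (fun s => tw (_ :: s)) (mlin_cons _ (@tw_mlin k V T))).
  by apply: expc_ladd; [exact: tw_ladd|exact: tot_mlin].
- apply: lsym_sub.
    apply: spl_lsym => [J z1 z2 x y gx gy|I].
      rewrite (ksym_lsym (U := U) (@tot_sym k V T)) //.
      exact: (mlinZ [::] _ _ _ (@tw_mlin k V T)).
    exact: (@ksym_lsym _ U _ (fun s => tw (_ :: s)) (ksym_cons _ (@tw_sym k V T))).
  by apply: expc_lsym; [exact: tw_lsym|exact: tot_mlin].
- by move=> z gz; rewrite (tw_tot_V T char0) // subrr.
- by move=> p g z hg gz; rewrite (@tw_tot_g k V T char0 p g z) // subrr.
- by move=> p q g h z hg hh gz; rewrite tw_tot_gg // subrr.
by move=> a b c z gz na nb nc; have [-> ->] := tw_tot_ggg gz na nb nc; rewrite subrr.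
Qed.

End TwistMap2.

(** * The twisting map is an involution *)

Section TwistAut.
Variables (k : fieldType) (V : dgspace k) (T : twistable V).
Local Notation G := (tG T).
Local Notation P := (Pi V).
Local Notation D := (dsum G V).
Local Notation U := (Pi D).
Local Notation L := (bool * U)%type.
Local Notation pu := (@fst bool U).
Local Notation pp := (@fst bool P).
Local Notation br := (bracket (@tcomp k V T)).
Local Notation plug := (@tplug k V T).
Local Notation act := (@tact k V T).
Local Notation comp := (@tcomp k V T).
Local Notation dd := (tdd T).

Local Notation LD := (@LD k V T).
Local Notation tw := (@tw k V T).
Local Notation vl := (@vl k V T).
Local Notation iW := (@iW k V T).
Local Notation iF := (@iF k V T).
Local Notation inV := (@inV k V T).
Local Notation in_G := (@in_G k V T).
Local Notation ttw := (fun z : seq L => tw (unzip2 z) : U).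
Hypothesis char0 : [pchar k] =i pred0.
Local Notation Id := (@Lid k D).

Lemma Lid_mlin : @mlin k U D Id.
Proof. exact: (@mlin1 k V T D id). Qed.

Lemma Lid_sym : @ksym k U D Id.
Proof.
by move=> [|x [|y s1]] s2 p q u v hu hv _ /=; rewrite scaler0.
Qed.

(** Plugging I and then - J: the alternating sum over unshuffles leaves only the
empty word. *)
Lemma tw_inv_g p g (z : seq (bool * P)) : hom (~~ p) g -> all (@good k P) z ->
  expc ttw tw (iF p g :: map iW z) = Id (unzip2 (iF p g :: map iW z)).
Proof.
move=> hg gz; have gF : all (@good k U) (iF p g :: map iW z).
  by rewrite /= good_iF // iW_good.
rewrite (expc_tw char0) //; [|exact: tw_mlin|exact: tw_sym].
rewrite (spl_mapl (par := pp)) //.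
transitivity (spl pp z (fun I J => ((-1) ^+ size J *: plug g (unzip2 (I ++ J)), 0) : D)).
  apply: (@eq_spl_in _ _ _ (@good k P)) => // I J gI gJ _ _.
  rewrite (_ : tw _ = (plug g (unzip2 I), 0)); last by rewrite /= unzip2_iW tw_iF.
  rewrite (expc_iW char0) //; first last.
  - by apply: ksym_cons; exact: tw_sym.
  - by apply: mlin_cons; exact: tw_mlin.
  rewrite (map_comp inV -%R) tw_iF; congr pair.
  by rewrite (mlin_opp (U := P) _ (tplug_mlin _)) size_map tplug_plug.
rewrite spl_pair spl0 (@spl_alt k P G (fun z => plug g (unzip2 z))) //.
  by case: (z) => [|a z'] //=; rewrite tplug_nil.
exact: (@ksym_lsym k P G _ (tplug_sym g)).
Qed.

Lemma tw_inv_gg a b z : all (@good k U) (a :: b :: z) -> in_G a.2 -> in_G b.2 ->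
  expc ttw tw (a :: b :: z) = 0.
Proof.
move=> gz na nb; rewrite (expc_tw2 char0) //; [|exact: tw_mlin|exact: tw_sym].
have gz' : all (@good k U) z by move: gz => /= /and3P[].
rewrite -[RHS](spl0 pu D z); apply: (@eq_spl_in _ _ _ (@good k U)) => // I J gI gJ _ _.
have gb : all (@good k U) (b :: J) by move: gz => /= /and3P[_ -> _].
rewrite (expc_tw char0) //; first last.
- by apply: ksym_cons; exact: tw_sym.
- by apply: mlin_cons; exact: tw_mlin.
rewrite [X in sgn _ *: X](_ : _ = 0) ?scaler0 //.
rewrite -[RHS](spl0 pu D J); apply: (@eq_spl_in _ _ _ (@good k U)) => // I' J' g1 g2 _ _.
apply: expc0 => t; apply: tw_two => /=; rewrite !(@tw_in_G _ _ _) //=.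
  by rewrite g1 andbT; move: gz => /= /and3P[].
by rewrite gI andbT; move: gz => /= /and3P[].
Qed.

Lemma tw_inv z : all (@good k U) z -> expc ttw tw z = Id (unzip2 z).
Proof.
move=> gz; apply/eqP; rewrite -subr_eq0; apply/eqP; move: z gz.
apply: sorted_D.
- apply: ladd_sub; last exact: (mlin_ladd (U := U) Lid_mlin).
  by apply: expc_ladd; [exact: tw_ladd|exact: tw_mlin].
- apply: lsym_sub; last exact: (ksym_lsym (U := U) Lid_sym).
  by apply: expc_lsym; [exact: tw_lsym|exact: tw_mlin].
- move=> z gz; rewrite (expc_iW char0) ?(map_comp inV -%R) ?tw_iW //;
    [|exact: tw_mlin|exact: tw_sym].
  by case: z {gz} => [|a [|b z]] //=; rewrite ?opprK ?subrr.
- by move=> p g z hg gz; rewrite tw_inv_g // subrr.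
- move=> p q g h z hg hh gz; rewrite tw_inv_gg /in_G /= ?eqxx ?subr0 //.
  by rewrite !good_iF //= iW_good.
by move=> a b c z gz na nb nc; rewrite tw_inv_gg // subr0.
Qed.

Lemma homs_letters (X : superspace k) b (s : seq X) : homs b s ->
  exists2 z, all (@good k X) z & b = unzip1 z /\ s = unzip2 z.
Proof.
move=> hs; have hsz := homs_size hs; exists (zip b s); first exact: homs_good.
by rewrite unzip1_zip ?unzip2_zip ?hsz.
Qed.

Lemma spl_pred (X : Type) (par : X -> bool) (g : pred X) (W : lmodType k)
    (Q : W -> Prop) z (psi : seq X -> seq X -> W) :
  (forall x y, Q x -> Q y -> Q (x + y)) -> (forall c x, Q x -> Q (c *: x)) ->
  all g z -> (forall I J, all g I -> all g J -> Q (psi I J)) ->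
  Q (spl par z psi).
Proof.
move=> QD QZ; elim: z psi => [|a z IH] psi /=; first by move=> _; apply.
case/andP=> ga gz H; apply: QD; apply: IH => // I J gI gJ.
  by apply: H => //=; rewrite ga.
by apply/QZ/H => //=; rewrite ga.
Qed.

(** The value lies in the span of plug g w for the homogeneous parts g of the
first components and good words w. *)
Lemma tw_mem (S : G -> Prop) : S 0 ->
  (forall x y, S x -> S y -> S (x + y)) -> (forall c x, S x -> S (c *: x)) ->
  (forall p x, S x -> S (pr p x)) ->
  (forall g (z : seq (bool * P)), all (@good k P) z -> S g -> S (plug g (unzip2 z))) ->
  forall s : seq D, (forall x, x \in s -> S x.1) -> S (tw s).1.
Proof.
move=> S0 SD SZ Spr Splug s hs; rewrite /tw /kext.
rewrite (big_morph (fun x : D => x.1) (id1 := 0) (op1 := +%R)) //.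
rewrite big_seq; apply: (big_ind S) => // b /size_words hb.
have [z gz [Eb E]] := homs_letters (homs_prs (U := U) hb).
rewrite E {1}Eb /tw_form front_letters /front_op /front /=.
have gz' : all (fun a : L => good a && `[< S a.2.1 >]) z.
  apply/allP => -[p x] hx; rewrite (allP gz) //=; apply/asboolP.
  have: x \in @prs k U b s by rewrite E; apply/mapP; exists (p, x).
  case/mapP => -[q y] hy -> /=.
  have ys : y \in s by rewrite -(unzip2_zip (s := b) (t := s)) ?hb //; apply/mapP; exists (q, y).
  have -> : (@pr k U q y).1 = @pr k G (~~ q) y.1 by case: (q); rewrite /pr //= /pr /= opprB addrC subrK.
  by apply: Spr; apply: hs.
apply: (@spl_pred L pu _ G S z _ SD SZ gz' _) => -[|a [|c I]] J // /andP[/andP[_ /asboolP Sa] _] gJ.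
apply: Splug => //; apply: vl_good; apply: sub_all gJ => c.
by case/andP.
Qed.

(** The inverse of the twisting map is itself. *)
Lemma Linfty_aut_tw (S : G -> Prop) : S 0 ->
  (forall x y, S x -> S y -> S (x + y)) -> (forall c x, S x -> S (c *: x)) ->
  (forall p x, S x -> S (pr p x)) ->
  (forall g (z : seq (bool * P)), all (@good k P) z -> S g -> S (plug g (unzip2 z))) ->
  Linfty_aut (tilde S br dd act (@dif k V)) tw.
Proof.
move=> S0 SD SZ Spr Splug; set LS := tilde _ _ _ _ _.
suff Hm : Linfty_map LS LS tw.
  split=> //; exists tw => // b s _ /homs_letters[z gz [-> ->]].
  suff: Lcomp (X := D) tw tw (unzip1 z) (unzip2 z) = Lid (unzip2 z) by [].
  case: z gz => [|a z] gz; first by rewrite /Lcomp big_nil.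
  by rewrite (@Lcomp_expc k U U) tw_inv.
split.
- exact: tw_nil.
- exact: tw_mem.
- by move=> s1 s2 a u v _; apply: (mlinE (@tw_mlin k V T)).
- by move=> s1 s2 p q u v hu hv _; apply: (ksymE (@tw_sym k V T)).
- by move=> b s _ /homs_letters[z gz [-> ->]]; apply: tw_hom.
move=> b s _ /homs_letters[z gz [-> ->]].
have := @tw_tot k V T char0 z gz; case: z gz => [|a z] gz.
  move=> H; rewrite /Lcomp big_nil.
  apply: (etrans (@insl_spl k D D tw (@Ltot k LS) [::])); apply: (etrans H).
  by rewrite expc_nil; exact: (tot_nil T).
move=> H; apply: (etrans (@insl_spl k D D tw (@Ltot k LS) (a :: z))).
by apply: (etrans H); apply/esym; exact: (@Lcomp_expc k U U tw D (@Ltot k LS) a z).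
Qed.

End TwistAut.

(** * Products in a nilpotent algebra *)

Section NilAlgebra.
Variables (k : fieldType) (A : nilcdga k).
Local Notation Ix := 'I_(nc_dim A).
Local Notation par := (@nc_par k A).
Local Notation lp := (lp par).
Local Notation e := (@nc_e k A).
Local Notation cf := (coord (nc_basis A)).
Implicit Types (s t : seq A) (js : seq Ix) (p q : bool).

(** The empty product is set to 0, so that terms of arity 0 vanish in the
exponentials below. *)
Definition prodA s : A := if s is a :: s' then foldl (@nc_mul k A) a s' else 0.

Lemma nc_prodE js : nc_prod js = prodA (map e js).
Proof. by case: js. Qed.

Lemma foldl_lin s c (a b : A) :
  foldl (@nc_mul k A) (c *: a + b) s =
  c *: foldl (@nc_mul k A) a s + foldl (@nc_mul k A) b s.
Proof. by elim: s a b => //= d s IH a b; rewrite nc_mul_linl IH. Qed.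

Lemma foldl_mulA s (a b : A) :
  nc_mul a (foldl (@nc_mul k A) b s) = foldl (@nc_mul k A) (nc_mul a b) s.
Proof. by elim: s b => //= d s IH b; rewrite IH nc_mulA. Qed.

Lemma prodA_mlin : mlin prodA.
Proof.
move=> [|d s1] s2 c a b _ /=; first exact: foldl_lin.
by rewrite !foldl_cat /= nc_mul_linr foldl_lin.
Qed.

(** Associativity. *)
Lemma prodA_sub s1 t s2 : t != [::] ->
  prodA (s1 ++ prodA t :: s2) = prodA (s1 ++ t ++ s2).
Proof.
case: t => // a t _; case: s1 => [|d s1] /=; first by rewrite foldl_cat.
by rewrite !foldl_cat /= foldl_cat foldl_mulA.
Qed.

Lemma prodA_swap s1 p q (a b : A) s2 : nc_hom p a -> nc_hom q b ->
  prodA (s1 ++ a :: b :: s2) = sgn (p && q) *: prodA (s1 ++ b :: a :: s2).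
Proof.
move=> ha hb; have H x : nc_mul (nc_mul x a) b =
    sgn (p && q) *: nc_mul (nc_mul x b) a.
  rewrite -!nc_mulA (nc_mulC ha hb); have := nc_mul_linr x (sgn (p && q)) (nc_mul b a) 0.
  have -> : nc_mul x 0 = 0.
    have := nc_mul_linr x (-1) 0 0; by rewrite scaler0 addr0 scaleN1r addNr.
  by rewrite !addr0.
have foldlZ c x s : foldl (@nc_mul k A) (c *: x) s = c *: foldl (@nc_mul k A) x s.
  have := foldl_lin s c x 0; have := foldl_lin s (-1) 0 0.
  by rewrite scaler0 addr0 scaleN1r addNr addr0 => ->; rewrite addr0.
case: s1 => [|d s1] /=; first by rewrite (nc_mulC ha hb) foldlZ.
by rewrite !foldl_cat /= H foldlZ.
Qed.

Lemma prodA_nil s : (nc_nil A < size s)%N -> prodA s = 0.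
Proof. by case: s => //= a s hs; apply: nc_nilP. Qed.

Lemma e_coord i j : cf i (e j) = (i == j)%:R.
Proof.
rewrite /nc_e (tnth_nth 0) coord_free 1?eq_sym ?(basis_free (nc_basisP A)) //.
Qed.

Lemma e_hom j : nc_hom (par j) (e j).
Proof. by move=> i; rewrite e_coord; case: (i =P j) => [->|_] //; rewrite eqxx. Qed.

Lemma coordE (a : A) : a = \sum_i cf i a *: e i.
Proof.
rewrite {1}(coord_basis (nc_basisP A) (memvf a)); apply: eq_bigr => i _.
by rewrite /nc_e (tnth_nth 0).
Qed.

Lemma prodA_hom js : nc_hom (lp js) (prodA (map e js)).
Proof.
case: js => [|j js]; first by move=> i; rewrite raddf0 eqxx.
rewrite lp_cons /=; move: (e j) (par j) (@e_hom j) => a p.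
elim: js a p => [|i js IH] a p ha /=; first by rewrite addbF.
by rewrite lp_cons addbA; apply: IH; apply: nc_mul_hom => //; apply: e_hom.
Qed.

(** The elementary tensor of a and w, in coordinates. *)
Definition pure (W : lmodType k) (a : A) (w : W) : tensor A W :=
  [ffun l => cf l a *: w].

Lemma pure_linl (W : lmodType k) (w : W) : linear (fun a => pure a w).
Proof.
move=> c a b; apply/ffunP => l; rewrite !ffunE linearP scalerDl.
by rewrite scalerA.
Qed.

Lemma pure_linr (W : lmodType k) (a : A) : linear (@pure W a).
Proof.
move=> c u v; apply/ffunP => l; rewrite !ffunE scalerDr !scalerA.
by rewrite mulrC.
Qed.

Lemma esign_cons p a b :
  esign k p (a :: b) = sgn (p && a) * esign k (p (+) a) b.
Proof.
rewrite /esign [parsum _]/= [count _ _]/= mulrA -!signr_addb.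
have h : odd (count id b) = parsum b.
  by elim: b => //= x b IH; rewrite oddD IH; case: x.
congr ((-1) ^+ nat_of_bool _).
case: a => /=; last by rewrite add0n addbF; case: (p) => //=; rewrite addbF.
rewrite add1n binS bin1 oddD h.
by case: (p); case: (parsum b); case: (odd _).
Qed.

Lemma esign_cat p a b :
  esign k p (a ++ b) = esign k p a * esign k (p (+) parsum a) b.
Proof.
elim: a p => [|x a IH] p; first by rewrite /esign andbF addbF mul1r mul1r.
by rewrite cat_cons !esign_cons IH mulrA /= addbA.
Qed.

Lemma esign_perm p a b : perm_eq a b -> esign k p a = esign k p b.
Proof.
move=> hab; rewrite /esign; congr (sgn (_ && _) * sgn (odd 'C(_, 2))).
  elim: a b hab => [|x a IH] b hab; first by case: b hab => // y b /perm_size.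
  have xb : x \in b by rewrite -(perm_mem hab) inE eqxx.
  case/path.splitPr: xb hab => b1 b2 hab.
  have {}hab : perm_eq a (b1 ++ b2).
    by rewrite -(perm_cons x) (perm_trans hab) // -cat1s perm_catCA.
  by rewrite /= (IH _ hab) !parsum_cat /= addbCA.
by move/permP: hab => ->.
Qed.

End NilAlgebra.

(** * Evaluation of multilinear maps on tensors *)

Section Evaluation.
Variables (k : fieldType) (A : nilcdga k).
Local Notation Ix := 'I_(nc_dim A).
Local Notation par := (@nc_par k A).
Local Notation lp := (lp par).
Local Notation spl := (spl par).
Local Notation e := (@nc_e k A).
Local Notation cf := (coord (nc_basis A)).
Local Notation wd := (words (enum Ix)).
Implicit Types (s t : seq A) (js ks : seq Ix) (p q : bool) (W : lmodType k).

Lemma prodA_move s1 q (a : A) js s2 : nc_hom q a ->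
  prodA (s1 ++ a :: map e js ++ s2) =
  sgn (q && lp js) *: prodA (s1 ++ map e js ++ a :: s2).
Proof.
move=> ha; elim: js s1 => [|j js IH] s1 /=; first by rewrite andbF scale1r.
rewrite (prodA_swap _ _ ha (@e_hom k A j)) -cat_rcons IH cat_rcons scalerA.
by rewrite -signr_addb -andb_addr.
Qed.

(** The value of a multilinear map Psi on n copies of sum e_l (x) x_l, where
Psi js stands for the map applied to the x_j; s is a word of elements of A that
stand to the left of the e_j, and p the parity of what the e_j have to pass. *)
Definition ev W p s n (Psi : seq Ix -> W) : tensor A W :=
  \sum_(js <- wd n) esign k p (map par js) *: pure (prodA (s ++ map e js)) (Psi js).

Lemma eq_ev W p s n (Psi Psi' : seq Ix -> W) : (forall js, Psi js = Psi' js) ->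
  ev p s n Psi = ev p s n Psi'.
Proof. by move=> H; apply: eq_bigr => js _; rewrite H. Qed.

Lemma eq_ev_size W p s n (Psi Psi' : seq Ix -> W) :
  (forall js, size js = n -> Psi js = Psi' js) -> ev p s n Psi = ev p s n Psi'.
Proof. by move=> H; apply: eq_big_seq => js /size_words /H ->. Qed.

Lemma ev_lin W p s n c (Psi Psi' : seq Ix -> W) :
  ev p s n (fun js => c *: Psi js + Psi' js) = c *: ev p s n Psi + ev p s n Psi'.
Proof.
rewrite scaler_sumr -big_split; apply: eq_bigr => js _ /=.
by rewrite pure_linr scalerDr !scalerA [c * _]mulrC.
Qed.

Lemma ev0 W p s n : ev p s n (fun _ => 0 : W) = 0.
Proof.
by apply: big1 => js _; rewrite (lin_0 (@pure_linr k A W _)) scaler0.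
Qed.

Lemma evZ W p s n c (Psi : seq Ix -> W) :
  ev p s n (fun js => c *: Psi js) = c *: ev p s n Psi.
Proof.
rewrite -[RHS]addr0 -(ev0 W p s n) -ev_lin.
by apply: eq_ev => js; rewrite addr0.
Qed.

Lemma evD W p s n (Psi Psi' : seq Ix -> W) :
  ev p s n (fun js => Psi js + Psi' js) = ev p s n Psi + ev p s n Psi'.
Proof.
rewrite -[ev p s n Psi]scale1r -ev_lin.
by apply: eq_ev => js; rewrite scale1r.
Qed.

Lemma ev_sum W p s n (R : Type) (r : seq R) (Psi : R -> seq Ix -> W) :
  ev p s n (fun js => \sum_(i <- r) Psi i js) = \sum_(i <- r) ev p s n (Psi i).
Proof.
elim: r => [|i r IH].
  by rewrite big_nil -[RHS](ev0 W p s n); apply: eq_ev => js; rewrite big_nil.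
by rewrite big_cons -IH -evD; apply: eq_ev => js; rewrite big_cons.
Qed.

Lemma ev_lins W p s1 s2 n (Psi : seq Ix -> W) :
  linear (fun a => ev p (s1 ++ a :: s2) n Psi).
Proof.
move=> c a b; rewrite scaler_sumr -big_split; apply: eq_bigr => js _ /=.
rewrite -!catA !cat_cons (mlinE (@prodA_mlin k A)) pure_linl.
by rewrite scalerDr !scalerA [c * _]mulrC.
Qed.

Lemma ev_nil W p s n (Psi : seq Ix -> W) : (nc_nil A < size s + n)%N ->
  ev p s n Psi = 0.
Proof.
move=> hn; rewrite /ev big_seq big1 // => js /size_words hs.
rewrite prodA_nil ?(lin_0 (@pure_linl k A W _)) ?scaler0 //.
by rewrite size_cat size_map hs.
Qed.

Lemma ev_word0 W p s (Psi : seq Ix -> W) : ev p s 0 Psi = pure (prodA s) (Psi [::]).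
Proof.
rewrite /ev big_seq1 cats0 /esign andbF mul1r scale1r; congr (pure _ _).
Qed.

Lemma ev_cons W p s n (Psi : seq Ix -> W) :
  ev p s n.+1 Psi = \sum_(j <- enum Ix) sgn (p && par j) *:
    ev (p (+) par j) (s ++ [:: e j]) n (fun js => Psi (j :: js)).
Proof.
rewrite /ev big_words_cons; apply: eq_bigr => j _; rewrite scaler_sumr.
apply: eq_bigr => js _; rewrite scalerA [map par _]/= esign_cons.
by rewrite -catA.
Qed.

(** Elements of A are exchanged at the cost of a sign. *)
Lemma ev_move W p s q (a : A) js n (Psi : seq Ix -> W) : nc_hom q a ->
  ev p (s ++ a :: map e js) n Psi =
  sgn (q && lp js) *: ev p (s ++ map e js ++ [:: a]) n Psi.
Proof.
move=> ha; rewrite scaler_sumr; apply: eq_bigr => ks _.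
rewrite -!catA !cat_cons (prodA_move _ _ _ ha) cat0s.
rewrite (lin_scale (@pure_linl k A W _)) !scalerA.
by rewrite mulrC.
Qed.

Lemma ev_subst W p s1 t s2 n (Psi : seq Ix -> W) : t != [::] ->
  ev p (s1 ++ prodA t :: s2) n Psi = ev p (s1 ++ t ++ s2) n Psi.
Proof.
by move=> ht; apply: eq_bigr => js _; rewrite -catA cat_cons prodA_sub // !catA.
Qed.

(** The term of [ev_spl] with i letters in the first part and m in the second. *)
Definition ev2 W p s i m (psi : seq Ix -> seq Ix -> W) : tensor A W :=
  \sum_(js <- wd i) esign k p (map par js) *:
    ev (p (+) lp js) (s ++ map e js) m (psi js).

Lemma ev2_consl W p s i m (psi : seq Ix -> seq Ix -> W) :
  \sum_(j <- enum Ix) sgn (p && par j) *: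
     ev2 (p (+) par j) (s ++ [:: e j]) i m (fun I J => psi (j :: I) J) =
  ev2 p s i.+1 m psi.
Proof.
rewrite /ev2 big_words_cons; apply: eq_bigr => j _; rewrite scaler_sumr.
apply: eq_bigr => js _; rewrite scalerA [map par (_ :: _)]/= esign_cons.
by rewrite -catA lp_cons addbA.
Qed.

Lemma ev2_consr W p s i m (psi : seq Ix -> seq Ix -> W) :
  \sum_(j <- enum Ix) sgn (p && par j) *:
     ev2 (p (+) par j) (s ++ [:: e j]) i m
       (fun I J => sgn (par j && lp I) *: psi I (j :: J)) =
  ev2 p s i m.+1 psi.
Proof.
rewrite /ev2; transitivity (\sum_(js <- wd i) \sum_(j <- enum Ix)
   (esign k p (map par js) * sgn ((p (+) lp js) && par j)) *:
   ev (p (+) lp js (+) par j) (s ++ map e js ++ [:: e j]) m (fun ks => psi js (j :: ks))).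
  rewrite exchange_big; apply: eq_bigr => j _; rewrite scaler_sumr.
  apply: eq_bigr => js _; rewrite -catA (ev_move _ _ _ _ _ (@e_hom k A j)) evZ.
  rewrite !scalerA addbAC; congr (_ *: _).
  have := @esign_perm k p (par j :: map par js) (map par js ++ [:: par j]).
  rewrite esign_cons esign_cat esign_cons => -> //; last by rewrite perm_sym cats1 perm_rcons.
  rewrite {2}/esign andbF !mul1r mulr1 -!mulrA -signr_addb addbb mulr1.
  by rewrite mulrA.
apply: eq_bigr => js _; rewrite ev_cons scaler_sumr; apply: eq_bigr => j _.
by rewrite scalerA catA.
Qed.

(** The sign of an unshuffle is compensated by that of the product of the e_j, so
that all unshuffles with the same sizes contribute equally.  The recursion is
Pascal's rule. *)
Lemma ev_spl W p s n (psi : seq Ix -> seq Ix -> W) :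
  ev p s n (fun js => spl js psi) =
  \sum_(i < n.+1) 'C(n, i)%:R *: ev2 p s i (n - i) psi.
Proof.
elim: n p s psi => [|n IH] p s psi.
  by rewrite big_ord1 /ev2 big_seq1 /= addbF cats0 /esign /= andbF mul1r !scale1r !ev_word0.
rewrite ev_cons.
transitivity (\sum_(i < n.+1) 'C(n, i)%:R *: ev2 p s i.+1 (n - i) psi +
              \sum_(i < n.+1) 'C(n, i)%:R *: ev2 p s i (n - i).+1 psi).
  rewrite -big_split /=.
  transitivity (\sum_(j <- enum Ix) \sum_(i < n.+1) sgn (p && par j) *:
    ('C(n, i)%:R *: ev2 (p (+) par j) (s ++ [:: e j]) i (n - i) (fun I J => psi (j :: I) J) +
     'C(n, i)%:R *: ev2 (p (+) par j) (s ++ [:: e j]) i (n - i)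
        (fun I J => sgn (par j && lp I) *: psi I (j :: J)))).
    apply: eq_bigr => j _; rewrite evD !IH -big_split scaler_sumr.
    by apply: eq_bigr.
  rewrite exchange_big; apply: eq_bigr => i _ /=.
  rewrite -ev2_consl -ev2_consr !scaler_sumr -big_split; apply: eq_bigr => j _ /=.
  by rewrite scalerDr !scalerA ![sgn _ * _]mulrC.
pose E i := ev2 p s i (n.+1 - i) psi.
have E1 : \sum_(i < n.+1) 'C(n, i)%:R *: ev2 p s i (n - i).+1 psi =
    \sum_(i < n.+2) 'C(n, i)%:R *: E i.
  rewrite [RHS]big_ord_recr /= bin_small // scale0r addr0.
  by apply: eq_bigr => i _; rewrite /E subSn // -ltnS.
rewrite E1 [X in _ + X]big_ord_recl [RHS]big_ord_recl addrCA /= !bin0; congr (_ + _).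
rewrite -big_split; apply: eq_bigr => i _ /=.
by rewrite /bump /= add1n binS natrD scalerDl addrC.
Qed.

(** A term Theta_q(a, v) is multilinear in the factor a (x) v of parity q of a
tensor; a sum of such factors may be expanded in the basis of A. *)
Lemma tensor_subst W (X : lmodType k) (Theta : bool -> A -> X -> W)
    (R : Type) (r : seq R) (q : R -> bool) (a : R -> A) (v : R -> X) :
  (forall b x, linear (fun a => Theta b a x)) -> (forall b a, linear (Theta b a)) ->
  (forall j, nc_hom (q j) (a j)) ->
  \sum_(j <- r) Theta (q j) (a j) (v j) =
  \sum_(l <- enum Ix) Theta (par l) (e l) (\sum_(j <- r) cf l (a j) *: v j).
Proof.
move=> H1 H2 ha.
transitivity (\sum_(j <- r) \sum_(l <- enum Ix) cf l (a j) *: Theta (par l) (e l) (v j)).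
  apply: eq_bigr => j _; rewrite {1}[a j]coordE big_enum /=.
  transitivity (\sum_i cf i (a j) *: Theta (q j) (e i) (v j)).
    elim/big_rec2: _ => [|i x y _ <-]; first by rewrite (lin_0 (H1 _ _)).
    by rewrite H1.
  apply: eq_bigr => i _; case: (eqVneq (cf i (a j)) 0) => [->|h]; first by rewrite !scale0r.
  by rewrite (ha _ _ h).
rewrite exchange_big; apply: eq_bigr => l _.
elim: r => [|j r IH]; first by rewrite !big_nil (lin_0 (H2 _ _)).
by rewrite !big_cons H2 IH.
Qed.

End Evaluation.

(** * Exponentials in a tensor product *)

Section Composition.
Variables (k : fieldType) (A : nilcdga k).
Hypothesis char0 : [pchar k] =i pred0.
Local Notation Ix := 'I_(nc_dim A).
Local Notation par := (@nc_par k A).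
Local Notation lp := (lp par).
Local Notation spl := (spl par).
Local Notation blks := (blks par).
Local Notation e := (@nc_e k A).
Local Notation cf := (coord (nc_basis A)).
Local Notation wd := (words (enum Ix)).
Local Notation N := (nc_nil A).+1.
Implicit Types (s t : seq A) (js ks : seq Ix) (p q : bool) (W X : lmodType k).
Local Notation fi n := ((n`!%:R)^-1 : k).

Lemma fact_neq0 n : n`!%:R != 0 :> k.
Proof. by move/pcharf0P: char0 => ->; rewrite -lt0n fact_gt0. Qed.

Lemma fi_bin n i : (i <= n)%N -> fi n * 'C(n, i)%:R = fi i * fi (n - i).
Proof.
move=> hi; rewrite -(bin_fact hi) !natrM !invfM mulrAC mulVf ?mul1r //.
have := fact_neq0 n; rewrite -(bin_fact hi) !natrM mulf_eq0 negb_or.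
by case/andP.
Qed.

Lemma triangle W (f : nat -> nat -> W) n :
  \sum_(0 <= j < n) \sum_(i < j.+1) f i (j - i)%N =
  \sum_(0 <= i < n) \sum_(0 <= m < n - i) f i m.
Proof.
elim: n => [|n IH]; first by rewrite !big_geq.
rewrite big_nat_recr //= IH [RHS]big_nat_recr //= subSnn big_nat1.
rewrite big_ord_recr /= subnn addrA; congr (_ + _).
rewrite -(big_mkord xpredT (fun i => f i (n - i)%N)) -big_split /=.
apply: eq_big_nat => i /andP[_ hi].
by rewrite subSn ?(ltnW hi) // big_nat_recr.
Qed.

(** The exponential of a sum over unshuffles is a product of exponentials:
n! is the product of i! and (n - i)! with the binomial coefficient. *)
Lemma ev_spl_exp W p s (psi : seq Ix -> seq Ix -> W) :
  \sum_(0 <= n < N) fi n *: ev p s n (fun js => spl js psi) =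
  \sum_(0 <= i < N) fi i *: \sum_(0 <= m < N) fi m *: ev2 p s i m psi.
Proof.
transitivity (\sum_(0 <= n < N) \sum_(i < n.+1)
    (fi i * fi (n - i)) *: ev2 p s i (n - i) psi).
  apply: eq_bigr => n _; rewrite ev_spl scaler_sumr; apply: eq_bigr => i _.
  by rewrite scalerA fi_bin // -ltnS.
rewrite (triangle (fun i m => (fi i * fi m) *: ev2 p s i m psi)).
apply: eq_big_nat => i /andP[_ hi]; rewrite scaler_sumr.
rewrite [RHS](@big_cat_nat _ _ _ (N - i)) ?leq_subr //= -[LHS]addr0.
congr (_ + _); first by apply: eq_bigr => m _; rewrite scalerA.
rewrite big_nat big1 // => m /andP[hm _]; rewrite [ev2 _ _ _ _ _](_ : _ = 0) ?scaler0 //.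
rewrite /ev2 big_seq big1 // => js /size_words hjs; rewrite ev_nil ?scaler0 //.
rewrite size_cat size_map hjs -addnA; apply: leq_trans (leq_addl _ _).
by rewrite -leq_subLR.
Qed.

(** The element sum_n h(x, ..., x) / n! of the tensor product; n is bounded since A
is nilpotent. *)
Definition expo X q (h : seq Ix -> X) : tensor A X :=
  \sum_(0 <= n < N) fi n *: ev q [::] n h.

(** A subsum over words js of h js is collected into one element of the tensor
product, which is then used as a single argument. *)
Lemma ev_absorb W X (kappa : bool -> k) q p s m (K : X -> seq Ix -> W)
    (h : seq Ix -> X) : (forall js, linear (K^~ js)) -> h [::] = 0 ->
  \sum_(0 <= n < N) fi n *: \sum_(js <- wd n)
     (kappa (lp js) * esign k q (map par js)) *:
       ev (p (+) lp js) (s ++ map e js) m (K (h js)) =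
  \sum_(l <- enum Ix) kappa (par l) *:
     ev (p (+) par l) (s ++ [:: e l]) m (K (expo q h l)).
Proof.
move=> HK h0.
pose Theta b (a : A) (v : X) := kappa b *: ev (p (+) b) (s ++ [:: a]) m (K v).
have T1 b x : linear (fun a => Theta b a x).
  by move=> c u v; rewrite /Theta ev_lins scalerDr !scalerA mulrC.
have T2 b a : linear (Theta b a).
  move=> c u v; rewrite /Theta.
  rewrite (@eq_ev _ _ _ _ _ _ _ (fun js => c *: K u js + K v js)) ?ev_lin.
    by rewrite scalerDr !scalerA mulrC.
  by move=> js; apply: HK.
have E n : \sum_(js <- wd n) (kappa (lp js) * esign k q (map par js)) *:
       ev (p (+) lp js) (s ++ map e js) m (K (h js)) =
     \sum_(l <- enum Ix) Theta (par l) (e l) (ev q [::] n h l).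
  transitivity (\sum_(js <- wd n)
      Theta (lp js) (prodA (map e js)) (esign k q (map par js) *: h js)).
    apply: eq_bigr => js _; rewrite (lin_scale (T2 _ _)) /Theta scalerA mulrC.
    case: js => [|j js]; last by rewrite ev_subst //= cats0.
    have K0 : K 0 = fun _ => 0 by apply: funext => js; apply: (lin_0 (HK js)).
    by rewrite h0 K0 !ev0 !scaler0.
  rewrite (tensor_subst _ _ T1 T2 (fun js => @prodA_hom k A js)).
  apply: eq_bigr => l _; congr (Theta _ _ _); rewrite /ev sum_ffunE.
  by apply: eq_bigr => js _; rewrite !ffunE !scalerA mulrC.
rewrite (eq_bigr _ (fun n _ => congr1 _ (E n))).
transitivity (\sum_(l <- enum Ix) \sum_(0 <= n < N)
    fi n *: Theta (par l) (e l) (ev q [::] n h l)).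
  by rewrite exchange_big; apply: eq_bigr => n _; rewrite scaler_sumr.
apply: eq_bigr => l _; rewrite -[RHS]/(Theta (par l) (e l) (expo q h l)) /expo.
rewrite sum_ffunE.
elim: (index_iota 0 N) => [|n r IH]; first by rewrite !big_nil (lin_0 (T2 _ _)).
by rewrite !big_cons IH ffunE T2.
Qed.

Lemma esign_split p b : esign k p b = sgn (p && parsum b) * esign k false b.
Proof. by rewrite /esign mul1r. Qed.

Lemma blks_nil_big W X r js (F : seq Ix -> X) (H : seq X -> W) : mlin H ->
  F [::] = 0 -> (size js < r)%N ->
  blks r js (fun B => H (map F B)) = 0.
Proof.
move=> HH F0; elim: r js H HH => [|r IH] js H HH //= hr.
rewrite -[RHS](spl0 par W js); apply: (@eq_spl_in _ _ _ predT).
  exact: all_predT.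
case=> [|a I] J _ _ /= hs _.
  by rewrite -[RHS](blks0 par W r J); apply: eq_blks => B; rewrite F0 (mlin0 [::]).
apply: (IH J (fun u => H (F (a :: I) :: u))).
  by move=> s1 s2 c u v _; rewrite -!cat_cons (mlinE HH).
by rewrite -ltnS; apply: leq_ltn_trans hr; rewrite -hs addSn ltnS leq_addl.
Qed.

(** The blocks of an ordered partition are collected one after the other. *)
Lemma ev_blks W X p s r (F : seq Ix -> X) (H : seq X -> W) : mlin H ->
  F [::] = 0 ->
  \sum_(0 <= n < N) fi n *: ev p s n (fun js => blks r js (fun B => H (map F B))) =
  ev p s r (fun ls => H (map (expo false F) ls)).
Proof.
move=> HH F0; elim: r p s H HH => [|r IH] p s H HH.
  rewrite big_nat_recl //= invr1 scale1r [X in _ + X]big1 ?addr0.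
    by rewrite !ev_word0.
  move=> n _; rewrite (@eq_ev_size _ _ _ _ _ _ _ (fun _ => 0)) ?ev0 ?scaler0 //.
  by case.
rewrite /= ev_spl_exp ev_cons.
have HK : forall js, linear (fun v : X => H (v :: map (expo false F) js)).
  by move=> js c u v; apply: (mlinE HH [::]).
rewrite -(@ev_absorb _ _ (fun b => sgn (p && b)) false p s r
   (fun v ls => H (v :: map (expo false F) ls)) F HK F0).
apply: eq_bigr => i _; congr (_ *: _).
transitivity (\sum_(js <- wd i) esign k p (map par js) *:
    \sum_(0 <= m < N) fi m *: ev (p (+) lp js) (s ++ map e js) m
       (fun ks => blks r ks (fun B => H (F js :: map F B)))).
  rewrite /ev2 (eq_bigr _ (fun m _ => scaler_sumr _ _ _ _)) exchange_big.
  apply: eq_bigr => js _; rewrite scaler_sumr; apply: eq_bigr => m _.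
  by rewrite !scalerA mulrC.
apply: eq_bigr => js _; rewrite (IH _ _ (fun u => H (F js :: u))).
  by rewrite [in LHS]esign_split.
by move=> s1 s2 c u v _; rewrite -!cat_cons (mlinE HH).
Qed.

End Composition.

(** * Composition, insertion and base change *)

Section Functoriality.
Variables (k : fieldType) (A : nilcdga k).
Hypothesis char0 : [pchar k] =i pred0.
Local Notation Ix := 'I_(nc_dim A).
Local Notation par := (@nc_par k A).
Local Notation lp := (lp par).
Local Notation spl := (spl par).
Local Notation blks := (blks par).
Local Notation e := (@nc_e k A).
Local Notation cf := (coord (nc_basis A)).
Local Notation wd := (words (enum Ix)).
Local Notation N := (nc_nil A).+1.
Implicit Types (js ks : seq Ix) (p q : bool) (W X : lmodType k).
Local Notation fi n := ((n`!%:R)^-1 : k).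

Lemma Lcomp_par (W X Y : lmodType k) (G : seq X -> W) (F : seq Y -> X)
    (x : Ix -> Y) js :
  Lcomp G F (map par js) (map x js) =
  \sum_(1 <= r < (size js).+1) fi r *:
    blks r js (fun B => G (map (fun js => F (map x js)) B)).
Proof.
rewrite /Lcomp size_map; apply: eq_bigr => r _; congr (_ *: _).
rewrite -words_blks; apply: eq_bigr => w _; congr (_ *: G _).
by rewrite -map_comp; apply: eq_map => j /=; rewrite blk_map.
Qed.

Lemma insl_par (W : lmodType k) (U : superspace k) (F : seq U -> W)
    (h : seq U -> U) (x : Ix -> U) js :
  insl F h (map par js) (map x js) =
  spl js (fun I J => F (h (map x I) :: map x J)).
Proof.
rewrite -words_spl /insl size_map; apply: eq_bigr => w _.
by rewrite -!blk_map.
Qed.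

Lemma ev_word00 W p (Psi : seq Ix -> W) : ev p [::] 0 Psi = 0.
Proof. by rewrite ev_word0 (lin_0 (@pure_linl k A W _)). Qed.

Lemma expo1 X q (h : seq Ix -> X) :
  expo q h = \sum_(1 <= n < N) fi n *: ev q [::] n h.
Proof. by rewrite /expo big_ltn // ev_word00 scaler0 add0r. Qed.

(** Composition of coalgebra maps induces composition of maps on tensors; the
blocks of a partition are the arguments of G. *)
Lemma expo_comp (W X Y : lmodType k) p (G : seq X -> W) (F : seq Y -> X)
    (x : Ix -> Y) : mlin G -> F [::] = 0 ->
  expo p (fun ls => G (map (expo false (fun js => F (map x js))) ls)) =
  expo p (fun js => Lcomp G F (map par js) (map x js)).
Proof.
move=> HG F0; pose F' js := F (map x js).
transitivity (\sum_(1 <= r < N) fi r *: \sum_(0 <= n < N) fi n *: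
   ev p [::] n (fun js => blks r js (fun B => G (map F' B)))).
  by rewrite expo1; apply: eq_bigr => r _; rewrite ev_blks.
transitivity (\sum_(0 <= n < N) fi n *: \sum_(1 <= r < N) fi r *:
   ev p [::] n (fun js => blks r js (fun B => G (map F' B)))).
  rewrite (eq_bigr _ (fun r _ => scaler_sumr _ _ _ _)) exchange_big.
  apply: eq_bigr => n _; rewrite scaler_sumr; apply: eq_bigr => r _.
  by rewrite !scalerA mulrC.
apply: eq_big_nat => n /andP[_ hn]; congr (_ *: _).
rewrite (eq_bigr _ (fun r _ => esym (evZ _ _ _ _ _))) -ev_sum.
apply: eq_ev_size => js hs; rewrite Lcomp_par hs.
rewrite [LHS](@big_cat_nat _ _ _ n.+1) //= -[RHS]addr0; congr (_ + _).
rewrite big_nat big1 // => r /andP[hr _].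
by rewrite blks_nil_big ?scaler0 // hs.
Qed.

(** The part of the word that is inserted into h is collected into the value of the
exponential of h. *)
Lemma expo_insl (W : lmodType k) (U : superspace k) (F : seq U -> W)
    (h : seq U -> U) (x : Ix -> U) : mlin F -> h [::] = 0 ->
  expo true (fun js => insl F h (map par js) (map x js)) =
  \sum_(0 <= m < N) fi m *: \sum_(l <- enum Ix)
    ev (~~ par l) [:: e l] m (fun ks =>
      F (expo true (fun js => h (map x js)) l :: map x ks)).
Proof.
move=> HF h0.
transitivity (\sum_(0 <= n < N) fi n *: ev true [::] n (fun js =>
    spl js (fun I J => F (h (map x I) :: map x J)))).
  by apply: eq_bigr => n _; congr (_ *: _); apply: eq_ev => js; rewrite insl_par.
rewrite ev_spl_exp //.
rewrite (eq_bigr _ (fun m _ => scaler_sumr _ _ _ _)) exchange_big.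
apply: eq_bigr => m _.
have HK : forall ks, linear (fun v : U => F (v :: map x ks)).
  by move=> ks c u v; apply: (mlinE HF [::]).
have := @ev_absorb k A W U (fun=> 1) true true [::] m
   (fun v ks => F (v :: map x ks)) (fun js => h (map x js)) HK h0.
rewrite [RHS](eq_bigr _ (fun l _ => scale1r _)) => <-; rewrite scaler_sumr.
apply: eq_bigr => i _; rewrite !scalerA mulrC; congr (_ *: _).
by apply: eq_bigr => js _; rewrite mul1r.
Qed.

Lemma tmap_pure (B : nilcdga k) (phi : A -> B) (W : lmodType k) (a : A) (w : W) :
  linear phi -> tmap phi (pure a w) = pure (phi a) w.
Proof.
move=> Hphi; apply/ffunP => l; rewrite !ffunE.
transitivity (\sum_i (cf i a * coord (nc_basis B) l (phi (e i))) *: w).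
  by apply: eq_bigr => i _; rewrite ffunE scalerA mulrC.
rewrite -scaler_suml; congr (_ *: w); rewrite {2}[a]coordE.
elim/big_rec2: _ => [|i u v _ ->]; first by rewrite (lin_0 Hphi) raddf0.
by rewrite Hphi linearP.
Qed.

Lemma tmap_lin (B : nilcdga k) (phi : A -> B) (W : lmodType k) :
  linear (@tmap k A B phi W).
Proof.
move=> c u v; apply/ffunP => l; rewrite !ffunE scaler_sumr -big_split.
apply: eq_bigr => i _; rewrite !ffunE scalerDr !scalerA.
by rewrite mulrC.
Qed.

Lemma tmap_ev (B : nilcdga k) (phi : A -> B) (W : lmodType k) p s n
    (Psi : seq Ix -> W) : linear phi ->
  tmap phi (ev p s n Psi) =
  \sum_(js <- wd n) esign k p (map par js) *:
     pure (phi (prodA (s ++ map e js))) (Psi js).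
Proof.
move=> Hphi; have HT := @tmap_lin B phi W.
rewrite /ev; elim: (wd n) => [|js r IH]; first by rewrite !big_nil (lin_0 HT).
by rewrite !big_cons HT IH tmap_pure.
Qed.

Section Morphism.
Variables (B : nilcdga k) (phi : nilcdga_mor A B).

Lemma mor_prodA s : phi (prodA s) = prodA (map phi s).
Proof.
case: s => [|a s]; first exact: (lin_0 (nm_linear phi)).
by rewrite /=; elim: s a => //= b s IH a; rewrite IH nm_mul.
Qed.

Lemma tmap_ev_mor (W X : lmodType k) p s n (H : seq X -> W) (x : tensor A X) :
  mlin H ->
  \sum_(js <- wd n) esign k p (map par js) *:
     pure (prodA (s ++ map phi (map e js))) (H (map x js)) =
  ev p s n (fun ls => H (map (tmap phi x) ls)).
Proof.
elim: n p s H => [|n IH] p s H HH.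
  by rewrite ev_word0 big_seq1 cats0 /esign /= andbF mul1r scale1r.
pose Theta b (a : B) (v : X) := sgn (p && b) *:
   ev (p (+) b) (s ++ [:: a]) n (fun ls => H (v :: map (tmap phi x) ls)).
have T1 b v : linear (fun a => Theta b a v).
  by move=> c a a'; rewrite /Theta ev_lins scalerDr !scalerA mulrC.
have T2 b a : linear (Theta b a).
  move=> c u v; rewrite /Theta.
  rewrite (@eq_ev _ _ _ _ _ _ _ (fun ls => c *: H (u :: map (tmap phi x) ls) +
     H (v :: map (tmap phi x) ls))) ?ev_lin; first by rewrite scalerDr !scalerA mulrC.
  by move=> ls; apply: (mlinE HH [::]).
transitivity (\sum_(j <- enum Ix) Theta (par j) (phi (e j)) (x j)).
  rewrite big_words_cons; apply: eq_bigr => j _; rewrite /Theta -(IH _ _ (fun u => H (x j :: u))); last first.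
    by move=> s1 s2 c u v _; rewrite -!cat_cons (mlinE HH).
  rewrite scaler_sumr; apply: eq_bigr => js _.
  by rewrite [map par (_ :: _)]/= esign_cons scalerA -catA.
rewrite (tensor_subst _ _ T1 T2 (fun j => @nm_hom k A B phi _ _ (@e_hom k A j))).
rewrite ev_cons; apply: eq_bigr => l _; rewrite /Theta.
by congr (_ *: ev _ _ _ _); apply: funext => ls; rewrite /= !ffunE big_enum.
Qed.

(** Naturality in A: a morphism maps products of basis elements to products of
their images, which are expanded in the other basis. *)
Lemma tmap_expo (W X : lmodType k) p (H : seq X -> W) (x : tensor A X) :
  mlin H ->
  tmap phi (expo p (fun js => H (map x js))) =
  expo p (fun ls => H (map (tmap phi x) ls)).
Proof.
move=> HH; have E n : tmap phi (ev p [::] n (fun js => H (map x js))) =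
    ev p [::] n (fun ls => H (map (tmap phi x) ls)).
  rewrite tmap_ev; last exact: nm_linear.
  rewrite -tmap_ev_mor //.
  by apply: eq_bigr => js _; rewrite mor_prodA.
have HT := @tmap_lin B phi W.
have EA M : (nc_nil A < M)%N -> expo p (fun js => H (map x js)) =
    \sum_(0 <= n < M) fi n *: ev p [::] n (fun js => H (map x js)).
  move=> hM; rewrite [RHS](@big_cat_nat _ _ _ N) //= -[LHS]addr0; congr (_ + _).
  by rewrite big_nat big1 // => n /andP[hn _]; rewrite ev_nil ?scaler0.
have EB M : (nc_nil B < M)%N -> expo p (fun ls => H (map (tmap phi x) ls)) =
    \sum_(0 <= n < M) fi n *: ev p [::] n (fun ls => H (map (tmap phi x) ls)).
  move=> hM; rewrite [RHS](@big_cat_nat _ _ _ (nc_nil B).+1) //= -[LHS]addr0.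
  congr (_ + _); rewrite big_nat big1 // => n /andP[hn _].
  by rewrite ev_nil ?scaler0.
pose M := (maxn (nc_nil A) (nc_nil B)).+1.
rewrite (EA M) ?(EB M) ?ltnS ?leq_maxl ?leq_maxr //.
elim: (index_iota 0 M) => [|n r IH]; first by rewrite !big_nil (lin_0 HT).
by rewrite !big_cons HT IH E.
Qed.

Lemma tmap_hom (U : superspace k) (x : tensor A U) :
  (forall j, hom (par j) (x j)) -> forall l, hom (nc_par l) (tmap phi x l).
Proof.
move=> hx l; rewrite ffunE; elim/big_rec: _ => [|j u _ hu]; first exact: hom0.
apply: homD => //.
case: (eqVneq (coord (nc_basis B) l (phi (e j))) 0) => [->|h].
  by rewrite scale0r hom0.
by rewrite (@nm_hom k A B phi _ _ (@e_hom k A j) _ h); apply: homZ.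
Qed.

End Morphism.
End Functoriality.

(** * The Leibniz rule *)

Section Leibniz.
Variables (k : fieldType) (A : nilcdga k).
Hypothesis char0 : [pchar k] =i pred0.
Local Notation Ix := 'I_(nc_dim A).
Local Notation par := (@nc_par k A).
Local Notation lp := (lp par).
Local Notation front := (front par).
Local Notation e := (@nc_e k A).
Local Notation d := (@nc_dif k A).
Local Notation cf := (coord (nc_basis A)).
Local Notation wd := (words (enum Ix)).
Local Notation N := (nc_nil A).+1.
Implicit Types (js ks : seq Ix) (p q : bool) (W X : lmodType k).
Local Notation fi n := ((n`!%:R)^-1 : k).

Lemma prodA_consM (a b : A) s : prodA (nc_mul a b :: s) = prodA (a :: b :: s).
Proof. by []. Qed.

(** The Leibniz rule, with the differentiated factor moved to the front. *)
Lemma dif_prodA_gen q (a : A) js : nc_hom q a ->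
  d (prodA (a :: map e js)) = prodA (d a :: map e js) +
  front js (fun c J => sgn (q && par c) *: prodA (d (e c) :: a :: map e J)).
Proof.
elim: js q a => [|j js IH] q a ha; first by rewrite /front /= addr0.
have hj := @e_hom k A j.
rewrite [map e _]/= -prodA_consM (IH _ _ (nc_mul_hom ha hj)) (nc_leibniz _ ha).
have HL := @prodA_mlin k A [::] (map e js) (sgn q) (nc_mul a (d (e j))) (nc_mul (d a) (e j)).
rewrite addrC [in RHS]addrC front_cons [X in prodA (X :: _)]addrC HL //= -!addrA addrCA.
congr (_ + (_ + _)).
  apply: eq_spl => -[|c [|c' I]] J //.
  by rewrite scalerA -signr_addb nc_mulA andb_addl addbC.
have := @prodA_swap k A [::] _ _ a (d (e j)) (map e js) ha (nc_dif_odd hj).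
rewrite /= => ->; rewrite scalerA -signr_addb; congr ((-1) ^+ nat_of_bool _ *: _).
by case: (q); case: (par j).
Qed.

Lemma dif_prodA j js :
  d (prodA (map e (j :: js))) =
  front (j :: js) (fun c J => prodA (d (e c) :: map e J)).
Proof.
rewrite [map e _]/= (dif_prodA_gen _ (@e_hom k A j)) front_cons.
by congr (_ + _).
Qed.

(** The signs of moving a letter to the front in a product and in a symmetric
function cancel. *)
Lemma front_dual W (kappa : seq Ix -> k) n (B : Ix -> seq Ix -> A) (S : seq Ix -> W) :
  (forall u c c' v, kappa (u ++ c :: c' :: v) = kappa (u ++ c' :: c :: v)) ->
  (forall u c c' v, S (u ++ c :: c' :: v) = sgn (par c && par c') *: S (u ++ c' :: c :: v)) ->
  \sum_(js <- wd n.+1) kappa js *: pure (front js B) (S js) =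
  n.+1%:R *: \sum_(j <- enum Ix) \sum_(ks <- wd n)
    kappa (j :: ks) *: pure (B j ks) (S (j :: ks)).
Proof.
elim: n kappa B S => [|n IH] kappa B S Hk HS.
  rewrite scale1r big_words_cons; apply: eq_bigr => j _; rewrite !big_seq1.
  by rewrite front_cons /front /= addr0.
have L1 := @pure_linl k A W; have L2 := @pure_linr k A W.
rewrite big_words_cons -natr1 scalerDl scale1r addrC.
transitivity (\sum_(j <- enum Ix) (\sum_(js <- wd n.+1)
     kappa (j :: js) *: pure (B j js) (S (j :: js)) +
   n.+1%:R *: \sum_(c <- enum Ix) \sum_(ks <- wd n)
     kappa (c :: j :: ks) *: pure (B c (j :: ks)) (S (c :: j :: ks)))).
  apply: eq_bigr => j _.
  have := IH (fun js => kappa (j :: js)) (fun c J => sgn (par j && par c) *: B c (j :: J))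
    (fun js => S (j :: js)) (fun u c c' v => Hk (j :: u) c c' v)
    (fun u c c' v => HS (j :: u) c c' v).
  move=> E; rewrite [X in _ = _ + X](_ : _ = \sum_(js <- wd n.+1) kappa (j :: js) *:
     pure (front js (fun c J => sgn (par j && par c) *: B c (j :: J))) (S (j :: js))).
    rewrite -big_split; apply: eq_bigr => js _.
    by rewrite front_cons (lin_add (L1 _)) scalerDr.
  rewrite E; congr (_ *: _); apply: eq_bigr => c _; apply: eq_bigr => ks _.
  rewrite (Hk [::] j c) (HS [::] j c) (lin_scale (L1 _)) (lin_scale (L2 _)) scalerA.
  by rewrite -signr_addb addbb scale1r.
rewrite big_split -scaler_sumr; congr (_ + _ *: _).
rewrite exchange_big; apply: eq_bigr => c _; exact/esym/big_words_cons.
Qed.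

(** Differentiating the n-th power gives n equal terms, and n / n! = 1 / (n - 1)!. *)
Lemma leibniz_ev W (S : seq Ix -> W) :
  (forall u c c' v, S (u ++ c :: c' :: v) = sgn (par c && par c') *: S (u ++ c' :: c :: v)) ->
  tmap d (expo false S) =
  \sum_(0 <= m < N) fi m *: \sum_(j <- enum Ix)
     ev (par j) [:: d (e j)] m (fun ks => S (j :: ks)).
Proof.
move=> HS; have HT := @tmap_lin k A A d W.
transitivity (\sum_(0 <= n < N) fi n *: \sum_(js <- wd n) esign k false (map par js) *:
    pure (d (prodA (map e js))) (S js)).
  rewrite /expo; elim: (index_iota 0 N) => [|n r IH]; first by rewrite !big_nil (lin_0 HT).
  by rewrite !big_cons HT IH tmap_ev //; apply: nc_dif_linear.
rewrite big_nat_recl // [in RHS]big_nat_recr // [X in X + _](_ : _ = 0); last first.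
  by rewrite big_seq1 (lin_0 (@nc_dif_linear k A)) (lin_0 (@pure_linl k A _ _)) !scaler0.
rewrite add0r [RHS]/= [X in _ + _ *: X](_ : _ = 0) ?scaler0 ?addr0; last first.
  by rewrite big1 // => j _; rewrite ev_nil.
apply: eq_bigr => n _.
transitivity (fi n.+1 *: \sum_(js <- wd n.+1) esign k false (map par js) *:
    pure (front js (fun c J => prodA (d (e c) :: map e J))) (S js)).
  congr (_ *: _); apply: eq_big_seq => js /size_words; case: js => // j js _.
  by rewrite dif_prodA.
rewrite (@front_dual _ (fun js => esign k false (map par js))) //; last first.
  move=> u c c' v; apply: esign_perm; rewrite !map_cat perm_cat2l /=.
  by rewrite -cat1s -[_ :: map par v]cat1s perm_catCA.
rewrite scalerA factS natrM invfM -mulrA mulrC -mulrA mulfV ?mulr1; last first.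
  by move/pcharf0P: char0 => ->.
congr (_ *: _); apply: eq_bigr => j _; rewrite /ev; apply: eq_bigr => ks _.
by rewrite [map par _]/= esign_cons mul1r.
Qed.

End Leibniz.

(** * Morphisms and Maurer-Cartan elements *)

Lemma tpow_ev (k : fieldType) (A : nilcdga k) (X W : lmodType k) p
    (F : seq X -> W) n (x : tensor A X) :
  tpow p F n x = ev p [::] n (fun js => F (map x js)).
Proof.
apply/ffunP => l; rewrite !ffunE /ev sum_ffunE; apply: eq_bigr => js _.
by rewrite !ffunE nc_prodE scalerA.
Qed.

Lemma nil_pos (k : fieldType) (A : nilcdga k) (l : 'I_(nc_dim A)) :
  (0 < nc_nil A)%N.
Proof.
rewrite lt0n; apply/eqP => h; have := @nc_nilP k A (nc_e l) [::].
rewrite h => /(_ isT) /= h0; have := e_coord l l; rewrite h0 raddf0 eqxx.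
by move/eqP; rewrite eq_sym oner_eq0.
Qed.

(** With one factor only, the sum over the basis has a single term in each
coordinate. *)
Lemma expo_arity1 (k : fieldType) (A : nilcdga k) (X : lmodType k) q
    (h : seq 'I_(nc_dim A) -> X) l :
  (forall js, size js != 1%N -> h js = 0) ->
  expo q h l = sgn (q && nc_par l) *: h [:: l].
Proof.
move=> h1; rewrite expo1 sum_ffunE big_ltn ?ltnS ?(nil_pos l) //.
rewrite big_nat [X in _ + X]big1 ?addr0; last first.
  move=> n /andP[hn _]; rewrite ffunE.
  rewrite (@eq_ev_size _ _ _ _ _ _ _ (fun _ => 0)) ?ev0 ?ffunE ?scaler0 //.
  by move=> js hs; rewrite h1 // hs; case: n hn {hs} => [|[|n]].
rewrite ffunE invr1 scale1r ev_cons sum_ffunE (bigD1_seq l) ?enum_uniq ?mem_enum //=.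
rewrite big1 ?addr0 => [|j jl]; rewrite ffunE ev_word0 ffunE e_coord ?eqxx ?scale1r //.
by rewrite eq_sym (negbTE jl) scale0r scaler0.
Qed.

Section MaurerCartan.
Variables (k : fieldType) (L : Linfty_data k) (F : seq L -> L).
Hypothesis char0 : [pchar k] =i pred0.
Local Notation U := (Pi L).
Hypothesis Fmlin : @mlin k U L F.
Hypothesis Fsym : @ksym k U L F.
Hypothesis Feven : forall z : seq (bool * U), all (@good k U) z ->
  @hom k U (lp (@fst bool U) z) (F (unzip2 z)).
Hypothesis F0 : F [::] = 0.
Hypothesis tot_mlin : @mlin k U L (@Ltot k L).
Hypothesis tot0 : @Ltot k L [::] = 0.
Hypothesis Fdif : forall z : seq (bool * U), all (@good k U) z ->
  insl F (@Ltot k L) (unzip1 z) (unzip2 z) =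
  Lcomp (@Ltot k L) F (unzip1 z) (unzip2 z).
Hypothesis Finv : forall z : seq (bool * U), all (@good k U) z ->
  Lcomp F F (unzip1 z) (unzip2 z) = Lid (unzip2 z).

Definition even_tensor A (x : tensor A L) : Prop :=
  forall l, @hom k U (nc_par l) (x l).

(** The map on Maurer-Cartan elements that is induced by F. *)
Definition mc_map A (x : tensor A L) : tensor A L :=
  expo false (fun js => F (map x js)).

Lemma MC_indE A (x : family L A) i : MC_ind F x i = mc_map (x i).
Proof.
rewrite /MC_ind /mc_map expo1; apply: eq_bigr => n _.
by rewrite tpow_ev.
Qed.

Lemma even_letters A (x : tensor A L) js : even_tensor x ->
  exists2 z : seq (bool * U), all (@good k U) z &
    unzip1 z = map (@nc_par k A) js /\ unzip2 z = map x js.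
Proof.
move=> hx; exists [seq (nc_par j, x j) | j <- js].
  by rewrite all_map; apply/allP => j _; apply: hx.
by rewrite /unzip1 /unzip2 -!map_comp.
Qed.

Lemma MC_eqnE A (x : tensor A L) :
  MC_eqn x <-> tmap (@nc_dif k A) x + expo true (fun js => @Ltot k L (map x js)) = 0.
Proof.
have E l : (tmap (@nc_dif k A) x + expo true (fun js => @Ltot k L (map x js))) l =
   tmap (@nc_dif k A) x l + sgn (nc_par l) *: (- Ldif (x l)) +
    \sum_(1 <= n < (nc_nil A).+1) (n`!%:R)^-1 *: tpow true (@Lop k L) n x l.
  rewrite ffunE -addrA; congr (_ + _).
  have -> : expo true (fun js => @Ltot k L (map x js)) =
      expo true (fun js => if map x js is [:: y] then - Ldif y else 0) +
      expo true (fun js => @Lop k L (map x js)).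
    rewrite /expo -big_split; apply: eq_bigr => n _ /=.
    by rewrite -scalerDr -evD; congr (_ *: _); apply: eq_ev => js; rewrite addrC.
  rewrite ffunE expo_arity1; last by case=> [|j [|j' js]].
  congr (_ + _); rewrite expo1 sum_ffunE; apply: eq_bigr => n _.
  by rewrite ffunE tpow_ev.
split=> [H|H l]; first by apply/ffunP => l; rewrite E H ffunE.
by rewrite -E H ffunE.
Qed.

Lemma mc_map_even A (x : tensor A L) : even_tensor x -> even_tensor (mc_map x).
Proof.
move=> hx l; rewrite /mc_map /expo sum_ffunE.
elim/big_rec: _ => [|n u _ hu]; first exact: hom0.
apply: homD => //; rewrite ffunE; apply: homZ; rewrite /ev sum_ffunE.
elim/big_rec: _ => [|js v _ hv]; first exact: hom0.
apply: homD => //; rewrite !ffunE; apply: homZ.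
case: (eqVneq (coord (nc_basis A) l (prodA (map (@nc_e k A) js))) 0) => [->|h].
  by rewrite scale0r hom0.
apply: homZ; rewrite (prodA_hom h).
have [z gz [E1 E2]] := even_letters js hx.
by have := Feven gz; rewrite E2 lp_unzip E1.
Qed.

(** The morphism equation is evaluated on copies of x: insertion of the total
structure becomes substitution of the curvature of x, which is zero, and what
remains is the curvature of the image. *)
Lemma mc_map_MC A (x : tensor A L) : even_tensor x -> MC_eqn x -> MC_eqn (mc_map x).
Proof.
move=> hx /MC_eqnE Hx; apply/MC_eqnE; rewrite [in X in _ + X]/mc_map expo_comp //.
pose Y := expo true (fun js => @Ltot k L (map x js)).
transitivity (tmap (@nc_dif k A) (mc_map x) +
    expo true (fun js => insl F (@Ltot k L) (map (@nc_par k A) js) (map x js))).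
  congr (_ + _); apply: eq_bigr => n _; congr (_ *: _); apply: eq_ev => js.
  by have [z gz [<- <-]] := even_letters js hx; rewrite Fdif.
rewrite (@expo_insl k A char0 L L F (@Ltot k L) x) // -/Y.
rewrite /mc_map leibniz_ev //; last first.
  move=> u c c' v; rewrite !map_cat /=; apply: (ksymE Fsym); exact: hx.
rewrite -big_split big1 //= => m _; rewrite -scalerDr.
pose Theta b (a : A) (v : L) := ev (~~ b) [:: a] m (fun ks => F (v :: map x ks)).
have T1 b v : linear (fun a => Theta b a v) by apply: (@ev_lins k A L (~~ b) [::] [::]).
have T2 b a : linear (Theta b a).
  move=> c u v; rewrite /Theta -ev_lin; apply: eq_ev => js.
  exact: (mlinE Fmlin [::]).
have -> : \sum_(j <- enum 'I_(nc_dim A)) ev (nc_par j) [:: nc_dif (nc_e j)] m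
     (fun ks => F (map x (j :: ks))) =
   \sum_(l <- enum 'I_(nc_dim A)) Theta (nc_par l) (nc_e l) (tmap (@nc_dif k A) x l).
  transitivity (\sum_(j <- enum 'I_(nc_dim A))
      Theta (~~ nc_par j) (nc_dif (nc_e j)) (x j)).
    by apply: eq_bigr => j _; rewrite /Theta negbK.
  rewrite (tensor_subst _ _ T1 T2 (fun j => nc_dif_odd (@e_hom k A j))).
  by apply: eq_bigr => l _; congr (Theta _ _ _); rewrite ffunE big_enum.
rewrite -big_split big1 ?scaler0 // => l _ /=.
rewrite -[ev (~~ _) _ _ _]/(Theta (nc_par l) (nc_e l) (Y l)) -(lin_add (T2 _ _)).
have -> : tmap (@nc_dif k A) x l + Y l = 0 by move/ffunP/(_ l): Hx; rewrite !ffunE.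
exact: lin_0 (T2 _ _).
Qed.

(** An involution of coalgebras induces an involution by [expo_comp]. *)
Lemma mc_map_inv A (x : tensor A L) : even_tensor x -> mc_map (mc_map x) = x.
Proof.
move=> hx; apply: (etrans (@expo_comp k A char0 L L L false F F x Fmlin F0)).
transitivity (expo false (fun js => Lid (map x js))).
  apply: eq_bigr => n _; congr (_ *: _); apply: eq_ev => js.
  by have [z gz [<- <-]] := even_letters js hx; rewrite Finv.
apply/ffunP => l; rewrite expo_arity1 ?scale1r //.
by case=> [|j [|j' js]].
Qed.

Hypothesis mem0 : Lmem (0 : L).
Hypothesis memD : forall x y : L, Lmem x -> Lmem y -> Lmem (x + y).
Hypothesis memZ : forall c (x : L), Lmem x -> Lmem (c *: x).
Hypothesis Fmem : forall s, Lmems s -> Lmem (F s).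

Lemma mc_map_mem A (x : tensor A L) : (forall l, Lmem (x l)) ->
  forall l, Lmem (mc_map x l).
Proof.
move=> hx l; rewrite /mc_map /expo sum_ffunE.
elim/big_rec: _ => [|n u _ hu] //.
apply: memD => //; rewrite ffunE; apply: memZ; rewrite /ev sum_ffunE.
elim/big_rec: _ => [|js v _ hv] //.
apply: memD => //; rewrite !ffunE; do 2!apply: memZ.
by apply: Fmem => y /mapP[j _ ->].
Qed.

Variable T : forall A : formal_cdga k, family L A -> family L A.
Hypothesis HT : forall A (x : family L A) i, even_tensor (x i) ->
  T x i = mc_map (x i).

Lemma MC_T A (x : family L A) : MC x -> MC (T x).
Proof.
case=> hc hx; have hev i : even_tensor (x i) by have [] := hx i.
split=> [i j h|i].
  by rewrite !HT // /mc_map tmap_expo // hc.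
have [h1 h2 h3] := hx i; rewrite HT //; split.
- exact: mc_map_mem.
- exact: mc_map_even.
exact: mc_map_MC.
Qed.

(** Bijectivity holds because T is its own inverse. *)
Lemma functor_aut_of_map : functor_aut L T.
Proof.
have ev A (x : family L A) : MC x -> forall i, even_tensor (x i).
  by move=> [_ hx] i; have [] := hx i.
split.
- exact: MC_T.
- move=> A x y hx hy H i; have ex := ev _ _ hx i; have ey := ev _ _ hy i.
  by rewrite -(mc_map_inv ex) -(mc_map_inv ey) -(HT ex) -(HT ey) H.
- move=> A y hy; exists (T y); first exact: MC_T.
  move=> i; have ey := ev _ _ hy i.
  have eT : even_tensor (T y i) by rewrite (HT ey); apply: mc_map_even.
  by rewrite (HT eT) (HT ey) mc_map_inv.
move=> A B phi x hx j; have ex := ev _ _ hx (fm_idx phi j).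
rewrite /MC_fmap HT // HT; last exact: tmap_hom.
by rewrite /mc_map tmap_expo.
Qed.

Lemma induced_by_of_map : induced_by L T F.
Proof. by move=> A x [_ hx] i; rewrite MC_indE HT //; have [] := hx i. Qed.

End MaurerCartan.

(** * Twisting Maurer-Cartan elements *)

Section TwistFunctor.
Variables (k : fieldType) (V : dgspace k) (T : twistable V).
Local Notation G := (tG T).
Local Notation P := (Pi V).
Local Notation D := (dsum G V).
Local Notation U := (Pi D).
Local Notation L := (bool * U)%type.
Local Notation pu := (@fst bool U).
Local Notation pp := (@fst bool P).
Local Notation br := (bracket (@tcomp k V T)).
Local Notation plug := (@tplug k V T).
Local Notation act := (@tact k V T).
Local Notation comp := (@tcomp k V T).
Local Notation dd := (tdd T).

Local Notation tw := (@tw k V T).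
Local Notation vl := (@vl k V T).
Hypothesis char0 : [pchar k] =i pred0.

Lemma expo_pair (A : nilcdga k) (X Y : lmodType k) q
    (f : seq 'I_(nc_dim A) -> X) (g : seq 'I_(nc_dim A) -> Y) l :
  expo q (fun js => (f js, g js) : (X * Y)%type) l = (expo q f l, expo q g l).
Proof.
rewrite /expo !sum_ffunE; elim: (index_iota _ _) => [|n r IH]; first by rewrite !big_nil.
rewrite !big_cons IH !ffunE /ev !sum_ffunE.
suff -> : \sum_(js <- words (enum 'I_(nc_dim A)) n)
   (esign k q (map (@nc_par k A) js) *:
      pure (prodA ([::] ++ map (@nc_e k A) js)) ((f js, g js) : (X * Y)%type)) l =
  (\sum_(js <- words (enum 'I_(nc_dim A)) n)
   (esign k q (map (@nc_par k A) js) *: pure (prodA ([::] ++ map (@nc_e k A) js)) (f js)) l,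
   \sum_(js <- words (enum 'I_(nc_dim A)) n)
   (esign k q (map (@nc_par k A) js) *: pure (prodA ([::] ++ map (@nc_e k A) js)) (g js)) l) by [].
elim: (words _ _) => [|js w IHw]; first by rewrite !big_nil.
by rewrite !big_cons IHw !ffunE.
Qed.

(** A letter moved to the front is one of n equal choices, so n! becomes (n - 1)!. *)
Lemma expo_front (A : nilcdga k) (X : lmodType k)
    (K : 'I_(nc_dim A) -> seq 'I_(nc_dim A) -> X) l :
  expo false (fun js => front (@nc_par k A) js K) l =
  (\sum_(m < nc_nil A) (m`!%:R)^-1 *: \sum_(j <- enum 'I_(nc_dim A))
      ev (nc_par j) [:: nc_e j] m (K j)) l.
Proof.
congr (fun_of_fin _ l); rewrite /expo /front ev_spl_exp //.
rewrite big_nat_recl // [X in _ *: X](_ : _ = 0) ?scaler0 ?add0r; last first.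
  rewrite big1 // => m _; rewrite /ev2 big_seq1 ev0.
  by rewrite !scaler0.
have := nil_pos l; case En : (nc_nil A) => [|n] // _.
rewrite big_nat_recl // [X in _ + X]big1 ?addr0; last first.
  move=> i _; rewrite big1 ?scaler0 // => m _.
  rewrite /ev2 big_seq big1 ?scaler0 // => js /size_words.
  by case: js => [|j [|j' js]] // _; rewrite ev0 scaler0.
rewrite invr1 scale1r big_nat_recr // [LHS]/= [X in _ + X](_ : _ = 0); last first.
  rewrite /ev2 big_words_cons big1 ?scaler0 // => j _.
  by rewrite big_seq1 ev_nil ?scaler0 // size_cat /= En.
rewrite big_mkord [LHS]addr0; apply: eq_bigr => m _; congr (_ *: _).
rewrite /ev2 big_words_cons; apply: eq_bigr => j _; rewrite big_seq1.
by rewrite lp_cons addbF /esign /= mul1r addn0; case: (nc_par j); rewrite scale1r.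
Qed.

(* The components plug0 of the twisted structure agree with those of tw up to
   the number of orderings of the entries. *)
Variables (c : nat -> k) (plug0 : G -> seq V -> G).
Hypothesis plug0_lin : forall s, linear (plug0^~ s).
Hypothesis plug0_ev : forall (A : nilcdga k) (xi : tensor A V) g q (a : A) r,
  (forall l, @hom k P (nc_par l) (xi l)) ->
  ev q [:: a] r (fun ks => plug g (map xi ks)) =
  (r`!%:R * c r) *: ev q [:: a] r (fun ks => plug0 g (map xi ks)).

(** In the first component the letter moved to the front is the structure and the
others are copies of xi; in the second one only arity one survives. *)
Lemma tw_fun_map (A : nilcdga k) (x : tensor A D) :
  (forall l, @hom k U (nc_par l) (x l)) ->
  MC_pair (twist c plug0 (MC_m x) (MC_xi x)) (- MC_xi x) =
  expo false (fun js => tw (map x js)).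
Proof.
move=> hx; pose xi := MC_xi x.
have hxi l : @hom k P (nc_par l) (xi l).
  by rewrite ffunE; have := hx l; rewrite hom_dsum => /andP[].
have E js : tw (map x js) =
    (front (@nc_par k A) js (fun j J => plug (x j).1 (map xi J)),
     if js is [:: j] then - (x j).2 else 0).
  pose z : seq L := [seq (nc_par j, x j) | j <- js].
  have gz : all (@good k U) z by rewrite all_map; apply/allP => j _; apply: hx.
  have -> : map x js = unzip2 z by rewrite /unzip2 -map_comp.
  rewrite tw_good //; congr pair; last by rewrite /z; case: (js) => [|j [|j' js']].
  rewrite /front_op /front (spl_mapl (par := @nc_par k A)) //.
  apply: eq_spl => -[|j [|j' I]] J //=.
  by congr (plug _ _); rewrite /unzip2 -!map_comp; apply: eq_map => j' /=; rewrite ffunE.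
apply/ffunP => l; rewrite ffunE.
rewrite [RHS](_ : _ = expo false (fun js =>
    (front (@nc_par k A) js (fun j J => plug (x j).1 (map xi J)),
     if js is [:: j] then - (x j).2 else 0) : D) l); last first.
  by congr (expo _ _ _); apply: funext => js; rewrite E.
rewrite expo_pair; congr pair; last first.
  by rewrite expo_arity1 ?scale1r ?ffunE // => -[|j [|j' js]].
rewrite expo_front ffunE sum_ffunE scaler_sumr; apply: eq_bigr => r _.
rewrite [RHS]ffunE [in RHS]sum_ffunE big_enum !scaler_sumr; apply: eq_bigr => j _.
rewrite [in RHS]plug0_ev // [in RHS]ffunE [in RHS]scalerA mulrA mulVf ?fact_neq0 // mul1r scalerA mulrC -scalerA.
congr (_ *: _); rewrite scaler_sumr /ev sum_ffunE; apply: eq_bigr => js _.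
rewrite !ffunE (lin_scale (plug0_lin _)) !scalerA nc_prodE [map _ (_ :: _)]/=.
case: (eqVneq (coord (nc_basis A) l (prodA (nc_e j :: map (@nc_e k A) js))) 0) => [->|h].
  by rewrite !(mulr0, mul0r) !scale0r.
have := @prodA_hom k A (j :: js) l h; rewrite lp_cons => ->; congr (_ *: _).
rewrite mulrA mulrAC; congr (_ * _).
rewrite [in LHS]esign_split [in RHS]esign_split mulrA mulrAC; congr (_ * _).
rewrite -!signr_addb; congr ((-1) ^+ nat_of_bool _).
rewrite -/(lp (@nc_par k A) js); by case: (nc_par j); case: (lp _ _).
Qed.

Lemma tilde_functor (S : G -> Prop) : S 0 ->
  (forall x y, S x -> S y -> S (x + y)) -> (forall c x, S x -> S (c *: x)) ->
  (forall p x, S x -> S (pr p x)) ->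
  (forall g (z : seq (bool * P)), all (@good k P) z -> S g -> S (plug g (unzip2 z))) ->
  let LS := tilde S br dd act (@dif k V) in
  let TS := @tw_fun k G V c plug0 in
  functor_aut LS TS /\ induced_by LS TS tw.
Proof.
move=> S0 SD SZ Spr Splug LS TS.
have HT A (x : family LS A) i : even_tensor (x i) -> TS A x i = @mc_map k LS tw (A i) (x i).
  exact: tw_fun_map.
have tot0 : @Ltot k LS [::] = 0 by exact: (tot_nil T).
have inv (z : seq (bool * Pi LS)) : all (@good k (Pi LS)) z ->
    Lcomp (X := LS) tw tw (unzip1 z) (unzip2 z) = Lid (unzip2 z).
  case: z => [|a z] gz; first by rewrite /Lcomp big_nil.
  by rewrite (@Lcomp_expc k U U) (@tw_inv k V T char0 _ gz).
have tdif (z : seq (bool * Pi LS)) : all (@good k (Pi LS)) z ->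
    insl (tw : seq LS -> LS) (@Ltot k LS) (unzip1 z) (unzip2 z) =
    Lcomp (@Ltot k LS) tw (unzip1 z) (unzip2 z).
  have [[_ _ _ _ _ H] _] := @Linfty_aut_tw k V T char0 (fun=> True) I
    (fun _ _ _ _ => I) (fun _ _ _ => I) (fun _ _ _ => I) (fun _ _ _ _ => I).
  by move=> gz; apply: (H _ _ (fun _ _ => I)); apply: good_homs.
split.
  apply: (@functor_aut_of_map k LS tw) => //.
  - exact: tw_mlin.
  - exact: tw_sym.
  - exact: tw_hom.
  - exact: tw_nil.
  - exact: (@tot_mlin k V T).
  - by move=> x y; apply: SD.
  - by move=> a x; apply: SZ.
  exact: (tw_mem (T := T)).
exact: (@induced_by_of_map k LS tw).
Qed.

End TwistFunctor.

(** * Multilinear maps on homogeneous words *)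

Section GoodWords.
Variables (k : fieldType) (P : superspace k).
Implicit Types (z : seq (bool * P)) (W : lmodType k).
Local Notation pp := (@fst bool P).

Lemma prs_good z : all (@good k P) z -> prs (unzip1 z) (unzip2 z) = unzip2 z.
Proof.
by elim: z => [|[p x] z IH] //= /andP[/eqP gx /IH hz]; rewrite /prs /= gx -/(prs _ _) hz.
Qed.

Lemma prs_cat (b1 b2 : seq bool) (s1 s2 : seq P) : size b1 = size s1 ->
  prs (b1 ++ b2) (s1 ++ s2) = prs b1 s1 ++ prs b2 s2.
Proof. by move=> h; rewrite /prs zip_cat // map_cat. Qed.

(** Arguments are decomposed into their homogeneous parts. *)
Lemma ksym_good W (f : seq P -> W) : mlin f ->
  (forall z1 z2 x y, all (@good k P) (z1 ++ x :: y :: z2) ->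
    f (unzip2 (z1 ++ x :: y :: z2)) =
    sgn (x.1 && y.1) *: f (unzip2 (z1 ++ y :: x :: z2))) -> ksym f.
Proof.
move=> Hf HS; pose G b s := if size b == size s then f (prs b s) else 0.
have HG b : mlin (G b).
  move=> s1 s2 a u v _; rewrite /G !size_cat /=; case: eqP => [h|_]; last first.
    by rewrite scaler0 addr0.
  have hb : (size s1 < size b)%N by rewrite h addnS ltnS leq_addr.
  rewrite -(cat_take_drop (size s1) b) (drop_nth false) // !prs_cat ?size_takel ?(ltnW hb) //.
  by rewrite /prs /= pr_linear (mlinE Hf).
have -> : f = kext G.
  apply: mlin_eq => // [|z gz]; first exact: kext_mlin.
  by rewrite kext_good // /G !size_map eqxx prs_good.
apply: kext_lsym => // z1 z2 x y gx gy.
rewrite /G !size_map !size_cat eqxx /=.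
pose c (a : bool * P) := (a.1, pr a.1 a.2).
have E z : prs (unzip1 z) (unzip2 z) = unzip2 (map c z).
  by elim: z => [|[p u] z IH] //=; rewrite /prs /= -/(prs _ _) IH.
have gc z : all (@good k P) (map c z).
  by rewrite all_map; apply/allP => a _; rewrite /= /good /= pr_hom.
have Ec a : good a -> c a = a by case: a => p u /eqP h; rewrite /c /= h.
rewrite !E !map_cat /= !(Ec _ gx) !(Ec _ gy); apply: HS.
by rewrite all_cat /= !gc gx gy.
Qed.

Lemma ev_fun_good (f : seq P -> P) z : mlin f -> all (@good k P) z ->
  ev_fun f (unzip2 z) = pr (lp pp z) (f (unzip2 z)).
Proof. by move=> Hf gz; rewrite /ev_fun (kext_good (ev_fun_mlin0 Hf)). Qed.

Lemma smval_lin (s : seq P) : linear (fun f : smulti P => smval f s).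
Proof. by []. Qed.

Lemma mval_lin (s : seq P) : linear (fun f : multi P => mval f s).
Proof. by []. Qed.

Lemma pr_smulti p (f : smulti_sp P) z : all (@good k P) z ->
  smval (pr p f) (unzip2 z) = pr (p (+) lp pp z) (smval f (unzip2 z)).
Proof.
move=> gz; have [[_ Hf] _] := smultiP f; have E := ev_fun_good Hf gz.
case: p => /=; last exact: E.
rewrite {1}/pr; transitivity (smval f (unzip2 z) - ev_fun f (unzip2 z)); first by [].
by rewrite E; case: (lp _ _); rewrite /pr /= ?subKr.
Qed.

Lemma pr_multi p (f : multi_sp P) z : all (@good k P) z ->
  mval (pr p f) (unzip2 z) = pr (p (+) lp pp z) (mval f (unzip2 z)).
Proof.
move=> gz; have [_ Hf] := multiP f; have E := ev_fun_good Hf gz.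
case: p => /=; last exact: E.
rewrite {1}/pr; transitivity (mval f (unzip2 z) - ev_fun f (unzip2 z)); first by [].
by rewrite E; case: (lp _ _); rewrite /pr /= ?subKr.
Qed.

Lemma smulti_eq (f g : smulti P) :
  (forall z, all (@good k P) z -> z != [::] -> smval f (unzip2 z) = smval g (unzip2 z)) ->
  f = g.
Proof.
move=> H; have [[f0 Hf] _] := smultiP f; have [[g0 Hg] _] := smultiP g.
apply/val_inj/mlin_eq => // z gz; case: z gz => [|a z] gz; last exact: H.
by rewrite /= f0 g0.
Qed.

Lemma multi_eq (f g : multi P) :
  (forall z, all (@good k P) z -> z != [::] -> mval f (unzip2 z) = mval g (unzip2 z)) ->
  f = g.
Proof.
move=> H; have [f0 Hf] := multiP f; have [g0 Hg] := multiP g.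
apply/val_inj/mlin_eq => // z gz; case: z gz => [|a z] gz; last exact: H.
by rewrite /= f0 g0.
Qed.

Lemma hom_smulti p (f : smulti_sp P) z : hom p f -> all (@good k P) z ->
  hom (p (+) lp pp z) (smval f (unzip2 z)).
Proof. by move=> /eqP hf gz; rewrite -hf pr_smulti // pr_hom. Qed.

Lemma hom_multi p (f : multi_sp P) z : hom p f -> all (@good k P) z ->
  hom (p (+) lp pp z) (mval f (unzip2 z)).
Proof. by move=> /eqP hf gz; rewrite -hf pr_multi // pr_hom. Qed.

Lemma smulti_hom p (f : smulti_sp P) :
  (forall z, all (@good k P) z -> z != [::] -> hom (p (+) lp pp z) (smval f (unzip2 z))) ->
  hom p f.
Proof.
move=> H; apply/eqP/smulti_eq => z gz z0; rewrite pr_smulti //.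
by apply/eqP; apply: H.
Qed.

Lemma multi_hom p (f : multi_sp P) :
  (forall z, all (@good k P) z -> z != [::] -> hom (p (+) lp pp z) (mval f (unzip2 z))) ->
  hom p f.
Proof.
move=> H; apply/eqP/multi_eq => z gz z0; rewrite pr_multi //.
by apply/eqP; apply: H.
Qed.

End GoodWords.

(** * Derivations of the symmetric algebra *)

Section Symmetric.
Variables (k : fieldType) (V : dgspace k).
Local Notation P := (Pi V).
Local Notation G := (der_c V).
Local Notation pp := (@fst bool P).
Implicit Types (z : seq (bool * P)) (f g h : G).

Lemma smval_mlin f : mlin (smval f).
Proof. by have [[]] := smultiP f. Qed.

Lemma smval_ksym f : ksym (smval f).
Proof. by have [] := smultiP f. Qed.

Lemma smval_nil f : smval f [::] = 0.
Proof. by have [[]] := smultiP f. Qed.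

Lemma comp_s_good g h z : all (@good k P) z ->
  smval (comp_s g h) (unzip2 z) =
  spl pp z (fun I J => smval g (smval h (unzip2 I) :: unzip2 J)).
Proof.
move=> gz; rewrite /= (kext_good _ gz) ?insl_spl // => b.
by apply: insl_mlin; apply: smval_mlin.
Qed.

Lemma comp_s_linl h : linear (fun g => comp_s g h : G).
Proof.
move=> a g g'; apply: smulti_eq => z gz _; rewrite smval_lin !comp_s_good // -spl_lin.
by apply: eq_spl => I J; rewrite smval_lin.
Qed.

Lemma comp_s_linr g : linear (fun h => comp_s g h : G).
Proof.
move=> a h h'; apply: smulti_eq => z gz _; rewrite smval_lin !comp_s_good // -spl_lin.
by apply: eq_spl => I J; rewrite smval_lin (mlinE (smval_mlin g) [::]).
Qed.

Lemma dif_hom p (v : V) : @hom k P p v -> @hom k P (~~ p) (- dif v).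
Proof.
move=> hv; apply: hom_opp; move: hv; rewrite /hom !Pi_prE.
exact: dif_odd.
Qed.

Lemma dif_c_hom : hom true (dif_c V).
Proof.
apply: smulti_hom => -[|a [|b z]] gz _ //=; rewrite ?hom0 //.
by move: gz => /= /andP[ga _]; rewrite /lp /= addbF; apply: dif_hom.
Qed.

Lemma plug_cE f ws (xs : seq P) : smval (plug_c V f ws) xs =
  if xs is [::] then 0 else smval f (ws ++ xs).
Proof. by []. Qed.

Lemma plug_c_linl ws : linear (fun f => plug_c V f ws).
Proof. by move=> a f g; apply: smulti_eq => -[|x z] gz. Qed.

Lemma plug_c_mlin f : mlin (plug_c V f).
Proof.
move=> s1 s2 a u v _; apply: smulti_eq => -[|x z] gz // _.
rewrite smval_lin !plug_cE -!catA !cat_cons.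
exact: (mlinE (smval_mlin f)).
Qed.

Lemma plug_c_sym f : @ksym k P G (plug_c V f).
Proof.
move=> s1 s2 p q u v hu hv _; apply: smulti_eq => -[|x z] gz // _.
rewrite [RHS](lin_scale (smval_lin _)) !plug_cE -!catA !cat_cons.
exact: (ksymE (smval_ksym f)).
Qed.

Lemma plug_c_nil f : plug_c V f [::] = f.
Proof. by apply: smulti_eq => -[|x z]. Qed.

Lemma unzip2_cat z1 z2 : unzip2 z1 ++ unzip2 z2 = unzip2 (z1 ++ z2).
Proof. by rewrite /unzip2 map_cat. Qed.

Lemma plug_c_hom p g z : hom p g -> all (@good k P) z ->
  hom (p (+) lp pp z) (plug_c V g (unzip2 z)).
Proof.
move=> hg gz; apply: smulti_hom => -[|a y] gy // _.
rewrite plug_cE; have := @hom_smulti k P p g (z ++ a :: y) hg.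
by rewrite all_cat gz gy lp_cat addbA -unzip2_cat; apply.
Qed.

Lemma act_plug_c g z1 z2 : all (@good k P) z1 -> all (@good k P) z2 ->
  z2 != [::] ->
  act_c (plug_c V g (unzip2 z1)) (unzip2 z2) = act_c g (unzip2 (z1 ++ z2)).
Proof. by case: z2 => // a z2 _ _ _; rewrite -unzip2_cat. Qed.

Lemma plug_plug_c g z1 z2 : all (@good k P) z1 -> all (@good k P) z2 ->
  plug_c V (plug_c V g (unzip2 z1)) (unzip2 z2) = plug_c V g (unzip2 (z1 ++ z2)).
Proof.
move=> g1 g2; apply: smulti_eq => -[|a y] gy // _.
rewrite !plug_cE -unzip2_cat -catA; case: (z2) => [|b z2'] //.
Qed.

(** An unshuffle of w ++ x splits w and x separately.  The terms in which h
receives no letter of x are those with the action of h; in the other terms the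
value of h is moved past the letters of w that g receives. *)
Lemma plug_comp_c p q g h z : hom p g -> hom q h -> all (@good k P) z ->
  plug_c V (comp_s g h) (unzip2 z) =
  spl pp z (fun I J => sgn (q && lp pp I) *:
     (comp_s (plug_c V g (unzip2 I)) (plug_c V h (unzip2 J)) : G)) +
  spl pp z (fun I J => plug_c V g (act_c h (unzip2 I) :: unzip2 J)).
Proof.
move=> hg hh gz; apply: smulti_eq => -[|a y0] // gy _; set y := a :: y0 in gy *.
have hyl := smval_lin (unzip2 y).
rewrite [RHS](lin_add hyl) !(spl_map _ _ _ hyl) plug_cE unzip2_cat comp_s_good; last first.
  by rewrite all_cat gz gy.
rewrite spl_cat addrC.
transitivity (spl pp z (fun I J => spl pp y (fun I2 J2 =>
    (if I2 is [::] then smval g (smval h (unzip2 I) :: unzip2 J ++ unzip2 J2) else 0) +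
    (if I2 is [::] then 0 else sgn (lp pp J && lp pp I2) *:
        smval g (smval h (unzip2 I ++ unzip2 I2) :: unzip2 J ++ unzip2 J2))))).
  apply: eq_spl => I J; apply: eq_spl => -[|b I2] J2; rewrite -!unzip2_cat.
    by rewrite cats0 andbF scale1r addr0.
  by rewrite add0r.
rewrite (eq_spl _ _ (fun I J => splD _ _ _ _)) splD; congr (_ + _).
  by apply: eq_spl => I J; rewrite (spl_nill pp y (fun J2 => smval g (smval h (unzip2 I) :: unzip2 J ++ unzip2 J2))).
rewrite [RHS]spl_comm.
apply: (@eq_spl_in _ _ _ (@good k P)) => // I J gI gJ _ _.
rewrite (lin_scale hyl) comp_s_good // scalerA -splZ.
apply: (@eq_spl_in _ _ _ (@good k P)) => // -[|b I2] J2 g1 g2 _ _.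
  rewrite (_ : smval (plug_c V h _) _ = 0) // plug_cE.
  by rewrite (mlin0 _ _ (smval_mlin g)) scaler0.
rewrite [smval (plug_c V h _) _]plug_cE.
rewrite [smval (plug_c V g _) _]plug_cE.
have hI2 : hom (q (+) lp pp (I ++ b :: I2)) (smval h (unzip2 (I ++ b :: I2))).
  by apply: hom_smulti => //; rewrite all_cat gI.
have := @lsym_move k P _ (fun z => smval g (unzip2 z)) [::] J
   (q (+) lp pp (I ++ b :: I2), smval h (unzip2 (I ++ b :: I2))) J2
   (ksym_lsym (smval_ksym g)) gJ hI2.
rewrite /= -!unzip2_cat /= => ->; ssign.
Qed.

Definition twistable_c : twistable V.
refine (@Twistable k V G (fun _ => @comp_s k P) (dif_c V) (@act_c k V) (plug_c V)
  (fun _ => comp_s_linl) (fun _ => comp_s_linr) dif_c_hom (@smval_lin k P)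
  smval_mlin smval_ksym smval_nil (@hom_smulti k P) plug_c_linl plug_c_mlin
  plug_c_sym plug_c_nil plug_c_hom act_plug_c plug_plug_c plug_comp_c _ _).
- by [].
- move=> s s0; apply: smulti_eq => -[|x z] gz // _.
  by rewrite plug_cE; case: s s0 => // w [|w' s] _.
Defined.

End Symmetric.

(** * Symplectic derivations of the symmetric algebra *)

Section Symplectic.
Variables (k : fieldType) (V : dgspace k) (B : scalar_product V).
Local Notation P := (Pi V).
Local Notation pp := (@fst bool P).
Implicit Types (z : seq (bool * P)).
Local Notation om := (omega B : V -> V -> k^o).

Lemma omega_linl y : linear (om^~ y).
Proof.
move=> a u v; rewrite /omega !pr_linear !sp_linl.
by rewrite scalerBr opprD addrACA.
Qed.

Lemma omega_linr x : linear (om x).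
Proof.
move=> a u v; rewrite /omega !sp_linr.
by rewrite scalerBr opprD addrACA.
Qed.

Lemma sp0l y : sp B 0 y = 0.
Proof. by have := sp_linl B y (-1) 0 0; rewrite scaler0 addr0 mulN1r addNr. Qed.

(** The scalar product has a parity, so omega(-, y) sees only one homogeneous
component. *)
Lemma omega_pr t q (u y : V) : @hom k P q y ->
  om (@pr k P t u) y = if t (+) q == sp_par B then om u y else 0.
Proof.
rewrite /hom !Pi_prE => hy; have {}hy : hom (~~ q) y by [].
have Z p (v : V) : p (+) ~~ q != sp_par B -> sp B (pr p v) y = 0.
  by move=> h; apply: (sp_hom (pr_hom p v) hy h).
have Ez : sp B (0 : V) y = 0 := sp0l y.
have par_q (r : bool) : (r (+) ~~ q == sp_par B) = (~~ r (+) q == sp_par B).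
  by case: r; case: (q).
rewrite /omega; case: t.
  have -> : pr false (pr (~~ true) u) = pr false u by rewrite pr_pr.
  have -> : pr true (pr (~~ true) u) = 0 by rewrite pr_pr.
  rewrite Ez subr0; case: ifP => h; last by apply: Z; rewrite par_q h.
  rewrite [X in _ - X]Z ?subr0 // par_q.
  by move: h; case: (q); case: (sp_par B).
have -> : pr false (pr (~~ false) u) = 0 by rewrite pr_pr.
have -> : pr true (pr (~~ false) u) = pr true u by rewrite pr_pr.
rewrite Ez; case: ifP => h; last by rewrite Z ?oppr0 ?addr0 // par_q h.
rewrite [X in _ = X - _]Z // par_q.
by move: h; case: (q); case: (sp_par B).
Qed.

Lemma omega_fun_rcons (f : seq V -> V) (s : seq V) y :
  omega_fun B f (rcons s y) = om (f s) y.
Proof.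
case: s => [|x s] //=; congr (om (f _) _); last by rewrite last_rcons.
by rewrite belast_rcons.
Qed.

Lemma omega_fun_mlin (f : seq P -> P) : mlin f -> f [::] = 0 ->
  @mlin k P k^o (omega_fun B f).
Proof.
move=> Hf f0 s1 s2 a u v _; case/lastP: s2 => [|s2 y].
  rewrite !cats1 !omega_fun_rcons.
  exact: omega_linr.
rewrite -!rcons_cons -!rcons_cat !omega_fun_rcons (mlinE Hf).
exact: omega_linl.
Qed.

Lemma omega_fun_pr (f f' : seq P -> P) p z : all (@good k P) z ->
  (forall z, all (@good k P) z -> f' (unzip2 z) = pr (p (+) lp pp z) (f (unzip2 z))) ->
  f [::] = 0 ->
  omega_fun B f' (unzip2 z) =
  if p (+) lp pp z == sp_par B then omega_fun B f (unzip2 z) else 0.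
Proof.
move=> gz H f0; case/lastP: z gz => [|z [q y]]; first by rewrite /=; case: ifP.
rewrite all_rcons => /andP[gy gz].
have -> : unzip2 (rcons z (q, y)) = rcons (unzip2 z) y by rewrite /unzip2 map_rcons.
rewrite !omega_fun_rcons H // (omega_pr _ _ gy) -cats1 lp_cat /lp /= addbF -/(lp pp z).
by rewrite addbA.
Qed.

Lemma symplectic_c_pr p g : symplectic_c B g -> symplectic_c B (pr p g).
Proof.
move=> Hg; have Hm (h : der_c V) := omega_fun_mlin (smval_mlin h) (smval_nil h).
apply: ksym_good; first exact: Hm.
move=> z1 z2 x y gz.
have gz' : all (@good k P) (z1 ++ y :: x :: z2).
  by move: gz; rewrite !all_cat /= => /and4P[-> -> -> ->].
have E z : all (@good k P) z -> omega_fun B (smval (pr p g)) (unzip2 z) =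
    if p (+) lp pp z == sp_par B then omega_fun B (smval g) (unzip2 z) else 0.
  move=> gz0; apply: omega_fun_pr => //; last exact: smval_nil.
  by move=> z0 h0; apply: pr_smulti.
rewrite !E //.
have -> : lp pp (z1 ++ x :: y :: z2) = lp pp (z1 ++ y :: x :: z2).
  by rewrite !lp_cat !lp_cons (addbCA x.1).
case: ifP => _; last by rewrite scaler0.
have /andP[gx gy] : good x && good y.
  by move: gz; rewrite all_cat /= => /and4P[_ -> ->].
rewrite /unzip2 !map_cat /=.
exact: (ksymE Hg).
Qed.

(** Plugging in at the front does not affect the transposition of later
arguments. *)
Lemma symplectic_c_plug g ws : symplectic_c B g -> symplectic_c B (plug_c V g ws).
Proof.
move=> Hg s1 s2 p q u v hu hv _.
have E s x y : omega_fun B (smval (plug_c V g ws)) (s ++ [:: x, y & s2]) =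
     omega_fun B (smval g) ((ws ++ s) ++ [:: x, y & s2]).
  case/lastP: s2 => [|t c].
    rewrite -!cat_rcons !cats0 !omega_fun_rcons plug_cE -rcons_cat.
    by case: (rcons s x) (mem_rcons s x) => [/(_ x)|//]; rewrite inE eqxx.
  rewrite -!rcons_cons -!rcons_cat !omega_fun_rcons plug_cE catA.
  by case: s.
by rewrite !E (ksymE Hg _ _ hu hv).
Qed.

Lemma symplectic_c0 : symplectic_c B 0.
Proof.
have E s : omega_fun B (smval (0 : der_c V)) s = 0.
  by case/lastP: s => // s y; rewrite omega_fun_rcons; exact: (lin_0 (omega_linl y)).
by move=> s1 s2 p q u v _ _ _; rewrite !E scaler0.
Qed.

Lemma symplectic_cP a g h : symplectic_c B g -> symplectic_c B h ->
  symplectic_c B (a *: g + h).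
Proof.
move=> Hg Hh s1 s2 p q u v hu hv _.
have E s : omega_fun B (smval (a *: g + h)) s =
    a *: (omega_fun B (smval g) s : k^o) + omega_fun B (smval h) s.
  case/lastP: s => [|s y]; first by rewrite /= scaler0 addr0.
  by rewrite !omega_fun_rcons; exact: (omega_linl y).
rewrite !E (ksymE Hg _ _ hu hv) (ksymE Hh _ _ hu hv) scalerDr !scalerA.
by rewrite mulrC.
Qed.

End Symplectic.

Section SymmetricMain.
Variables (k : fieldType) (V : dgspace k).
Hypothesis char0 : [pchar k] =i pred0.
Local Notation T := (twistable_c V).

Lemma tw_components_of (S : twistable V) :
  tw_components (@tplug k V S) (@tw k V S).
Proof.
split.
- exact: tw_iF.
- by move=> w; exact: (tw_iW S [:: w]).
- move=> ws hs; rewrite (tw_iW S ws).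
  by case: ws hs => [|w [|w' ws]].
move=> f f' s; apply: tw_two.
by rewrite /= /in_G /= !eqxx.
Qed.

Lemma linear_closed2 (W : lmodType k) (S : W -> Prop) : S 0 ->
  (forall a g h, S g -> S h -> S (a *: g + h)) ->
  (forall g h, S g -> S h -> S (g + h)) /\ (forall a g, S g -> S (a *: g)).
Proof.
move=> S0 SP; split=> [g h Sg Sh|a g Sg].
  by rewrite -[g]scale1r; apply: SP.
by rewrite -[a *: g]addr0; apply: SP.
Qed.

(** The normalization 1 / r! is the one of the exponential, so the hypothesis
on plug0 is trivial. *)
Lemma twist_automorphism_c : exists tw : seq (c_tilde V) -> c_tilde V,
     [/\ tw_components (plug_c V) tw,
         [/\ Linfty_aut (c_tilde V) tw,
             functor_aut (c_tilde V) (tw_c V) &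
             induced_by (c_tilde V) (tw_c V) tw] &
         forall B : scalar_product V,
           [/\ Linfty_aut (cs_tilde B) tw,
               functor_aut (cs_tilde B) (tw_c V) &
               induced_by (cs_tilde B) (tw_c V) tw]].
Proof.
exists (@tw k V T).
have H (S : der_c V -> Prop) : S 0 -> (forall a g h, S g -> S h -> S (a *: g + h)) ->
    (forall p g, S g -> S (pr p g)) -> (forall g ws, S g -> S (plug_c V g ws)) ->
    let L := @tilde k (der_c V) V S (@br_c k V) (dif_c V) (@act_c k V) (@dif k V) in
    [/\ Linfty_aut L (@tw k V T), functor_aut L (tw_c V) & induced_by L (tw_c V) (@tw k V T)].
  move=> S0 SP Spr Splug L; have [SD SZ] := linear_closed2 S0 SP.
  have [H1 H2] := @tilde_functor k V T char0 (fun r => (r`!%:R)^-1) (plug_c V)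
    (@plug_c_linl k V) (fun A xi g q a r hxi => ltac:(by rewrite mulfV ?scale1r ?fact_neq0))
    S S0 SD SZ Spr (fun g z _ Sg => Splug g (unzip2 z) Sg).
  split=> //.
  exact: (@Linfty_aut_tw k V T char0 S S0 SD SZ Spr (fun g z _ Sg => Splug g (unzip2 z) Sg)).
split; first exact: (tw_components_of T).
  exact: (H (fun _ => True)).
move=> B; apply: (H (symplectic_c B)).
- exact: symplectic_c0.
- exact: symplectic_cP.
- exact: symplectic_c_pr.
exact: symplectic_c_plug.
Qed.

End SymmetricMain.

(** * Signed shuffles *)

Section Shuffles.
Variables (k : fieldType) (T : Type) (par : T -> bool).
Implicit Types (z u v ws xs : seq T) (W : lmodType k) (a x y : T).
Local Notation lp := (lp par).
Local Notation spl := (spl par).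

(** The shuffles of a letter into a word. *)
Fixpoint ins W a u (phi : seq T -> W) : W :=
  if u is b :: u' then
    phi (a :: u) + sgn (par a && par b) *: ins a u' (fun t => phi (b :: t))
  else phi [:: a].

(** The signed sum over all orders of a word, by successive insertions. *)
Fixpoint sym W z (phi : seq T -> W) : W :=
  if z is a :: z' then sym z' (fun u => ins a u phi) else phi [::].

(** The sum over all cuts of a word; it plays the role of the deconcatenation
coproduct. *)
Fixpoint dec W u (psi : seq T -> seq T -> W) : W :=
  if u is b :: u' then psi [::] u + dec u' (fun t1 t2 => psi (b :: t1) t2)
  else psi [::] [::].

(** The shuffles of all orders of ws with xs.  Here I are the letters of ws that end
up before the first letter x of xs. *)
Fixpoint sh W ws xs (phi : seq T -> W) : W :=
  if xs is x :: xs' then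
    spl ws (fun I J => sgn (par x && lp J) *:
      sym I (fun u => sh J xs' (fun t => phi (u ++ x :: t))))
  else sym ws phi.

(** A sum of values at certain words is a linear operator on functions of words, and
any two of these commute; this is how independent sums are exchanged below. *)
Definition linop (S : Type) W W' (O : (S -> W) -> W') : Prop :=
  forall c f g, O (fun t => c *: f t + g t) = c *: O f + O g.

Section Linop.
Variables (S : Type) (W W' : lmodType k) (O : (S -> W) -> W').
Hypothesis HO : linop O.

Lemma linop_ext f g : (forall t, f t = g t) -> O f = O g.
Proof. by move=> H; congr O; apply: funext. Qed.

Lemma linop0 : O (fun=> 0) = 0.
Proof.
have := HO (-1) (fun=> 0) (fun=> 0); rewrite [in RHS]scaleN1r [in RHS]addNr => H.
by apply: etrans H; apply: linop_ext => t; rewrite scaler0 addr0.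
Qed.

Lemma linopD f g : O (fun t => f t + g t) = O f + O g.
Proof. by rewrite -[O f]scale1r -HO; apply: linop_ext => t; rewrite scale1r. Qed.

Lemma linopZ c f : O (fun t => c *: f t) = c *: O f.
Proof.
by rewrite -[RHS]addr0 -linop0 -HO; apply: linop_ext => t; rewrite addr0.
Qed.

End Linop.

Lemma ins_lin W a u : linop (@ins W a u).
Proof.
elim: u => [|b u IH] c f g //=; rewrite IH !scalerDr !scalerA [c * _]mulrC.
by rewrite addrACA.
Qed.

Lemma sym_lin W z : linop (@sym W z).
Proof.
elim: z => [|a z IH] c f g //=; rewrite -IH; congr (sym _ _); apply: funext => u.
exact: ins_lin.
Qed.

Lemma sh_lin W ws xs : linop (@sh W ws xs).
Proof.
elim: xs ws => [|x xs IH] ws c f g /=; first exact: sym_lin.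
rewrite -spl_lin; apply: eq_spl => I J.
rewrite scalerA mulrC -scalerA -scalerDr -sym_lin; congr (_ *: sym _ _).
by apply: funext => u; rewrite IH.
Qed.

(* Linear operators on functions commute with these sums. *)
Section Commute.
Variables (S : Type) (W W' : lmodType k) (O : (S -> W) -> W').
Hypothesis HO : linop O.

Lemma spl_linop z (psi : S -> seq T -> seq T -> W) :
  O (fun t => spl z (psi t)) = spl z (fun I J => O (fun t => psi t I J)).
Proof.
elim: z psi => //= a z IH psi; rewrite linopD // !IH; congr (_ + _).
by apply: eq_spl => I J; rewrite linopZ.
Qed.

Lemma ins_linop a u (phi : S -> seq T -> W) :
  O (fun t => ins a u (phi t)) = ins a u (fun v => O (fun t => phi t v)).
Proof.
elim: u phi => //= b u IH phi; rewrite linopD // linopZ //.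
by rewrite (IH (fun t v => phi t (b :: v))).
Qed.

Lemma sym_linop z (phi : S -> seq T -> W) :
  O (fun t => sym z (phi t)) = sym z (fun v => O (fun t => phi t v)).
Proof.
elim: z phi => //= a z IH phi; rewrite (IH (fun t u => ins a u (phi t))).
by congr (sym _ _); apply: funext => u; rewrite ins_linop.
Qed.

Lemma dec_linop u (psi : S -> seq T -> seq T -> W) :
  O (fun t => dec u (psi t)) = dec u (fun u1 u2 => O (fun t => psi t u1 u2)).
Proof.
elim: u psi => //= b u IH psi; rewrite linopD //.
by rewrite (IH (fun t t1 t2 => psi t (b :: t1) t2)).
Qed.

Lemma sh_linop ws xs (phi : S -> seq T -> W) :
  O (fun t => sh ws xs (phi t)) = sh ws xs (fun v => O (fun t => phi t v)).
Proof.
elim: xs ws phi => [|x xs IH] ws phi /=; first exact: sym_linop.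
rewrite spl_linop; apply: eq_spl => I J; rewrite linopZ // sym_linop.
congr (_ *: sym _ _); apply: funext => u.
exact: (IH J (fun t v => phi t (u ++ x :: v))).
Qed.

End Commute.

Lemma eq_dec W u (psi psi' : seq T -> seq T -> W) :
  (forall u1 u2, u = u1 ++ u2 -> psi u1 u2 = psi' u1 u2) -> dec u psi = dec u psi'.
Proof.
elim: u psi psi' => [|b u IH] psi psi' H /=; first exact: H.
rewrite H //; congr (_ + _); apply: IH => t1 t2 E.
by apply: H; rewrite E.
Qed.

Lemma decD W u (psi psi' : seq T -> seq T -> W) :
  dec u (fun u1 u2 => psi u1 u2 + psi' u1 u2) = dec u psi + dec u psi'.
Proof. by elim: u psi psi' => //= b u IH psi psi'; rewrite IH addrACA. Qed.

Lemma decZ W c u (psi : seq T -> seq T -> W) :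
  dec u (fun u1 u2 => c *: psi u1 u2) = c *: dec u psi.
Proof. by elim: u psi => //= b u IH psi; rewrite IH scalerDr. Qed.

Lemma ins_decE W a u (phi : seq T -> W) :
  ins a u phi = dec u (fun u1 u2 => sgn (par a && lp u1) *: phi (u1 ++ a :: u2)).
Proof.
elim: u phi => [|b u IH] phi /=; first by rewrite andbF scale1r.
rewrite andbF scale1r IH; congr (_ + _).
rewrite -decZ; apply: eq_dec => u1 u2 _.
by rewrite scalerA -signr_addb lp_cons andb_addr.
Qed.

Lemma dec_cat_cons W u x t (psi : seq T -> seq T -> W) :
  dec (u ++ x :: t) psi =
  dec u (fun u1 u2 => psi u1 (u2 ++ x :: t)) +
  dec t (fun t1 t2 => psi (u ++ x :: t1) t2).
Proof. by elim: u psi => //= b u IH psi; rewrite IH addrA. Qed.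

Lemma ins_cat_cons W a u x t (phi : seq T -> W) :
  ins a (u ++ x :: t) phi =
  ins a u (fun v => phi (v ++ x :: t)) +
  sgn (par a && lp (rcons u x)) *: ins a t (fun v => phi (u ++ x :: v)).
Proof.
elim: u phi => [|b u IH] phi /=; first by rewrite /lp /= addbF.
by rewrite IH scalerDr addrA scalerA -signr_addb lp_cons andb_addr.
Qed.

(** An inserted letter lies on one of the two sides of the cut. *)
Lemma ins_dec W a u (psi : seq T -> seq T -> W) :
  ins a u (fun v => dec v psi) =
  dec u (fun u1 u2 => ins a u1 (fun t => psi t u2) +
     sgn (par a && lp u1) *: ins a u2 (fun t => psi u1 t)).
Proof.
elim: u psi => [|b u IH] psi /=; first by rewrite andbF scale1r addrC.
rewrite andbF scale1r (linopD (@ins_lin W a u)) (IH (fun t1 t2 => psi (b :: t1) t2)).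
rewrite !decD scalerDr -!addrA addrC -!addrA; congr (_ + _).
rewrite addrCA [RHS]addrCA; congr (_ + _); rewrite [RHS]addrCA; congr (_ + _).
rewrite addrC scalerDr; congr (_ + (_ + _)); first exact/esym/decZ.
rewrite -decZ; apply: eq_dec => u1 u2 _.
by rewrite scalerA -signr_addb lp_cons andb_addr.
Qed.

Lemma eq_ins_in (g : pred T) W a u (phi phi' : seq T -> W) : g a -> all g u ->
  (forall v, all g v -> lp v = par a (+) lp u -> phi v = phi' v) ->
  ins a u phi = ins a u phi'.
Proof.
move=> ga; elim: u phi phi' => [|b u IH] phi phi' /=.
  by move=> _ H; apply: H; rewrite /= ?ga.
case/andP=> gb gu H; rewrite H /= ?ga ?gb //; congr (_ + _ *: _).
by apply: IH => // v gv hv; apply: H; rewrite /= ?gb // !lp_cons hv addbCA.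
Qed.

Lemma eq_sym_in (g : pred T) W z (phi phi' : seq T -> W) : all g z ->
  (forall v, all g v -> lp v = lp z -> phi v = phi' v) -> sym z phi = sym z phi'.
Proof.
elim: z phi phi' => [|a z IH] phi phi' /=; first by move=> _ H; apply: H.
case/andP=> ga gz H; apply: IH => // u gu hu; apply: (eq_ins_in ga gu) => v gv hv.
by apply: H => //; rewrite hv hu.
Qed.

Lemma eq_sym_lp W z (phi phi' : seq T -> W) :
  (forall v, lp v = lp z -> phi v = phi' v) -> sym z phi = sym z phi'.
Proof.
by move=> H; apply: (@eq_sym_in predT) => [|v _]; [exact: all_predT|exact: H].
Qed.

Lemma eq_sh_in (g : pred T) W ws xs (phi phi' : seq T -> W) :
  all g ws -> all g xs ->
  (forall v, all g v -> lp v = lp ws (+) lp xs -> phi v = phi' v) ->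
  sh ws xs phi = sh ws xs phi'.
Proof.
elim: xs ws phi phi' => [|x xs IH] ws phi phi' gw /=.
  by move=> _ H; apply: (eq_sym_in gw) => v gv hv; apply: H; rewrite ?addbF.
case/andP=> gx gxs H; apply: (eq_spl_in gw) => I J gI gJ _ hl.
congr (_ *: _); apply: (eq_sym_in gI) => u gu hu; apply: IH => // v gv hv.
apply: H; first by rewrite all_cat /= gu gx gv.
rewrite lp_cat !lp_cons hu hv -hl; bcase; reflexivity.
Qed.

(** Cutting an order of z splits z into two parts, each in some order. *)
Lemma sym_dec W z (psi : seq T -> seq T -> W) :
  sym z (fun u => dec u psi) =
  spl z (fun I J => sym I (fun u1 => sym J (psi u1))).
Proof.
elim: z psi => //= a z IH psi.
transitivity (sym z (fun u => dec u (fun u1 u2 => ins a u1 (fun t => psi t u2) +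
     sgn (par a && lp u1) *: ins a u2 (fun t => psi u1 t)))).
  by congr (sym _ _); apply: funext => u; exact: ins_dec.
rewrite IH -splD; apply: eq_spl => I J.
rewrite -(linopZ (@sym_lin W I)) -(linopD (@sym_lin W I)).
apply: eq_sym_lp => u hu; rewrite (linopD (@sym_lin W J)); congr (_ + _).
  by rewrite (sym_linop (@ins_lin W a u)).
by rewrite (linopZ (@sym_lin W J)) hu.
Qed.

Lemma dec_spl W xs z (Phi : seq T -> seq T -> seq T -> seq T -> W) :
  dec xs (fun z1 z2 => spl z (Phi z1 z2)) =
  spl z (fun I J => dec xs (fun z1 z2 => Phi z1 z2 I J)).
Proof.
elim: xs Phi => //= x xs IH Phi.
by rewrite (IH (fun z1 z2 => Phi (x :: z1) z2)) -splD.
Qed.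

(** A cut of a shuffle cuts xs and splits the letters of ws: the bialgebra property
of the shuffle product. *)
Lemma sh_dec W ws xs (psi : seq T -> seq T -> W) :
  sh ws xs (fun v => dec v psi) =
  spl ws (fun I J => dec xs (fun z1 z2 => sgn (lp J && lp z1) *:
    sh I z1 (fun u => sh J z2 (psi u)))).
Proof.
elim: xs ws psi => [|x xs IH] ws psi.
  rewrite [LHS]/= sym_dec; apply: eq_spl => I J /=.
  by rewrite andbF scale1r.
(* The cut lies before or after the first letter x of xs. *)
transitivity (spl ws (fun I M => sgn (par x && lp M) *:
    sym I (fun u => dec u (fun u1 u2 => sh M xs (fun t => psi u1 (u2 ++ x :: t))))) +
  spl ws (fun I M => sgn (par x && lp M) *: sym I (fun u =>
    sh M xs (fun t => dec t (fun t1 t2 => psi (u ++ x :: t1) t2))))).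
  rewrite -splD /=; apply: eq_spl => I M; rewrite -scalerDr -(linopD (@sym_lin W I)).
  congr (_ *: sym _ _); apply: funext => u.
  rewrite -(dec_linop (@sh_lin W M xs)) -(linopD (@sh_lin W M xs)).
  by congr (sh _ _ _); apply: funext => t; rewrite dec_cat_cons.
transitivity (spl ws (fun I J => sgn (lp J && false) *:
     sh I [::] (fun u => sh J (x :: xs) (psi u))) +
   spl ws (fun I J => dec xs (fun z1 z2 => sgn (lp J && lp (x :: z1)) *:
     sh I (x :: z1) (fun u => sh J z2 (psi u))))); last by rewrite -splD.
congr (_ + _).
  transitivity (spl ws (fun N M => spl N (fun I1 I2 => sgn (par x && lp M) *:
     sym I1 (fun u1 => sym I2 (fun u2 => sh M xs (fun t => psi u1 (u2 ++ x :: t))))))).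
    by apply: eq_spl => N M; rewrite sym_dec splZ.
  rewrite -spl_coassoc; apply: eq_spl => I J; rewrite andbF scale1r /=.
  rewrite (spl_linop (@sym_lin W I)); apply: eq_spl => I2 M.
  by rewrite (linopZ (@sym_lin W I)).
transitivity (spl ws (fun N M => spl M (fun M1 J => dec xs (fun z1 z2 =>
    (sgn (par x && lp M1) * sgn (lp J && lp (x :: z1))) *:
    sym N (fun u => sh M1 z1 (fun t1 => sh J z2 (fun t2 => psi (u ++ x :: t1) t2))))))).
  apply: eq_spl => N M.
  transitivity (sgn (par x && lp M) *: sym N (fun u => spl M (fun M1 J =>
      dec xs (fun z1 z2 => sgn (lp J && lp z1) *:
        sh M1 z1 (fun t1 => sh J z2 (fun t2 => psi (u ++ x :: t1) t2)))))).
    congr (_ *: sym _ _); apply: funext => u.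
    exact: (IH M (fun t1 t2 => psi (u ++ x :: t1) t2)).
  rewrite (spl_linop (@sym_lin W N)) -splZ; apply: lp_split => M1 J ->.
  rewrite (dec_linop (@sym_lin W N)) -decZ; apply: eq_dec => z1 z2 _.
  by rewrite (linopZ (@sym_lin W N)) -signr_addb; ssign.
rewrite spl_coassoc; apply: eq_spl => I J; rewrite -dec_spl.
apply: eq_dec => z1 z2 _ /=; rewrite -splZ; apply: eq_spl => N M1.
by rewrite scalerA mulrC.
Qed.

(** The letters of ws are split according to the side of x on which they lie. *)
Lemma sh_mid W ws z1 x z2 (phi : seq T -> W) :
  sh ws (z1 ++ x :: z2) phi =
  spl ws (fun I J => sgn (lp J && lp (rcons z1 x)) *:
    sh I z1 (fun u => sh J z2 (fun t => phi (u ++ x :: t)))).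
Proof.
elim: z1 ws phi => [|y z1 IH] ws phi /=.
  by apply: eq_spl => I J; rewrite /lp /= addbF andbC.
transitivity (spl ws (fun N M => spl M (fun M1 J =>
    (sgn (par y && (lp M1 (+) lp J)) * sgn (lp J && lp (rcons z1 x))) *:
    sym N (fun u => sh M1 z1 (fun v => sh J z2 (fun t => phi (u ++ y :: v ++ x :: t))))))).
  apply: eq_spl => N M; rewrite -(linopZ (@sym_lin W N)).
  transitivity (sym N (fun u => spl M (fun M1 J =>
     (sgn (par y && (lp M1 (+) lp J)) * sgn (lp J && lp (rcons z1 x))) *:
     sh M1 z1 (fun v => sh J z2 (fun t => phi (u ++ y :: v ++ x :: t)))))).
    congr (sym _ _); apply: funext => u; rewrite IH -splZ; apply: lp_split => M1 J ->.
    by rewrite scalerA.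
  rewrite (spl_linop (@sym_lin W N)); apply: eq_spl => M1 J.
  by rewrite (linopZ (@sym_lin W N)).
rewrite spl_coassoc; apply: eq_spl => I J; rewrite -splZ; apply: eq_spl => N M1.
rewrite scalerA -!signr_addb; congr (_ *: sym _ _).
  by congr ((-1) ^+ nat_of_bool _); rewrite lp_cons; bcase.
apply: funext => u; congr (sh _ _ _); apply: funext => v; congr (sh _ _ _).
by apply: funext => t; rewrite -catA.
Qed.

(** A further letter is inserted anywhere in a shuffle of the others. *)
Lemma sh_cons W a ws xs (phi : seq T -> W) :
  sh (a :: ws) xs phi = sh ws xs (fun v => ins a v phi).
Proof.
elim: xs ws phi => [|x xs IH] ws phi //.
rewrite [sh _ _ _]/= -splD; apply: eq_spl => I J.
transitivity (sgn (par x && lp J) *: (sym I (fun u => ins a u (fun u' => sh J xs (fun t => phi (u' ++ x :: t)))) +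
  sgn (par a && (par x (+) lp I)) *: sym I (fun u => sh J xs (fun v => ins a v (fun t => phi (u ++ x :: t)))))).
  rewrite scalerDr; congr (_ + _).
  transitivity ((sgn (par a && lp I) * sgn (par x && lp (a :: J))) *:
      sym I (fun u => sh J xs (fun v => ins a v (fun t => phi (u ++ x :: t))))).
    rewrite -scalerA; congr (_ *: (_ *: sym _ _)); apply: funext => u.
    by rewrite IH.
  by rewrite -signr_addb; ssign.
congr (_ *: _); rewrite -(linopZ (@sym_lin W I)) -(linopD (@sym_lin W I)).
apply: eq_sym_lp => u hu; rewrite (sh_linop (@ins_lin W a u)).
rewrite -(linopZ (@sh_lin W J xs)) -(linopD (@sh_lin W J xs)).
congr (sh _ _ _); apply: funext => t; rewrite ins_cat_cons.
by rewrite -cats1 lp_cat /lp /= addbF -/(lp u) hu addbC.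
Qed.

Lemma sh_nil W z (phi : seq T -> W) : sh [::] z phi = phi z.
Proof.
elim: z phi => //= x z IH phi; rewrite /lp andbF scale1r.
exact: (IH (fun t => phi (x :: t))).
Qed.

(** Iteration of [sh_cons]. *)
Lemma sh_sh W ws1 ws2 xs (phi : seq T -> W) :
  sh ws2 xs (fun z => sh ws1 z phi) = sh (ws1 ++ ws2) xs phi.
Proof.
elim: ws1 phi => [|a ws1 IH] phi.
  by congr (sh _ _ _); apply: funext => z; rewrite sh_nil.
rewrite cat_cons sh_cons -IH; congr (sh _ _ _); apply: funext => z.
by rewrite sh_cons.
Qed.

(** Insertions of two letters commute up to sign; their relative order is summed
over in both cases. *)
Lemma ins_comm W x y v (phi : seq T -> W) :
  ins y v (fun t => ins x t phi) =
  sgn (par x && par y) *: ins x v (fun t => ins y t phi).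
Proof.
elim: v phi => [|b v IH] phi /=.
  rewrite scalerDr scalerA -signr_addb (andbC (par y)) addbb scale1r.
  by rewrite addrC.
rewrite !(linopD (@ins_lin W _ v)) !(linopZ (@ins_lin W _ v)).
rewrite (IH (fun t => phi (b :: t))).
set A := phi _; set B := phi _; set Cx := ins _ _ _; set Cy := ins _ _ _.
set D := ins _ _ _.
transitivity ((A + sgn (par y && par b) *: Cy) + sgn (par x && par y) *:
   (B + sgn (par x && par b) *: (Cx + sgn (par y && par b) *: D))).
  rewrite !scalerDr -!addrA; congr (_ + _).
  rewrite [RHS]addrCA; congr (_ + _); rewrite [LHS]addrCA; congr (_ + _).
  by congr (_ + _); ssign.
rewrite -[in RHS]addrA (addrCA B) [RHS]scalerDr; congr (_ + _).
by rewrite scalerA -signr_addb (andbC (par y) (par x)) addbb scale1r.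
Qed.

Lemma sh_swap W ws1 a b ws2 xs (phi : seq T -> W) :
  sh (ws1 ++ a :: b :: ws2) xs phi =
  sgn (par a && par b) *: sh (ws1 ++ b :: a :: ws2) xs phi.
Proof.
rewrite -!sh_sh !sh_cons -(linopZ (@sh_lin W ws2 xs)).
congr (sh _ _ _); apply: funext => v.
exact: ins_comm.
Qed.

(** A shuffle sum is a linear combination of values at words of letters of ws and
xs. *)
Lemma sh_ind (g : pred T) W (Q : W -> Prop) ws xs (phi : seq T -> W) :
  Q 0 -> (forall c (w w' : W), Q w -> Q w' -> Q (c *: w + w')) -> all g ws -> all g xs ->
  (forall v, all g v -> lp v = lp ws (+) lp xs -> Q (phi v)) -> Q (sh ws xs phi).
Proof.
move=> Q0 QL gw gxs; elim: ws gw phi => [|a ws IH] /=.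
  by move=> _ phi H; rewrite sh_nil; apply: H.
case/andP=> ga gw phi H; rewrite sh_cons; apply: IH => // v gv hv.
have: forall v', all g v' -> lp v' = par a (+) lp v -> Q (phi v').
  by move=> v' gv' hv'; apply: H => //; rewrite hv' hv lp_cons addbA.
elim: v gv phi {H hv} => [|b v IH'] /=; first by move=> _ phi H; apply: H; rewrite //= ga.
case/andP=> gb gv phi H; rewrite addrC; apply: (QL) => //.
  apply: IH' => // v' gv' hv'; apply: H; first by rewrite /= gb.
  by rewrite !lp_cons hv' addbCA.
by apply: H => //=; rewrite ga gb.
Qed.

Lemma eq_ins_cons W a u (phi phi' : seq T -> W) :
  (forall b v, phi (b :: v) = phi' (b :: v)) -> ins a u phi = ins a u phi'.
Proof.
move=> H; case: u => [|b u] /=; rewrite !H //; congr (_ + _ *: ins _ _ _).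
by apply: funext => t.
Qed.

Lemma ins_cons0 W a u (phi : seq T -> W) :
  (forall b v, phi (b :: v) = 0) -> ins a u phi = 0.
Proof. by move=> H; rewrite -(linop0 (@ins_lin W a u)); apply: eq_ins_cons. Qed.

Lemma eq_sh_cons W ws xs (phi phi' : seq T -> W) : ws ++ xs <> [::] ->
  (forall b v, phi (b :: v) = phi' (b :: v)) -> sh ws xs phi = sh ws xs phi'.
Proof.
case: xs => [|x xs] n0 H /=.
  case: ws n0 => //= a ws _; congr (sym _ _); apply: funext => u.
  exact: eq_ins_cons.
apply: eq_spl => I J; congr (_ *: sym _ _); apply: funext => u.
by congr (sh _ _ _); apply: funext => t; case: u => /=.
Qed.

End Shuffles.

(** * Permutations and interleavings as insertions *)

Section Rearrangements.
Variables (k : fieldType) (T : Type) (par : T -> bool).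
Implicit Types (z u v ws xs : seq T) (W : lmodType k) (a x y : T).
Local Notation lp := (lp par).
Local Notation spl := (spl par).
Local Notation sym := (sym par).
Local Notation ins := (ins par).
Local Notation sh := (sh par).

Lemma decE W u (psi : seq T -> seq T -> W) :
  dec u psi = \sum_(x <- iota 0 (size u).+1) psi (take x u) (drop x u).
Proof.
elim: u psi => [|b u IH] psi; first by rewrite big_seq1.
rewrite -[LHS]/(psi [::] (b :: u) + dec u (fun t1 t2 => psi (b :: t1) t2)) IH.
rewrite (_ : iota 0 (size (b :: u)).+1 = 0%N :: map S (iota 0 (size u).+1)).
  by rewrite [RHS]big_cons big_map.
by rewrite -(iotaDl 1 0).
Qed.

(** The sign of a label word depends only on the relative order of the labels. *)
Lemma kodd_mono (f : nat -> nat) w b : {mono f : i j / (i < j)%N} ->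
  kodd (map f w) b = kodd w b.
Proof.
move=> Hf; elim: w b => [|i w IH] [|p b] //=; rewrite IH; congr ((_ && parsum _) (+) _).
elim: w b {IH} => [|j w IH] [|q b] //=.
by rewrite Hf IH.
Qed.

Lemma bump_mono (x : nat) : {mono bump x : i j / (i < j)%N}.
Proof. by move=> i j; rewrite !ltnNge leq_bump2. Qed.

(** A permutation with first label x is a permutation of the remaining labels,
renumbered. *)
Lemma permutations_bump (x n : nat) : (x <= n)%N ->
  perm_eq (permutations (rem x (iota 0 n.+1)))
          [seq map (bump x) w | w <- permutations (iota 0 n)].
Proof.
move=> xn.
have E : perm_eq (rem x (iota 0 n.+1)) (map (bump x) (iota 0 n)).
  apply: uniq_perm; rewrite ?rem_uniq ?iota_uniq //.
    by rewrite map_inj_uniq ?iota_uniq //; exact: can_inj (bumpK x).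
  move=> i; rewrite mem_rem_uniq ?iota_uniq // inE /= -/(iota 0 n.+1) mem_iota.
  apply/andP/mapP => [[ix hi]|[j + ->]].
    exists (unbump x i); last by rewrite unbumpK.
    rewrite mem_iota /unbump /= add0n; move: hi ix; rewrite /= add0n ltnS neq_ltn.
    case: (ltnP x i) => [xi hi _|ix hi]; first by rewrite subn1 prednK // (leq_ltn_trans _ xi).
    by rewrite orbF subn0 => /leq_trans; apply.
  rewrite mem_iota /= !add0n eq_sym neq_bump => jn; split=> //.
  by rewrite /bump; case: (x <= j)%N; rewrite ?add1n ?add0n ltnS // ltnW.
rewrite (perm_trans (perm_permutations E)) //.
apply: uniq_perm.
- exact: permutations_uniq.
- rewrite map_inj_uniq ?permutations_uniq //.
  exact/inj_map/(can_inj (bumpK x)).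
move=> w; rewrite mem_permutations; apply/idP/mapP => [H|[w' + ->]]; last first.
  by rewrite mem_permutations => ?; apply: perm_map.
exists (map (unbump x) w).
  rewrite mem_permutations; have := perm_map (unbump x) H.
  by rewrite -map_comp (eq_map (bumpK x)) map_id.
rewrite -map_comp -[LHS]map_id; apply/eq_in_map => i.
rewrite (perm_mem H) => /mapP[j _ ->] /=.
by rewrite bumpK.
Qed.

Lemma blk_bump (x : nat) w j z : blk (map (bump x) w) (bump x j) z = blk w j z.
Proof.
rewrite /blk -map_comp; congr mask; apply: eq_map => i /=.
by rewrite (inj_eq (can_inj (bumpK x))).
Qed.

Lemma blk_bump0 (x : nat) w z : blk (map (bump x) w) x z = [::].
Proof.
elim: w z => [|i w IH] [|a z] //=.
by rewrite blk_cons IH eq_sym (negbTE (neq_bump x i)).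
Qed.

Lemma perm_singletons z w : w \in permutations (iota 0 (size z)) ->
  exists u, [seq blk w j z | j <- iota 0 (size z)] = [seq [:: y] | y <- u].
Proof.
rewrite mem_permutations => H.
have: all (fun j => size (blk w j z) == 1%N) (iota 0 (size z)).
  apply/allP => j hj; rewrite size_mask; last by rewrite size_map (perm_size H) size_iota.
  by rewrite count_map (permP H) count_uniq_mem ?iota_uniq // hj.
elim: (iota _ _) => [|j s IH] /=; first by exists [::].
case/andP=> + /IH [u ->]; case: (blk w j z) => [|y [|]] // _.
by exists (y :: u).
Qed.

(** The first letter goes to the x-th place of a rearrangement of the others, so the
sum over its label is a sum over insertions. *)
Lemma perm_sym W z (Phi : seq T -> W) :
  \sum_(w <- permutations (iota 0 (size z))) ksign w (map par z) *: Phi (rearr w z)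
  = sym z Phi.
Proof.
elim: z Phi => [|a z IH] Phi; first by rewrite big_seq1 scale1r.
rewrite [RHS]/= -IH.
transitivity (\sum_(x <- iota 0 (size z).+1) \sum_(w <- permutations (iota 0 (size z)))
    ksign (x :: map (bump x) w) (map par (a :: z)) *: Phi (rearr (x :: map (bump x) w) (a :: z))).
  rewrite (perm_big _ (permutationsE _)) // big_allpairs_dep undup_id ?iota_uniq //.
  apply: eq_big_seq => x; rewrite mem_iota ltnS => xn.
  by rewrite (perm_big _ (permutations_bump xn)) big_map.
rewrite exchange_big; apply: eq_big_seq => w hw.
have hs : size w = size z.
  by move: hw; rewrite mem_permutations => /perm_size ->; rewrite size_iota.
have [u Eu] := perm_singletons hw.
rewrite /rearr Eu flatten_seq1 ins_decE decE scaler_sumr.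
have -> : size u = size z by move/(congr1 size): Eu; rewrite !size_map size_iota.
apply: eq_big_seq => x; rewrite mem_iota ltnS => xn.
rewrite scalerA -signr_addb.
have Et : [seq blk w j z | j <- iota 0 x] = [seq [:: y] | y <- take x u].
  by rewrite map_take -Eu -map_take take_iota (minn_idPl xn).
have Ed : [seq blk w j z | j <- iota x (size z - x)] = [seq [:: y] | y <- drop x u].
  by rewrite map_drop -Eu -map_drop drop_iota add0n.
have E0 : [seq blk (map (bump x) w) j z | j <- iota 0 x] = [seq blk w j z | j <- iota 0 x].
  apply/eq_in_map => j; rewrite mem_iota /= => jx.
  by rewrite -(blk_bump x w j z) /bump leqNgt jx.
have E1 : [seq blk (map (bump x) w) j z | j <- iota x.+1 (size z - x)] =
          [seq blk w j z | j <- iota x (size z - x)].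
  rewrite -add1n iotaDl -map_comp; apply/eq_in_map => j; rewrite mem_iota => /andP[xj _] /=.
  by rewrite -(blk_bump x w j z) /bump xj.
have Ec j : blk (x :: map (bump x) w) j (a :: z) =
     if x == j then a :: blk (map (bump x) w) j z else blk (map (bump x) w) j z.
  exact: blk_cons.
rewrite kodd_cons ?size_map // E0 Et flatten_seq1 (kodd_mono _ _ (bump_mono x)).
rewrite addbC; congr (_ *: Phi _).
have -> : iota 0 (size (a :: z)) = iota 0 x ++ x :: iota x.+1 (size z - x).
  have -> : size (a :: z) = (x + (size z - x).+1)%N by rewrite addnS (subnKC xn).
  by rewrite iotaD add0n.
rewrite map_cat flatten_cat map_cons [flatten (_ :: _)]/= Ec eqxx blk_bump0 /= -[RHS](congr1 (fun t => t ++ _) (flatten_seq1 (take x u))) -Et -E0.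
congr (flatten _ ++ _ :: _).
  by apply/eq_in_map => j; rewrite mem_iota Ec /= => /ltn_eqF; rewrite eq_sym => ->.
rewrite -[RHS]flatten_seq1 -Ed -E1; congr flatten.
by apply/eq_in_map => j; rewrite mem_iota Ec => /andP[/ltn_eqF -> _].
Qed.

(** Every argument occurs exactly once in a rearrangement, which makes
[symmetrize] multilinear. *)
Lemma rearr_mid w s1 s2 : size w = (size s1 + size s2).+1 ->
  all (fun i => i < size w)%N w ->
  exists r1 r2 : seq T, forall x, rearr w (s1 ++ x :: s2) = r1 ++ x :: r2.
Proof.
move=> hs hw; have [w1 [i [w2 [Ew hw1]]]] : exists w1 i w2, w = w1 ++ i :: w2 /\ size w1 = size s1.
  exists (take (size s1) w), (nth 0%N w (size s1)), (drop (size s1).+1 w).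
  have h : (size s1 < size w)%N by rewrite hs ltnS leq_addr.
  by rewrite -drop_nth // cat_take_drop size_takel // ltnW.
have hi : (i <= size s1 + size s2)%N.
  have /(allP hw) : i \in w by rewrite Ew mem_cat inE eqxx orbT.
  by rewrite hs ltnS.
pose B j x := blk w j (s1 ++ x :: s2).
have EB j x : B j x = blk w1 j s1 ++ (if i == j then x :: blk w2 j s2 else blk w2 j s2).
  by rewrite /B Ew blk_cat // blk_cons.
exists (flatten [seq blk w1 j s1 ++ blk w2 j s2 | j <- iota 0 i] ++ blk w1 i s1).
exists (blk w2 i s2 ++ flatten [seq blk w1 j s1 ++ blk w2 j s2 | j <- iota i.+1 (size s1 + size s2 - i)]).
move=> x; rewrite /rearr.
have -> : iota 0 (size (s1 ++ x :: s2)) = iota 0 i ++ i :: iota i.+1 (size s1 + size s2 - i).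
  have -> : size (s1 ++ x :: s2) = (i + (size s1 + size s2 - i).+1)%N.
    by rewrite size_cat /= !addnS (subnKC hi).
  by rewrite iotaD add0n.
rewrite map_cat flatten_cat map_cons [flatten (_ :: _)]/= -/(B i x) EB eqxx -!catA; congr (flatten _ ++ _).
  by apply/eq_in_map => j; rewrite mem_iota -/(B j x) EB /= => /ltn_eqF; rewrite eq_sym => ->.
congr (_ ++ _ :: _ ++ flatten _).
by apply/eq_in_map => j; rewrite mem_iota -/(B j x) EB => /andP[/ltn_eqF -> _].
Qed.

(** The interleavings of u with xs, in which both keep their order; the first letter
of xs cuts u. *)
Fixpoint ord W u xs (Phi : seq T -> W) : W :=
  if xs is x :: xs' then
    dec u (fun u1 u2 => sgn (par x && lp u2) *: ord u2 xs' (fun t => Phi (u1 ++ x :: t)))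
  else Phi u.

(** Interleaving with all orders of ws is the same as shuffling ws in. *)
Lemma sym_ord W ws xs (Phi : seq T -> W) :
  sym ws (fun u => ord u xs Phi) = sh ws xs Phi.
Proof.
elim: xs ws Phi => [|x xs IH] ws Phi //=.
rewrite sym_dec; apply: eq_spl => I J.
rewrite -(linopZ (@sym_lin _ _ par W I)); congr (sym _ _); apply: funext => u.
rewrite -IH -(linopZ (@sym_lin _ _ par W J)).
by apply: eq_sym_lp => v ->.
Qed.

Lemma weave0 c u xs : count_mem 0%N c = size u -> size c = (size u + size xs)%N ->
  blk c 0 (weave c u xs) = u /\ size (weave c u xs) = size c.
Proof.
elim: c u xs => [|[|i] c IH] u xs /=.
- by case: u.
- by case: u => // b u [hc] [hs]; case: (IH u xs) => // H1 H2; rewrite blk_cons H1 /= H2.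
move=> hc hs; case: xs hs => [|x xs] /=.
  by rewrite addn0 -hc add0n => hs; have := count_size (pred1 0%N) c; rewrite -hs ltnn.
rewrite addnS => -[hs]; have [//|H1 H2] := IH u xs hc.
by rewrite blk_cons H1 H2.
Qed.

Lemma map_weave (T' : Type) (f : T -> T') c u xs :
  map f (weave c u xs) = weave c (map f u) (map f xs).
Proof. by elim: c u xs => [|[|i] c IH] [|b u] [|x xs] //=; rewrite IH. Qed.

(** Recursion on the first label: 0 takes a letter of u, and 1 takes the first
letter of xs past all of u. *)
Lemma interleave_ord W N u xs (Phi : seq T -> W) : (size u + size xs)%N = N ->
  \sum_(c <- words [:: 0%N; 1%N] N | count_mem 0%N c == size u)
    ksign c (weave c (map par u) (map par xs)) *: Phi (weave c u xs)
  = ord u xs Phi.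
Proof.
elim: N u xs Phi => [|N IH] u xs Phi.
  by case: u => //; case: xs => // _; rewrite big_mkcond big_seq1 scale1r.
move=> hN; rewrite big_mkcond big_words_cons !big_cons big_nil addr0.
have A b u' : u = b :: u' ->
    \sum_(w <- words [:: 0%N; 1%N] N) (if count_mem 0%N (0%N :: w) == size u then
       ksign (0%N :: w) (weave (0%N :: w) (map par u) (map par xs)) *: Phi (weave (0%N :: w) u xs)
       else 0) = ord u' xs (fun t => Phi (b :: t)).
  move=> E; rewrite E in hN *; rewrite -IH; last by case: hN.
  rewrite [RHS]big_mkcond; apply: eq_bigr => w _ /=; rewrite add1n eqSS.
  case: ifP => // _.
  set X := parsum _; have -> : X = false; last by rewrite andbF.
  by rewrite /X; elim: (zip _ _) => [|[? ?] s].
have B x xs' : xs = x :: xs' ->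
    \sum_(w <- words [:: 0%N; 1%N] N) (if count_mem 0%N (1%N :: w) == size u then
       ksign (1%N :: w) (weave (1%N :: w) (map par u) (map par xs)) *: Phi (weave (1%N :: w) u xs)
       else 0) = sgn (par x && lp u) *: ord u xs' (fun t => Phi (x :: t)).
  move=> E; rewrite E in hN *.
  have hN' : (size u + size xs')%N = N by move: hN; rewrite /= addnS => -[].
  rewrite -IH // scaler_sumr [RHS]big_mkcond; apply: eq_big_seq => w /size_words hw.
  rewrite /= add0n; case: ifP => [/eqP hc|_] //.
  rewrite scalerA -signr_addb; congr (sgn ((_ && _) (+) _) *: _).
  have [E0 E1] := weave0 hc (etrans hw (esym hN')).
  by rewrite -map_weave parsum_lt ?E1 // /= cats0 E0.
have B0 : xs = [::] -> forall w, w \in words [:: 0%N; 1%N] N ->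
    (count_mem 0%N (1%N :: w) == size u) = false.
  move=> E w /size_words hw; move: hN; rewrite E addn0 => ->.
  by apply/negbTE; rewrite neq_ltn /= add0n -hw ltnS count_size.
case: u xs A B B0 hN => [|b u] [|x xs] A B B0 hN //.
- rewrite big1 ?add0r; first by rewrite (B x xs) // andbF scale1r.
  by [].
- rewrite (A b u) // big1_seq ?addr0 // => w /andP[_ hw].
  by rewrite (B0 erefl w hw).
rewrite (A b u) // (B x xs) // addrC; congr (_ + _).
Qed.

End Rearrangements.

(** * Derivations of the tensor algebra *)

Section ShuffleMap.
Variables (k : fieldType) (T : Type) (par : T -> bool).

Lemma sh_map (W W' : lmodType k) (L : W -> W') ws xs (phi : seq T -> W) :
  linear L -> L (sh par ws xs phi) = sh par ws xs (fun v => L (phi v)).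
Proof.
move=> HL; pose O (f : unit -> W) := L (f tt).
have HO : linop O by move=> c f g; rewrite /O HL.
exact: (sh_linop par HO ws xs (fun _ => phi)).
Qed.

Lemma dec_split (W : lmodType k) u (psi : seq T -> seq T -> W) :
  dec u psi = psi [::] u + dec u (fun u1 u2 => if u1 is [::] then 0 else psi u1 u2).
Proof. by case: u => [|b u] /=; rewrite ?addr0 // add0r. Qed.

Lemma dec_ord (W : lmodType k) u (psi : seq T -> seq T -> W) :
  dec u psi = \sum_(j < (size u).+1) psi (take j u) (drop j u).
Proof.
by rewrite decE -(big_mkord xpredT (fun j => psi (take j u) (drop j u))) /index_iota subn0.
Qed.

(** A nonempty middle block is given by its two ends i < j. *)
Lemma dec_triangle (W : lmodType k) (z : seq T) (Psi : seq T -> seq T -> seq T -> W) :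
  \sum_(j < (size z).+1) \sum_(i < j) Psi (take i z) (drop i (take j z)) (drop j z) =
  dec z (fun u v => dec v (fun B t => if B is [::] then 0 else Psi u B t)).
Proof.
elim: z Psi => [|a z IH] Psi; first by rewrite big_ord1 big_ord0.
transitivity (dec z (fun B t => Psi [::] (a :: B) t) +
    dec z (fun u v => dec v (fun B t => if B is [::] then 0 else Psi (a :: u) B t))); last first.
  by rewrite /= add0r.
rewrite -(IH (fun u => Psi (a :: u))) dec_ord big_ord_recl big_ord0 add0r -big_split.
by apply: eq_bigr => j _; rewrite lift0 big_ord_recl.
Qed.

Lemma sym_mapl (T' : Type) (par' : T' -> bool) (f : T -> T')
    (W : lmodType k) (s : seq T) (phi : seq T' -> W) :
  (forall a, par' (f a) = par a) ->
  sym par' (map f s) phi = sym par s (fun t => phi (map f t)).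
Proof.
move=> Hf; elim: s phi => //= a s IH phi; rewrite IH; congr (sym _ _ _).
apply: funext => t; elim: t phi {IH} => //= b t IH phi; rewrite !Hf; congr (_ + _ *: _).
exact: (IH (fun t => phi (f b :: t))).
Qed.

End ShuffleMap.

Section Associative.
Variables (k : fieldType) (V : dgspace k).
Local Notation P := (Pi V).
Local Notation G := (der_a V).
Local Notation pp := (@fst bool P).
Local Notation lp := (lp pp).
Local Notation sh := (sh pp).
Local Notation sym := (sym pp).
Implicit Types (z u v y ws xs I J K : seq (bool * P)) (f g h : G).

Lemma mval_mlin f : mlin (mval f).
Proof. by have [] := multiP f. Qed.

Lemma mval_nil f : mval f [::] = 0.
Proof. by have [] := multiP f. Qed.

Lemma symform_mlin (W : lmodType k) (g : seq P -> W) b : mlin g ->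
  mlin (fun s => \sum_(w <- permutations (iota 0 (size s))) ksign w b *: g (rearr w s)).
Proof.
move=> Hg s1 s2 a u v _; rewrite !size_cat /= scaler_sumr -big_split /=.
apply: eq_big_seq => w; rewrite mem_permutations => H.
have hs : size w = (size s1 + size s2).+1 by rewrite (perm_size H) size_iota addnS.
have [|r1 [r2 E]] := @rearr_mid P w s1 s2 hs.
  by rewrite hs; apply/allP => i; rewrite (perm_mem H) mem_iota addnS.
by rewrite !E (mlinE Hg) scalerDr !scalerA [a * _]mulrC.
Qed.

Lemma symmetrize_mlin (W : lmodType k) (g : seq P -> W) : mlin g -> mlin (symmetrize g).
Proof. by move=> Hg; apply: kext_mlin => b; apply: symform_mlin. Qed.

Lemma map_rearr (T T' : Type) (f : T -> T') w (s : seq T) :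
  map f (rearr w s) = rearr w (map f s).
Proof.
rewrite /rearr map_flatten size_map -map_comp; congr flatten.
by apply: eq_map => j; rewrite /= blk_map.
Qed.

Lemma symmetrize_good (W : lmodType k) (g : seq P -> W) z : mlin g ->
  all (@good k P) z -> symmetrize g (unzip2 z) = sym z (fun u => g (unzip2 u)).
Proof.
move=> Hg gz; rewrite /symmetrize (kext_good _ gz) => [|b]; last exact: symform_mlin.
rewrite -perm_sym size_map; apply: eq_bigr => w _.
by rewrite /unzip2 map_rearr.
Qed.

Lemma plug_a_mlin f : @mlin k P G (plug_a f).
Proof.
move=> s1 s2 a u v _; apply: multi_eq => -[|x z] gz // _.
rewrite mval_lin /= -!catA !size_cat /=.
have H := kext_mlin (fun b => interleave_mlin (size s1 + (size s2).+1) b (mval_mlin f)).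
exact: (mlinE H).
Qed.

Lemma plug_a_linl (s : seq P) : linear (fun f => plug_a f s : G).
Proof.
move=> a f g; apply: multi_eq => -[|x z] gz // _; rewrite mval_lin /= -kext_comb.
apply: eq_kext => b t; rewrite /interleave scaler_sumr -big_split /=.
by apply: eq_bigr => c _; rewrite scalerDr !scalerA [a * _]mulrC.
Qed.

Lemma plug_a_ord f u xs : all (@good k P) u -> all (@good k P) xs -> xs != [::] ->
  mval (plug_a f (unzip2 u)) (unzip2 xs) = ord pp u xs (fun t => mval f (unzip2 t)).
Proof.
case: xs => // x xs gu gxs _; set y := x :: xs.
transitivity (kext (interleave (mval f) (size u)) (unzip2 (u ++ y))).
  by rewrite /unzip2 map_cat -(size_map snd u).
rewrite (kext_good _ _) => [|b|]; last by rewrite all_cat gu.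
  rewrite /interleave -(interleave_ord pp _ erefl) size_map size_cat.
  apply: eq_bigr => c _; rewrite /unzip1 /unzip2 !map_cat.
  by rewrite !take_size_cat ?drop_size_cat ?size_map // map_weave.
exact: interleave_mlin (mval_mlin f).
Qed.

Lemma act_a_good g z : all (@good k P) z ->
  act_a g (unzip2 z) = sh z [::] (fun t => mval g (unzip2 t)).
Proof. by move=> gz; rewrite /act_a (symmetrize_good (mval_mlin g) gz). Qed.

(** Symmetrized plugging is a sum over shuffles. *)
Lemma plug_sym_good f ws xs : all (@good k P) ws -> all (@good k P) xs -> xs != [::] ->
  mval (plug_sym_a V f (unzip2 ws)) (unzip2 xs) = sh ws xs (fun t => mval f (unzip2 t)).
Proof.
move=> gw gx x0; rewrite /plug_sym_a (symmetrize_good (@plug_a_mlin f) gw).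
rewrite (@sh_map k _ pp _ _ (fun F : G => mval F (unzip2 xs)) ws [::]); last exact: mval_lin.
rewrite -[RHS]sym_ord; apply: (eq_sym_in gw) => u gu _.
exact: plug_a_ord.
Qed.

Lemma comp_a_good q g h z : all (@good k P) z ->
  mval (comp_a q g h) (unzip2 z) =
  dec z (fun u v => dec v (fun B t => sgn (q && lp u) *:
    mval g (unzip2 u ++ mval h (unzip2 B) :: unzip2 t))).
Proof.
move=> gz; rewrite /= (kext_good _ gz) => [|b]; last by apply: insa_mlin; apply: mval_mlin.
have E := dec_triangle z (fun u B t => sgn (q && lp u) *:
    mval g (unzip2 u ++ mval h (unzip2 B) :: unzip2 t)).
apply: etrans (etrans E _).
  rewrite /insa size_map; apply: eq_bigr => j _; apply: eq_bigr => i _.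
  by rewrite /lp /unzip1 /unzip2 !map_take !map_drop map_take.
apply: eq_dec => u v _; apply: eq_dec => -[|b B] t _ //.
by rewrite mval_nil (mlin0 _ _ (mval_mlin g)) scaler0.
Qed.

(** The value of h on the shuffles of J with x2, as a single letter. *)
Definition blockl q h J x2 : bool * P :=
  (q (+) lp J (+) lp x2, sh J x2 (fun t => mval h (unzip2 t))).

Lemma blockl_good q h J x2 : hom q h -> all (@good k P) J -> all (@good k P) x2 ->
  @good k P (blockl q h J x2).
Proof.
move=> hh gJ g2; rewrite /good /=.
apply: (@sh_ind _ _ _ (@good k P) P (fun w => @hom k P (q (+) lp J (+) lp x2) w)) => //.
- exact: hom0.
- by move=> c w w' hw hw'; apply: homD => //; apply: homZ.
by move=> v gv hv; rewrite -addbA -hv; apply: hom_multi.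
Qed.

(** The sum over the arguments of h is absorbed into the letter by linearity. *)
Lemma sh_block (q : bool) g h J K u x2 x3 :
  sh J x2 (fun B => sh K x3 (fun t => sgn (q && lp u) *:
     mval g (unzip2 u ++ mval h (unzip2 B) :: unzip2 t))) =
  sgn (q && lp u) *: sh K x3 (fun t => mval g (unzip2 (u ++ blockl q h J x2 :: t))).
Proof.
pose L (w : P) := sgn (q && lp u) *: sh K x3 (fun t => mval g (unzip2 u ++ w :: unzip2 t)).
have HL : linear L.
  move=> c w w'; rewrite /L -!(linopZ (@sh_lin _ _ pp P K x3)) -(linopD (@sh_lin _ _ pp P K x3)).
  congr (sh _ _ _); apply: funext => t.
  by rewrite (mlinE (mval_mlin g)) scalerDr !scalerA mulrC.
transitivity (sh J x2 (fun B => L (mval h (unzip2 B)))).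
  congr (sh _ _ _); apply: funext => B.
  by rewrite /L (linopZ (@sh_lin _ _ pp P K x3)).
rewrite -(sh_map _ _ _ _ HL) /L; congr (_ *: sh _ _ _); apply: funext => t.
by rewrite /unzip2 map_cat.
Qed.

Definition blocks q g h I J K y1 x2 x3 : P :=
  sh I y1 (fun u => sh K x3 (fun t => mval g (unzip2 (u ++ blockl q h J x2 :: t)))).

(** Two applications of [sh_dec], one for each end of the block on which h is
evaluated. *)
Lemma sh_comp q g h z y :
  sh z y (fun v => dec v (fun u v' => dec v' (fun B t => sgn (q && lp u) *:
    mval g (unzip2 u ++ mval h (unzip2 B) :: unzip2 t)))) =
  spl pp z (fun I M => spl pp M (fun J K => dec y (fun y1 y2 => dec y2 (fun x2 x3 =>
    sgn (((lp J (+) lp K) && lp y1) (+) (lp K && lp x2) (+) (q && (lp I (+) lp y1))) *: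
    blocks q g h I J K y1 x2 x3)))).
Proof.
rewrite sh_dec; apply: eq_spl => I M.
transitivity (dec y (fun y1 y2 => spl pp M (fun J K => dec y2 (fun x2 x3 =>
    sgn (((lp J (+) lp K) && lp y1) (+) (lp K && lp x2) (+) (q && (lp I (+) lp y1))) *:
    blocks q g h I J K y1 x2 x3)))); last exact: dec_spl.
apply: eq_dec => y1 y2 _.
rewrite -(linopZ (@sh_lin _ _ pp P I y1)).
transitivity (sh I y1 (fun u => spl pp M (fun J K => dec y2 (fun x2 x3 =>
   sgn (((lp J (+) lp K) && lp y1) (+) (lp K && lp x2) (+) (q && lp u)) *:
   sh K x3 (fun t => mval g (unzip2 (u ++ blockl q h J x2 :: t))))))).
  congr (sh _ _ _); apply: funext => u; rewrite sh_dec -splZ.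
  apply: lp_split => J K ->; rewrite -decZ; apply: eq_dec => x2 x3 _.
  by rewrite sh_block; ssign.
rewrite (spl_linop _ (@sh_lin _ _ pp P I y1)); apply: eq_spl => J K.
rewrite (dec_linop (@sh_lin _ _ pp P I y1)); apply: eq_dec => x2 x3 _.
rewrite -(linopZ (@sh_lin _ _ pp P I y1)).
apply: (@eq_sh_in _ _ pp predT) => [||u _ ->] //; exact: all_predT.
Qed.

(** In [sh_comp], the block x2 of free arguments of h may be empty or not.  If not,
h is twisted by J, and by [sh_mid] the letters I and K on the two sides of its
value are the ones plugged into g.  If it is empty, the value of h on J is itself
a letter shuffled into the word ([sh_cons], [ins_decE]). *)
Lemma plug_comp_a p q g h z : hom p g -> hom q h -> all (@good k P) z ->
  plug_sym_a V (comp_a q g h) (unzip2 z) =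
  spl pp z (fun I J => sgn (q && lp I) *:
     (comp_a (q (+) lp J) (plug_sym_a V g (unzip2 I)) (plug_sym_a V h (unzip2 J)) : G)) +
  spl pp z (fun I J => plug_sym_a V g (act_a h (unzip2 I) :: unzip2 J)).
Proof.
move=> hg hh gz; apply: multi_eq => y gy y0.
have hyl := mval_lin (unzip2 y).
rewrite [RHS](lin_add hyl) !(spl_map _ _ _ hyl) plug_sym_good //.
have -> : sh z y (fun t => mval (comp_a q g h) (unzip2 t)) =
  sh z y (fun v => dec v (fun u v' => dec v' (fun B t => sgn (q && lp u) *:
    mval g (unzip2 u ++ mval h (unzip2 B) :: unzip2 t)))).
  by apply: (eq_sh_in gz gy) => v gv _; apply: comp_a_good.
rewrite sh_comp.
pose F I J K y1 x2 x3 := sgn (((lp J (+) lp K) && lp y1) (+) (lp K && lp x2)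
    (+) (q && (lp I (+) lp y1))) *: blocks q g h I J K y1 x2 x3.
(* The block x2 of free arguments of h is nonempty or empty. *)
transitivity (spl pp z (fun I M => spl pp M (fun J K => dec y (fun y1 y2 => dec y2 (fun x2 x3 =>
     if x2 is [::] then 0 else F I J K y1 x2 x3)))) +
   spl pp z (fun I M => spl pp M (fun J K => dec y (fun y1 y2 => F I J K y1 [::] y2)))).
  rewrite -splD; apply: eq_spl => I M; rewrite -splD; apply: eq_spl => J K.
  by rewrite -decD; apply: eq_dec => y1 y2 _; rewrite addrC; exact: dec_split.
congr (_ + _).
  rewrite (eq_spl _ _ (fun I M => spl_comm _ _ _)) spl_coassoc.
  apply: (@eq_spl_in _ _ _ (@good k P)) => // I' J gI' gJ _ _.
  rewrite (lin_scale hyl) comp_a_good //.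
  transitivity (spl pp I' (fun I K => dec y (fun y1 y2 => dec y2 (fun x2 x3 =>
      sgn (lp K && lp J) *: if x2 is [::] then 0 else F I J K y1 x2 x3)))).
    apply: eq_spl => I K; rewrite -decZ; apply: eq_dec => y1 y2 _.
    by rewrite -decZ.
  rewrite -dec_spl -decZ; apply: eq_dec => y1 y2 Ey.
  rewrite -dec_spl -decZ; apply: eq_dec => -[|b x2'] x3 Ex.
    rewrite [mval _ (unzip2 [::])]mval_nil (mlin0 _ _ (mval_mlin _)) !scaler0.
    by rewrite -[RHS](spl0 pp P I'); apply: eq_spl => I K; rewrite scaler0.
  set x2 := b :: x2'; move: gy; rewrite Ey Ex -/x2 !all_cat => /and3P[g1 g2 g3].
  rewrite (plug_sym_good h gJ g2) //.
  have -> : unzip2 y1 ++ sh J x2 (fun t => mval h (unzip2 t)) :: unzip2 x3 =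
            unzip2 (y1 ++ blockl q h J x2 :: x3) by rewrite /unzip2 map_cat.
  rewrite plug_sym_good //; last 2 first.
  - by rewrite all_cat g1 /= blockl_good.
  - by case: (y1).
  rewrite sh_mid -!splZ; apply: lp_split => I K ->; rewrite /F /blocks -/x2.
  clearbody x2.
  have -> : lp (rcons y1 (blockl q h J x2)) = lp y1 (+) (q (+) lp J (+) lp x2).
    by rewrite -cats1 lp_cat /lp /= addbF.
  by ssign.
(* All arguments of h are plugged in, and its value is the letter aJ. *)
rewrite spl_swap; apply: (@eq_spl_in _ _ _ (@good k P)) => // J N gJ gN _ _.
pose aJ := blockl q h J [::].
have gaJ : @good k P aJ by apply: blockl_good.
have EJ : act_a h (unzip2 J) :: unzip2 N = unzip2 (aJ :: N).
  by rewrite act_a_good.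
rewrite EJ plug_sym_good //=; last by rewrite gaJ.
rewrite sh_cons.
transitivity (sh N y (fun v => dec v (fun u t => sgn (aJ.1 && lp u) *:
    mval g (unzip2 (u ++ aJ :: t))))); last first.
  by congr (sh _ _ _); apply: funext => v; rewrite ins_decE.
rewrite sh_dec; apply: eq_spl => I K; rewrite -decZ; apply: eq_dec => y1 y2 _.
transitivity (sgn (lp K && lp y1) *: (sgn (aJ.1 && (lp I (+) lp y1)) *: blocks q g h I J K y1 [::] y2)).
  have -> : aJ.1 = q (+) lp J by rewrite /= addbF.
  by rewrite /F (_ : lp [::] = false) //; ssign.
congr (_ *: _); rewrite /blocks -(linopZ (@sh_lin _ _ pp P I y1)).
apply: (@eq_sh_in _ _ pp predT) => [||u _ <-]; try exact: all_predT.
by rewrite -(linopZ (@sh_lin _ _ pp P K y2)).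
Qed.

Lemma dif_a_hom : hom true (dif_a V).
Proof.
apply: multi_hom => -[|a [|b z]] gz _ //=; rewrite ?hom0 //.
by move: gz => /= /andP[ga _]; rewrite /lp /= addbF; apply: dif_hom.
Qed.

Lemma act_a_linl s : linear (fun f => act_a f s).
Proof.
move=> a f g; rewrite /act_a /symmetrize -kext_comb; apply: eq_kext => b t.
rewrite scaler_sumr -big_split /=; apply: eq_bigr => w _.
by rewrite scalerDr !scalerA [a * _]mulrC.
Qed.

Lemma act_a_mlin g : mlin (act_a g).
Proof. exact: symmetrize_mlin (mval_mlin g). Qed.

Lemma act_a_sym g : @ksym k P V (act_a g).
Proof.
apply: ksym_good => [|z1 z2 x y gz]; first exact: act_a_mlin.
rewrite !act_a_good //; first exact: sh_swap.
by move: gz; rewrite !all_cat /= (andbCA (good x)).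
Qed.

Lemma act_a_nil g : act_a g [::] = 0.
Proof. by rewrite (@act_a_good g [::]) //= mval_nil. Qed.

Lemma hom_sh p f ws xs : hom p f -> all (@good k P) ws -> all (@good k P) xs ->
  @hom k P (p (+) lp ws (+) lp xs) (sh ws xs (fun t => mval f (unzip2 t))).
Proof. by move=> hf gw gx; have := blockl_good hf gw gx. Qed.

Lemma act_a_hom p g z : hom p g -> all (@good k P) z ->
  @hom k P (p (+) lp z) (act_a g (unzip2 z)).
Proof.
by move=> hg gz; rewrite act_a_good //; have := hom_sh (xs := [::]) hg gz isT; rewrite addbF.
Qed.

Lemma plug_sym_linl s : linear (fun f => plug_sym_a V f s).
Proof.
move=> a f g; rewrite /plug_sym_a /symmetrize -kext_comb; apply: eq_kext => b t.
rewrite scaler_sumr -big_split /=; apply: eq_bigr => w _.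
by rewrite plug_a_linl scalerDr !scalerA [a * _]mulrC.
Qed.

Lemma plug_sym_mlin f : mlin (plug_sym_a V f).
Proof. exact: symmetrize_mlin (@plug_a_mlin f). Qed.

Lemma plug_sym_sym f : @ksym k P G (plug_sym_a V f).
Proof.
apply: ksym_good => [|z1 z2 x y gz]; first exact: plug_sym_mlin.
have gz' : all (@good k P) (z1 ++ y :: x :: z2).
  by move: gz; rewrite !all_cat /= (andbCA (good x)).
apply: multi_eq => v gv v0; rewrite [RHS](lin_scale (mval_lin _)).
by rewrite !plug_sym_good // sh_swap.
Qed.

Lemma plug_sym_nil f : plug_sym_a V f [::] = f.
Proof.
apply: multi_eq => z gz z0.
by rewrite (@plug_sym_good f [::]) // sh_nil.
Qed.

Lemma plug_sym_hom p g z : hom p g -> all (@good k P) z ->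
  hom (p (+) lp z) (plug_sym_a V g (unzip2 z)).
Proof.
move=> hg gz; apply: multi_hom => v gv v0.
by rewrite plug_sym_good //; apply: hom_sh.
Qed.

Lemma sh_plug_sym g z1 z2 v : all (@good k P) z1 -> all (@good k P) z2 ->
  all (@good k P) v -> z2 ++ v <> [::] ->
  sh z2 v (fun t => mval (plug_sym_a V g (unzip2 z1)) (unzip2 t)) =
  sh z2 v (fun t => sh z1 t (fun t' => mval g (unzip2 t'))).
Proof.
move=> g1 g2 gv n0.
transitivity (sh z2 v (fun t => if t is [::] then 0 else
    sh z1 t (fun t' => mval g (unzip2 t')))); last exact: eq_sh_cons.
apply: (eq_sh_in g2 gv) => t gt _; case: t gt => [|b t] gt; first exact: mval_nil.
exact: plug_sym_good.
Qed.

Lemma comp_a_linl q h : linear (fun g => comp_a q g h : G).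
Proof.
move=> a g g'; apply: multi_eq => z gz _; rewrite mval_lin !comp_a_good //.
rewrite -decZ -decD; apply: eq_dec => u v _; rewrite -decZ -decD.
by apply: eq_dec => B t _; rewrite mval_lin scalerDr !scalerA [a * _]mulrC.
Qed.

Lemma comp_a_linr q g : linear (fun h => comp_a q g h : G).
Proof.
move=> a h h'; apply: multi_eq => z gz _; rewrite mval_lin !comp_a_good //.
rewrite -decZ -decD; apply: eq_dec => u v _; rewrite -decZ -decD.
apply: eq_dec => B t _; rewrite mval_lin (mlinE (mval_mlin g)).
by rewrite scalerDr !scalerA [a * _]mulrC.
Qed.

Lemma dif_act_a (s : seq V) : act_a (dif_a V) s = if s is [:: w] then - dif w else 0.
Proof.
have E : act_a (dif_a V) = (fun s => if s is [:: w] then - dif w else 0).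
  apply: (@mlin_eq k P); first exact: act_a_mlin.
    by case: (arity1_multi (@opp_dif_linear k V)).
  move=> z gz; rewrite act_a_good //; case: z gz => [|a [|b z]] gz //.
  rewrite !sh_cons -[RHS](linop0 (@sh_lin _ _ pp P z [::])).
  congr (sh _ _ _); apply: funext => u.
  apply: ins_cons0 => c v /=; rewrite add0r.
  by rewrite ins_cons0 ?scaler0.
by rewrite E.
Qed.

Lemma act_plug_a g z1 z2 : all (@good k P) z1 -> all (@good k P) z2 -> z2 != [::] ->
  act_a (plug_sym_a V g (unzip2 z1)) (unzip2 z2) = act_a g (unzip2 (z1 ++ z2)).
Proof.
move=> g1 g2 z20; rewrite !act_a_good ?all_cat ?g1 // -sh_sh.
by apply: sh_plug_sym => //; case: (z2) z20.
Qed.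

Lemma plug_plug_a g z1 z2 : all (@good k P) z1 -> all (@good k P) z2 ->
  plug_sym_a V (plug_sym_a V g (unzip2 z1)) (unzip2 z2) = plug_sym_a V g (unzip2 (z1 ++ z2)).
Proof.
move=> g1 g2; apply: multi_eq => v gv v0.
rewrite !plug_sym_good ?all_cat ?g1 // -sh_sh.
by apply: sh_plug_sym => //; case: (z2) (v) v0 => [|b z2'] [|c v'].
Qed.

(** Plugging in a letter requires arity at least two. *)
Lemma dif_plug_a (s : seq P) : s != [::] -> plug_sym_a V (dif_a V) s = 0.
Proof.
move=> s0.
have E : plug_sym_a V (dif_a V) = (fun s => if s is [::] then dif_a V else 0).
  apply: (@mlin_eq k P); first exact: plug_sym_mlin.
    by move=> [|x s1] s2 a u v _; rewrite /= scaler0 addr0.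
  move=> z gz; case: z gz => [|a z] gz; first exact: plug_sym_nil.
  apply: multi_eq => v gv v0; rewrite plug_sym_good // sh_cons.
  rewrite -[RHS](linop0 (@sh_lin _ _ pp P z v)); apply: eq_sh_cons.
    by case: (z) (v) v0 => [|b z'] [|c v'].
  by move=> b u /=; rewrite add0r ins_cons0 ?scaler0.
by rewrite E; case: (s) s0.
Qed.

Definition twistable_a : twistable V.
refine (@Twistable k V G (@comp_a k P) (dif_a V) (@act_a k V) (plug_sym_a V)
  comp_a_linl comp_a_linr dif_a_hom act_a_linl
  act_a_mlin act_a_sym act_a_nil act_a_hom plug_sym_linl plug_sym_mlin
  plug_sym_sym plug_sym_nil plug_sym_hom act_plug_a plug_plug_a plug_comp_a dif_act_a dif_plug_a).
Defined.

End Associative.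

(** * Symplectic derivations of the tensor algebra *)

Section SymEvaluation.
Variables (k : fieldType) (A : nilcdga k) (W : lmodType k).
Local Notation Ix := 'I_(nc_dim A).
Local Notation par := (@nc_par k A).
Local Notation e := (@nc_e k A).
Implicit Types (s : seq A) (js : seq Ix) (p : bool) (phi : seq Ix -> W).

(** All n + 1 places in which an even element is inserted contribute equally. *)
Lemma ev_ins p s n phi :
  \sum_(j <- enum Ix) sgn (p && par j) *:
     ev (p (+) par j) (s ++ [:: e j]) n (fun js => ins par j js phi) =
  n.+1%:R *: ev p s n.+1 phi.
Proof.
elim: n p s phi => [|n IH] p s phi.
  rewrite scale1r ev_cons; apply: eq_bigr => j _; congr (_ *: _).
  by rewrite !ev_word0.
rewrite [n.+2%:R](natrD k 1 n.+1) scalerDl scale1r.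
transitivity (\sum_(j <- enum Ix) (sgn (p && par j) *:
     ev (p (+) par j) (s ++ [:: e j]) n.+1 (fun js => phi (j :: js)) +
   \sum_(b <- enum Ix) sgn (p && par b) *: (sgn ((p (+) par b) && par j) *:
     ev (p (+) par b (+) par j) ((s ++ [:: e b]) ++ [:: e j]) n
       (fun js => ins par j js (fun t => phi (b :: t)))))).
  apply: eq_bigr => j _; rewrite [in LHS]ev_cons [in RHS]ev_cons scaler_sumr [in RHS]scaler_sumr.
  rewrite -[RHS]big_split; apply: eq_bigr => b _ /=.
  rewrite evD evZ !scalerDr; congr (_ + _).
  rewrite -!catA (ev_move _ s [:: b] _ _ (@e_hom k A j)) !scalerA -!signr_addb.
  rewrite (addbAC p); congr (sgn _ *: _); rewrite /lp /= addbF.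
  by case: p; case: (par j); case: (par b).
rewrite big_split /=; congr (_ + _); first by rewrite -ev_cons.
rewrite exchange_big /= ev_cons scaler_sumr; apply: eq_bigr => b _ /=.
by rewrite -scaler_sumr IH !scalerA mulrC.
Qed.

(** Copies of one even element may be permuted freely. *)
Lemma ev_sym p s n phi :
  ev p s n (fun js => sym par js phi) = n`!%:R *: ev p s n phi.
Proof.
elim: n p s phi => [|n IH] p s phi; first by rewrite scale1r !ev_word0.
rewrite factS mulnC natrM -scalerA -ev_ins ev_cons scaler_sumr.
by apply: eq_bigr => j _; rewrite [in LHS]IH !scalerA mulrC.
Qed.

End SymEvaluation.

Section CyclicTwist.
Variables (k : fieldType) (V : dgspace k).
Local Notation P := (Pi V).
Local Notation pp := (@fst bool P).
Local Notation lp := (lp pp).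
Local Notation sh := (sh pp).
Local Notation sym := (sym pp).
Implicit Types (z u v ws xs : seq (bool * P)) (g : der_a V).

Lemma plug_a_ev (A : nilcdga k) (xi : tensor A V) g q (a : A) r :
  (forall l, @hom k P (nc_par l) (xi l)) ->
  ev q [:: a] r (fun ks => plug_sym_a V g (map xi ks)) =
  (r`!%:R * 1) *: ev q [:: a] r (fun ks => (plug_a g (map xi ks) : der_a V)).
Proof.
move=> hxi; rewrite mulr1 -ev_sym; apply: eq_ev => ks.
pose f l : bool * P := (nc_par l, xi l).
have E (js : seq 'I_(nc_dim A)) : map xi js = unzip2 (map f js) by rewrite /unzip2 -map_comp.
rewrite E /plug_sym_a (symmetrize_good (@plug_a_mlin k V g)); last first.
  by rewrite all_map; apply/allP => l _; exact: hxi.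
rewrite (@sym_mapl k _ (@nc_par k A)) //.
by apply: eq_sym_lp => u _; rewrite E.
Qed.

Section ScalarProduct.
Variable B : scalar_product V.
Local Notation om := (omega B : V -> V -> k^o).
Local Notation Om := (fun g z => omega_fun B (mval g) (unzip2 z) : k^o).

Lemma symplectic_aP g : symplectic_a B g <->
  forall z x, all (@good k P) z -> @good k P x ->
    Om g (rcons z x) = sgn (x.1 && lp z) *: Om g (x :: z).
Proof.
split=> [H z [p x] gz gx|H b p s x hs hx].
  by rewrite -(H _ _ _ _ (good_homs gz) gx) /unzip2 map_rcons.
have := H (zip b s) (p, x) (homs_good hs) hx.
rewrite /unzip2 map_rcons /= -/(unzip2 _) unzip2_zip ?(homs_size hs) //.
by rewrite lp_unzip unzip1_zip ?(homs_size hs).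
Qed.

(** Cyclic invariance moves a whole block at once. *)
Lemma omega_rot g z1 z2 : symplectic_a B g ->
  all (@good k P) z1 -> all (@good k P) z2 ->
  Om g (z1 ++ z2) = sgn (lp z1 && lp z2) *: Om g (z2 ++ z1).
Proof.
move=> /symplectic_aP Hg; elim: z2 z1 => [|x z2 IH] z1 g1.
  by rewrite cats0 andbF scale1r.
case/andP=> gx g2; rewrite -cat_rcons IH // ?all_rcons ?gx //.
rewrite -rcons_cat Hg // ?all_cat ?g1 ?andbT //.
by rewrite -cats1 (_ : lp (z1 ++ [:: x]) = lp z1 (+) x.1) ?lp_cat /lp /= ?addbF //; ssign.
Qed.

Lemma omega_rcons g z x : Om g (rcons z x) = om (mval g (unzip2 z)) x.2.
Proof. by rewrite /unzip2 map_rcons omega_fun_rcons. Qed.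

Lemma symplectic_a0 : symplectic_a B 0.
Proof.
have E s : omega_fun B (mval (0 : der_a V)) s = 0.
  by case/lastP: s => // s y; rewrite omega_fun_rcons; exact: (lin_0 (@omega_linl k V B y)).
by move=> b p s x _ _; rewrite !E scaler0.
Qed.

Lemma symplectic_a_comb a g h : symplectic_a B g -> symplectic_a B h ->
  symplectic_a B (a *: g + h).
Proof.
move=> Hg Hh b p t x ht hx.
have E s : omega_fun B (mval (a *: g + h)) s =
    a *: (omega_fun B (mval g) s : k^o) + omega_fun B (mval h) s.
  case/lastP: s => [|s y]; first by rewrite /= scaler0 addr0.
  by rewrite !omega_fun_rcons; exact: (@omega_linl k V B y).
rewrite !E (Hg _ _ _ _ ht hx) (Hh _ _ _ _ ht hx) [in RHS]scalerDr !scalerA.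
by rewrite mulrC.
Qed.

Lemma symplectic_a_pr p g : symplectic_a B g -> symplectic_a B (pr p g).
Proof.
move=> /symplectic_aP Hg; apply/symplectic_aP => z x gz gx.
have E v : all (@good k P) v -> Om (pr p g) v = if p (+) lp v == sp_par B then Om g v else 0.
  move=> gv; apply: omega_fun_pr => //; last exact: mval_nil.
  by move=> z0 h0; apply: pr_multi.
rewrite !E /= ?all_rcons ?gx // Hg //.
have -> : lp (rcons z x) = lp (x :: z) by rewrite -cats1 lp_cat lp_cons /lp /= addbF addbC.
by case: ifP => _ //; rewrite scaler0.
Qed.

(** With omega the values are cyclic words of the shape (t, l, u, x), where t and u
are the blocks between the marked letters l and x.  Evaluating at l or at x gives
the two sides, with the blocks exchanged. *)
Lemma symplectic_a_plug g ws : all (@good k P) ws -> symplectic_a B g ->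
  symplectic_a B (plug_sym_a V g (unzip2 ws)).
Proof.
move=> gw Hg; apply/symplectic_aP => z l gz gl.
case/lastP: z gz => [|xs x]; first by rewrite andbF scale1r.
rewrite all_rcons => /andP[gx gxs].
rewrite -rcons_cons !omega_rcons !plug_sym_good ?all_rcons ?gx ?gl //; last by case: (xs).
rewrite -cats1 sh_mid [sh ws (l :: xs) _]/=.
rewrite !(spl_map _ _ _ (@omega_linl k V B _)).
rewrite [in RHS]spl_comm -splZ; apply: (@eq_spl_in _ _ _ (@good k P)) => // I J gI gJ _ _.
rewrite !(lin_scale (@omega_linl k V B _)) !(sh_map _ _ _ _ (@omega_linl k V B _)).
(* The block t and the letter l after it are rotated to the front. *)
transitivity (sgn (lp J && lp (rcons xs x)) *: sh I xs (fun u => sym J (fun t =>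
    (sgn ((lp I (+) lp xs (+) x.1) && (lp J (+) l.1)) *: Om g (t ++ l :: rcons u x) : k^o)))).
  congr (_ *: _); apply: (eq_sh_in gI gxs) => u gu hu.
  rewrite (@sh_map k _ pp _ _ (om^~ l.2) J [::]); last exact: omega_linl.
  apply: (eq_sym_in gJ) => t gt ht.
  rewrite -[LHS]omega_rcons rcons_cat rcons_cons -cat_rcons omega_rot // ?all_rcons ?gx ?gl //.
  by rewrite cat_rcons -!cats1 !lp_cat /lp /= !addbF -/(lp u) -/(lp t) hu ht.
rewrite -(sh_linop pp (@sym_lin _ _ pp k^o J)).
have -> : om (sym J (fun t => sh I xs (fun v => mval g (unzip2 (t ++ l :: v))))) x.2 =
    sym J (fun t => sh I xs (fun v => Om g (t ++ l :: rcons v x))).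
  rewrite (@sh_map k _ pp _ _ (om^~ x.2) J [::]); last exact: omega_linl.
  congr (sym _ _); apply: funext => t.
  rewrite (sh_map _ _ _ _ (@omega_linl k V B x.2)); congr (sh _ _ _).
  by apply: funext => v; rewrite -rcons_cons -rcons_cat omega_rcons.
rewrite -!(linopZ (@sym_lin _ _ pp k^o J)); congr (sym _ _); apply: funext => t.
rewrite -!(linopZ (@sh_lin _ _ pp k^o I xs)); congr (sh _ _ _); apply: funext => v.
have Ex : lp (rcons xs x) = lp xs (+) x.1 by rewrite -cats1 lp_cat /lp /= addbF.
by rewrite cats1 Ex; ssign.
by rewrite /= gl.
Qed.

End ScalarProduct.
End CyclicTwist.

Section AssociativeMain.
Variables (k : fieldType) (V : dgspace k).
Hypothesis char0 : [pchar k] =i pred0.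
Local Notation T := (twistable_a V).

Lemma twist_automorphism_a : exists tw : seq (a_tilde V) -> a_tilde V,
     [/\ tw_components (plug_sym_a V) tw,
         [/\ Linfty_aut (a_tilde V) tw,
             functor_aut (a_tilde V) (tw_a V) &
             induced_by (a_tilde V) (tw_a V) tw] &
         forall B : scalar_product V,
           [/\ Linfty_aut (as_tilde B) tw,
               functor_aut (as_tilde B) (tw_a V) &
               induced_by (as_tilde B) (tw_a V) tw]].
Proof.
exists (@tw k V T).
have H (S : der_a V -> Prop) : S 0 -> (forall a g h, S g -> S h -> S (a *: g + h)) ->
    (forall p g, S g -> S (pr p g)) ->
    (forall g (z : seq (bool * Pi V)), all (@good k (Pi V)) z -> S g ->
       S (plug_sym_a V g (unzip2 z))) ->
    let L := @tilde k (der_a V) V S (@br_a k V) (dif_a V) (@act_a k V) (@dif k V) in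
    [/\ Linfty_aut L (@tw k V T), functor_aut L (tw_a V) & induced_by L (tw_a V) (@tw k V T)].
  move=> S0 SP Spr Splug L; have [SD SZ] := linear_closed2 S0 SP.
  have [H1 H2] := @tilde_functor k V T char0 (fun _ => 1) (@plug_a k (Pi V))
    (@plug_a_linl k V) (@plug_a_ev k V) S S0 SD SZ Spr Splug.
  split=> //.
  exact: (@Linfty_aut_tw k V T char0 S S0 SD SZ Spr Splug).
split; first exact: (tw_components_of T).
  exact: (H (fun _ => True)).
move=> B; apply: (H (symplectic_a B)).
- exact: symplectic_a0.
- exact: symplectic_a_comb.
- exact: symplectic_a_pr.
by move=> g z; exact: symplectic_a_plug.
Qed.

End AssociativeMain.

Theorem theorem4p6 (k : fieldType) (char0 : [pchar k] =i pred0) (V : dgspace k) :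
  (exists tw : seq (c_tilde V) -> c_tilde V,
     [/\ tw_components (plug_c V) tw,
         [/\ Linfty_aut (c_tilde V) tw,
             functor_aut (c_tilde V) (tw_c V) &
             induced_by (c_tilde V) (tw_c V) tw] &
         forall B : scalar_product V,
           [/\ Linfty_aut (cs_tilde B) tw,
               functor_aut (cs_tilde B) (tw_c V) &
               induced_by (cs_tilde B) (tw_c V) tw]])
  /\
  (exists tw : seq (a_tilde V) -> a_tilde V,
     [/\ tw_components (plug_sym_a V) tw,
         [/\ Linfty_aut (a_tilde V) tw,
             functor_aut (a_tilde V) (tw_a V) &
             induced_by (a_tilde V) (tw_a V) tw] &
         forall B : scalar_product V,
           [/\ Linfty_aut (as_tilde B) tw,
               functor_aut (as_tilde B) (tw_a V) &
               induced_by (as_tilde B) (tw_a V) tw]]).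
Proof.
exact: (conj (twist_automorphism_c V char0) (twist_automorphism_a V char0)).
Qed.
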